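(* Let $P\subset\mathbb R^d$ be a $d$-dimensional parallelohedron and let $\mathcal T_P$ be the corresponding face-to-face tiling of $\mathbb R^d$ by translates of $P$. Then the Voronoi conjecture holds for $P$ (that is, $P$ is affinely equivalent to some Voronoi parallelohedron) if and only if the tiling $\mathcal T_P$ admits a canonical scaling.
   Context: A $d$-dimensional parallelohedron is a convex $d$-dimensional polytope $P\subset\mathbb R^d$ whose translates tile $\mathbb R^d$ in a normal (face-to-face) way: the intersection of any two of the translates is either empty or a common whole face of both. The tiling is denoted $\mathcal T_P$. It is classical that $P$ and all its $(d-1)$-faces are centrally symmetric. A Voronoi parallelohedron is the Dirichlet domain of some point $\mathbf p$ of a $d$-dimensional lattice $\Lambda^d\subset\mathbb R^d$, i.e. $\{\mathbf x\in\mathbb R^d:\|\mathbf x-\mathbf p\|\le\|\mathbf x-\mathbf q\|\ \forall \mathbf q\in\Lambda^d\}$. Hyperfaces are the $(d-1)$-faces of the cells of the tiling; $\mathcal F^{d-1}$ is the set of all hyperfaces. Let $s:\mathcal F^{d-1}\to\mathbb R_+$ be a positive function (a scaling). For a $(d-2)$-face $F$ of the tiling, take all hyperfaces containing $F$, in their cyclic order around $F$ (as seen by projecting along the affine hull of $F$ onto a complementary 2-plane); for each such hyperface $F_i$ let $\mathbf n_i$ be its unit normal pointing in the chosen direction of going around $F$. The torsion is $\Delta_s(F)=\sum_i s(F_i)\mathbf n_i$, the sum being over all hyperfaces containing $F$ (it depends on the direction only up to sign). The scaling $s$ is canonical if $\Delta_s(F)=0$ for every $(d-2)$-face $F$ of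 the tiling. *)

(* Defs.v *)
From HB Require Import structures.
From mathcomp Require Export all_boot all_order all_algebra.
From mathcomp Require Export all_classical all_reals all_analysis.
Export Order.TTheory GRing.Theory Num.Theory.
Export numFieldNormedType.Exports.

Set Implicit Arguments.
Unset Strict Implicit.
Unset Printing Implicit Defensive.

Global Open Scope classical_set_scope.
Global Open Scope ring_scope.

Section Euclidean.
Context {R : realType} {d : nat}.
Implicit Types u v x y : 'rV[R]_d.

Definition dot u v : R := \sum_i u 0 i * v 0 i.

(* The norm `|u| of the library on 'rV[R]_d is the sup norm. *)
Definition enorm u : R := Num.sqrt (dot u u).

Definition translate (A : set 'rV[R]_d) u : set 'rV[R]_d :=
  [set x + u | x in A].

(* U is the direction space of the affine hull of A *)
Definition direction (A : set 'rV[R]_d) (U : {vspace 'rV[R]_d}) : Prop :=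
  (forall x y, A x -> A y -> x - y \in U) /\
  (forall W : {vspace 'rV[R]_d},
      (forall x y, A x -> A y -> x - y \in W) -> (U <= W)%VS).

Definition has_dim (A : set 'rV[R]_d) (k : nat) : Prop :=
  A !=set0 /\ exists2 U, direction A U & \dim U = k.

Definition convex_hull (A : set 'rV[R]_d) : set 'rV[R]_d :=
  smallest (fun B => convex_set B) A.

Definition polytope (P : set 'rV[R]_d) : Prop :=
  exists s : seq 'rV[R]_d, P = convex_hull [set` s].

(* A nonempty face is the set where some linear functional attains its maximum
   over A; a = 0 gives A itself. The empty face is excluded. *)
Definition face (A F : set 'rV[R]_d) : Prop :=
  F !=set0 /\
  exists a, F = [set x | A x /\ forall y, A y -> dot a y <= dot a x].

End Euclidean.

Section Tilings.
Context {R : realType} {d : nat}.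
Implicit Types (P T F G : set 'rV[R]_d) (e n : 'rV[R]_d).

(* T is the set of translation vectors: the cells are P + t with t in T. *)
Definition face_to_face_tiling P T : Prop :=
  [/\ \bigcup_(t in T) translate P t = setT,
      forall t t', T t -> T t' -> t <> t' ->
        (translate P t)° `&` (translate P t')° = set0 &
      forall t t', T t -> T t' ->
        let I := translate P t `&` translate P t' in
        I = set0 \/ (face (translate P t) I /\ face (translate P t') I)].

Definition parallelohedron P : Prop :=
  [/\ polytope P, has_dim P d & exists T, face_to_face_tiling P T].

Definition tiling_face P T F : Prop :=
  exists2 t, T t & face (translate P t) F.

Definition hyperface P T G : Prop :=
  tiling_face P T G /\ exists2 k, has_dim G k & k.+1 = d.

Definition codim2_face P T F : Prop :=
  tiling_face P T F /\ exists2 k, has_dim F k & k.+2 = d.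

(* A direction of going around a (d-2)-face F is an orientation of the 2-plane
   orthogonal to F, given by an orthonormal basis (e1, e2) of that plane;
   x |-> (dot e1 x, dot e2 x) is then the projection along the affine hull of F,
   and the chosen direction is the counterclockwise one. *)
Definition around F e1 e2 : Prop :=
  [/\ enorm e1 = 1, enorm e2 = 1, dot e1 e2 = 0 &
      forall x y, F x -> F y -> dot e1 (x - y) = 0 /\ dot e2 (x - y) = 0].

(* A hyperface G containing F projects into a ray issued from the projection of
   F, spanned by the projection of y - x for any x in F and y in G outside F.
   The unit normal n of G points counterclockwise when (y - x, n) projects to a
   positively oriented pair, i.e. one of positive determinant. *)
Definition unit_normal_along e1 e2 F G n : Prop :=
  [/\ enorm n = 1,
      forall x y, G x -> G y -> dot n (x - y) = 0 &
      forall x y, F x -> G y -> ~ F y ->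
        0 < dot e1 (y - x) * dot e2 n - dot e2 (y - x) * dot e1 n].

Definition unit_normal e1 e2 F G : 'rV[R]_d :=
  xget 0 [set n | unit_normal_along e1 e2 F G n].

(* Only finitely many hyperfaces contain F, so this finitely supported sum is
   the sum over all of them. The cyclic order of the hyperfaces matters only
   through the direction (e1, e2), the sum being commutative. *)
Definition torsion P T (s : set 'rV[R]_d -> R) e1 e2 F : 'rV[R]_d :=
  \sum_(G \in [set G | hyperface P T G /\ F `<=` G])
    s G *: unit_normal e1 e2 F G.

(* Only the values of s on the hyperfaces of the tiling matter. *)
Definition scaling P T (s : set 'rV[R]_d -> R) : Prop :=
  forall G, hyperface P T G -> 0 < s G.

Definition canonical_scaling P T (s : set 'rV[R]_d -> R) : Prop :=
  scaling P T s /\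
  forall F e1 e2, codim2_face P T F -> around F e1 e2 ->
    torsion P T s e1 e2 F = 0.

End Tilings.

Section Voronoi.
Context {R : realType} {d : nat}.

(* the full-rank lattice whose basis consists of the rows of B *)
Definition lattice (B : 'M[R]_d) : set 'rV[R]_d :=
  [set map_mx intr z *m B | z in [set: 'rV[int]_d]].

Definition dirichlet_domain (L : set 'rV[R]_d) (p : 'rV[R]_d) :
    set 'rV[R]_d :=
  [set x | forall q, L q -> enorm (x - p) <= enorm (x - q)].

Definition voronoi_parallelohedron (Q : set 'rV[R]_d) : Prop :=
  exists (B : 'M[R]_d) (p : 'rV[R]_d),
    [/\ B \in unitmx, lattice B p & Q = dirichlet_domain (lattice B) p].

Definition affinely_equivalent (P Q : set 'rV[R]_d) : Prop :=
  exists (A : 'M[R]_d) (b : 'rV[R]_d),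
    A \in unitmx /\ Q = [set x *m A + b | x in P].

Definition voronoi_conjecture_holds (P : set 'rV[R]_d) : Prop :=
  exists2 Q, voronoi_parallelohedron Q & affinely_equivalent P Q.

End Voronoi.

(* Main.v *)
From HB Require Import structures.
Require Import Defs.
From mathcomp Require Import ring lra zify.

Set Implicit Arguments.
Unset Strict Implicit.
Unset Printing Implicit Defensive.

(** The torsion condition is a closedness condition, and a canonical scaling is
    the gradient jump of a convex piecewise linear function on the tiling.

    The whole tiling is encoded by finite data of one cell, a [facet_system]:
    the finite set L of vectors l such that the cells t and t + l share a
    facet, the unit outer normal n l of that facet and its height.  A
    hyperface is then a pair (t, l), up to the exchange with (t + l, - l), and
    the torsion at a codimension two face is, up to sign, a sum of s (t, l) n l
    over the pairs (t, l) met when turning around that face ([canonical_star]).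
    A function j of these pairs whose sums around all codimension two faces
    vanish is called a star; if moreover it changes sign under the exchange of
    the two cells, it is the difference of a function on the cells
    ([potential]).  This is the statement that a closed cochain is exact.  It
    is proved without homotopies: a sum of crossings along a generic triangle
    is computed by counting the endpoints of the segments that facets cut out
    of the triangle ([jump_triangle]).

    Necessity.  If P is affinely a Dirichlet cell, then for the positive
    definite form A of the Voronoi structure each facet vector l satisfies
    l A = s(l) n l with s(l) > 0: the facet (t, l) lies in the mediator of t and
    t + l ([facet_vector]).  Hence the torsion is the image by A of the sum of
    the vectors l met around a face, and that sum telescopes ([rot_telescope]).

    Sufficiency.  A half-plane argument shows that at a codimension two face
    the facets are either at most three, with ratios of the scaling that are
    forced, or pair off into opposite ones with equal values
    ([ridge_dichotomy]).  So the ratio of two values of a scaling is the same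
    for all scalings along chains of such forced relations.  The values along
    the translates of a facet in such a chain grow like a character exp ell of
    the period lattice ([log_character]).  A nontrivial character is only
    possible when all facets of the chain are parallel, because the potential
    of the chain is then an eigenvector of the translations
    ([unbalanced_parallel]).  In all cases the chain carries a star invariant
    under translations, and adding these stars gives a canonical scaling w that
    depends on l only ([periodic_solution_exists]).

    For such a w, the potential of w(l) n l is affine, so l A = w(l) n l for
    a matrix A; the potential of the constant terms gives the symmetry of A;
    crossing facets in the direction of a segment gives its positivity.  The
    cell is then described by the inequalities 2 (l A)(x - p) <= (l A) l
    ([cell_form]), and after a Cholesky change of coordinates it is the
    Dirichlet domain of the lattice of periods ([form_voronoi]). *)

(** * Scalar products *)

(** Baire is used in [avoid_zeros]. *)
HB.instance Definition _ (K : realType) m n := Complete.on 'M[K]_(m, n).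

Section Dot.
Context {R : realType} {d : nat}.
Implicit Types (u v w x y : 'rV[R]_d) (k : R).

Lemma dotC u v : dot u v = dot v u.
Proof. by apply: eq_bigr => i _; rewrite mulrC. Qed.

Lemma dotDl u v w : dot (u + v) w = dot u w + dot v w.
Proof. by rewrite -big_split; apply: eq_bigr => i _; rewrite mxE mulrDl. Qed.

Lemma dotZl k u v : dot (k *: u) v = k * dot u v.
Proof. by rewrite mulr_sumr; apply: eq_bigr => i _; rewrite mxE mulrA. Qed.

Lemma dotDr u v w : dot u (v + w) = dot u v + dot u w.
Proof. by rewrite ![dot u _]dotC dotDl. Qed.

Lemma dotZr k u v : dot u (k *: v) = k * dot u v.
Proof. by rewrite ![dot u _]dotC dotZl. Qed.

Lemma dotNl u v : dot (- u) v = - dot u v.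
Proof. by rewrite -scaleN1r dotZl mulN1r. Qed.

Lemma dotNr u v : dot u (- v) = - dot u v.
Proof. by rewrite ![dot u _]dotC dotNl. Qed.

Lemma dot0l u : dot 0 u = 0.
Proof. by rewrite -(scale0r u) dotZl mul0r. Qed.

Lemma dot0r u : dot u 0 = 0.
Proof. by rewrite dotC dot0l. Qed.

Definition dotE :=
  (dotDl, dotDr, dotNl, dotNr, dotZl, dotZr, dot0l, dot0r).

Lemma dot_suml (I : Type) (r : seq I) (Q : pred I) (F : I -> 'rV[R]_d) u :
  dot (\sum_(i <- r | Q i) F i) u = \sum_(i <- r | Q i) dot (F i) u.
Proof.
by elim/big_rec2: _ => [|i a b _ <-]; rewrite ?dot0l ?dotDl.
Qed.

Lemma dot_ge0 u : 0 <= dot u u.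
Proof. by apply: sumr_ge0 => i _; rewrite -expr2 sqr_ge0. Qed.

Lemma dot_eq0 u : (dot u u == 0) = (u == 0).
Proof.
apply/eqP/eqP => [/eqP|->]; last by rewrite dot0l.
rewrite psumr_eq0 => [/allP u0|i _]; last by rewrite -expr2 sqr_ge0.
apply/rowP => i; rewrite mxE; apply/eqP.
by have := u0 i (mem_index_enum _); rewrite /= mulf_eq0 orbb.
Qed.

Lemma dot_gt0 u : (0 < dot u u) = (u != 0).
Proof. by rewrite lt_def dot_ge0 andbT dot_eq0. Qed.

Lemma sqr_enorm u : enorm u ^+ 2 = dot u u.
Proof. by rewrite sqr_sqrtr ?dot_ge0. Qed.

Lemma enorm_eq1 u : enorm u = 1 -> dot u u = 1.
Proof. by move=> u1; rewrite -sqr_enorm u1 expr1n. Qed.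

Lemma enorm_le u v : (enorm u <= enorm v) = (dot u u <= dot v v).
Proof. by rewrite ler_sqrt ?dot_ge0. Qed.

Lemma dot_mulmx u (A : 'M[R]_d) v : dot (u *m A) v = dot u (v *m A^T).
Proof.
have dotM x y : dot x y = (x *m y^T) 0 0.
  by rewrite mxE; apply: eq_bigr => i _; rewrite mxE.
by rewrite !dotM trmx_mul trmxK mulmxA.
Qed.

Lemma coord_norm u i : `|u 0 i| <= `|u|.
Proof.
rewrite [leRHS]mx_normrE.
exact: (le_bigmax _ (fun ij => `|u ij.1 ij.2|) (0, i)).
Qed.

Lemma norm_mulmx u (A : 'M[R]_d) : `|u *m A| <= (\sum_i `|row i A|) * `|u|.
Proof.
rewrite mulmx_sum_row; apply: le_trans (ler_norm_sum _ _ _) _.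
rewrite mulr_suml; apply: ler_sum => i _; rewrite normrZ mulrC ler_wpM2l //.
exact: coord_norm.
Qed.

Lemma dot_norm_le u v : `|dot u v| <= (d%:R * `|u|) * `|v|.
Proof.
apply: le_trans (ler_norm_sum _ _ _) _.
have H i : `|u 0 i * v 0 i| <= `|u| * `|v|.
  by rewrite normrM; apply: ler_pM => //; exact: coord_norm.
apply: le_trans (ler_sum _ (fun i _ => H i)) _.
by rewrite sumr_const card_ord -[_ *+ d]mulr_natl mulrA.
Qed.

Lemma dot_continuous u : continuous (dot u).
Proof.
have H : 0 < d%:R * `|u| + 1 by rewrite ltr_wpDl ?mulr_ge0.
move=> x A /nbhs_ballP[e /= e0 eA]; apply/nbhs_ballP.
exists (e / (d%:R * `|u| + 1)); first by rewrite /= divr_gt0.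
move=> y; rewrite mx_norm_ball /ball_ /= ltr_pdivlMr // mulrC => xy.
apply: eA; rewrite -ball_normE /ball_ /= -dotNr -dotDr.
by apply: le_lt_trans xy; apply: le_trans (dot_norm_le _ _) _;
  rewrite ler_wpM2r // lerDl.
Qed.

(** A neighbourhood contains a piece of every line through its centre; this
    avoids balls of the sup norm in all later arguments. *)
Lemma open_line (A : set 'rV[R]_d) x v : nbhs x A ->
  exists2 e, 0 < e & forall k, `|k| < e -> A (x + k *: v).
Proof.
have H : 0 < `|v| + 1 by rewrite ltr_wpDl.
move=> /nbhs_ballP[e /= e0 eA].
exists (e / (`|v| + 1)) => [|k]; first by rewrite divr_gt0.
rewrite ltr_pdivlMr // => ke; apply: eA; rewrite mx_norm_ball /ball_ /=.
rewrite opprD addNKr normrN normrZ; apply: le_lt_trans ke.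
by rewrite ler_wpM2l // lerDl.
Qed.

Lemma open_gt u k : open [set x | k < dot u x].
Proof.
by apply: (open_comp (f := dot u) (D := [set r | k < r]));
  [move=> x _; exact: dot_continuous | exact: open_gt].
Qed.

Lemma open_lt u k : open [set x | dot u x < k].
Proof.
by apply: (open_comp (f := dot u) (D := [set r | r < k]));
  [move=> x _; exact: dot_continuous | exact: open_lt].
Qed.

Lemma closed_le u k : closed [set x | dot u x <= k].
Proof.
rewrite (_ : mkset _ = ~` [set x | k < dot u x]).
  by apply: open_closedC; exact: open_gt.
apply/seteqP; split => x /=; first by move=> h; apply/negP; rewrite -leNgt.
by move/negP; rewrite -leNgt.
Qed.

Lemma dot_unit_le1 u v : dot u u = 1 -> dot v v = 1 -> `|dot u v| <= 1.
Proof.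
move=> uu vv; rewrite ler_norml; apply/andP; split.
  by have := dot_ge0 (u + v); rewrite !dotE uu vv (dotC v u); lra.
by have := dot_ge0 (u - v); rewrite !dotE uu vv (dotC v u); lra.
Qed.

(** Otherwise the translates x + k v would leave every ball. This is how two
    translation vectors that move a bounded set into itself are identified. *)
Lemma bounded_periodic (A : set 'rV[R]_d) M x v : (forall y, A y -> `|y| <= M) -> A x ->
  (forall y, A y -> A (y + v)) -> v = 0.
Proof.
move=> HM Ax Av; apply/eqP/negPn/negP => v0.
have H (k : nat) : A (x + k%:R *: v).
  elim: k => [|k IH]; first by rewrite scale0r addr0.
  by rewrite -natr1 scalerDl scale1r addrA; exact: Av.
have v0' : 0 < `|v| by rewrite normr_gt0.
have := HM _ (H (Num.truncn ((M + `|x|) / `|v|)).+1).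
rewrite leNgt => /negP; apply.
have := truncnS_gt ((M + `|x|) / `|v|); set k := (Num.truncn _).+1.
rewrite ltr_pdivrMr // => K.
have : `|k%:R *: v| <= `|x + k%:R *: v| + `|x|.
  have {1}-> : k%:R *: v = (x + k%:R *: v) - x by rewrite addrC addKr.
  exact: ler_normB.
rewrite normrZ ger0_norm // => K2.
by have := lt_le_trans K K2; rewrite ltrD2r.
Qed.
End Dot.

(** Baire: the complement of the zero set of a nonconstant affine function is
    open and dense. *)
Lemma avoid_zeros {R : realType} {d : nat} (A : set ('rV[R]_d * R))
    (O : set 'rV[R]_d) :
  countable A -> (forall a, A a -> a.1 != 0) -> open O -> O !=set0 ->
  exists2 x, O x & forall a, A a -> dot a.1 x + a.2 != 0.
Proof.
move=> /countable_injP[f finj] A0 Oop O0.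
pose F k : set 'rV[R]_d :=
  [set x | forall a, A a -> f a = k -> dot a.1 x + a.2 != 0].
have HF k : open (F k) /\ dense (F k).
  have [[a [Aa fa]]|no] := pselect (exists a, A a /\ f a = k); last first.
    have -> : F k = setT.
      by apply/seteqP; split => x // _ a Aa fa; case: no; exists a.
    by split; [exact: openT | move=> B B0 _; rewrite setIT].
  have FE : F k = [set x | dot a.1 x + a.2 != 0].
    apply/seteqP; split => x /=; first by move/(_ _ Aa fa).
    move=> ax b Ab fb; have -> // : b = a.
    by apply: finj; rewrite ?inE // fa fb.
  rewrite FE; split.
    have -> : [set x | dot a.1 x + a.2 != 0] =
        [set x | dot a.1 x < - a.2] `|` [set x | - a.2 < dot a.1 x].
      apply/seteqP; split => x /=; rewrite addr_eq0 neq_lt.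
        by move/orP.
      by move=> h; apply/orP.
    by apply: openU; [exact: open_lt | exact: open_gt].
  move=> B [x Bx] Bop; have [e e0 He] := open_line a.1 (open_nbhs_nbhs (conj Bop Bx)).
  have [ax0|ax] := eqVneq (dot a.1 x + a.2) 0; last by exists x.
  exists (x + (e / 2) *: a.1); split => /=.
    by apply: He; rewrite ger0_norm ?divr_ge0 ?ltW // ltr_pdivrMr // mulr2n mulrDr mulr1 ltrDl.
  rewrite !dotE addrAC ax0 add0r mulf_neq0 ?dot_eq0 ?A0 //.
  by rewrite mulf_neq0 ?invr_eq0 ?gt_eqF.
have [x [Ox Fx]] := Baire HF O0 Oop.
by exists x => // a Aa; apply: (Fx (f a)).
Qed.

(** * Facet systems *)

(** The finite description of the tiling of the space by the cells P + t. The
    vectors l of [fvec] lead from a cell to its neighbours across facets, [nrm]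
    and [hgt] give the inequality of the facet, [apt] a point of the facet that
    lies on no other one, and [ctr] a point inside P. In [facewise], a cell t' that
    contains x contains every point x + w such that x lies strictly between
    x + w and another point of the cell t: this is what remains of the
    face-to-face condition. *)
Record facet_system {R : realType} {d : nat} (P T : set 'rV[R]_d) := FacetSystem {
  fvec : seq 'rV[R]_d;
  nrm : 'rV[R]_d -> 'rV[R]_d;
  hgt : 'rV[R]_d -> R;
  apt : 'rV[R]_d -> 'rV[R]_d;
  ctr : 'rV[R]_d;
  fvec_uniq : uniq fvec;
  cellE : forall x, P x <-> forall l, l \in fvec -> dot (nrm l) x <= hgt l;
  nrm1 : forall l, l \in fvec -> dot (nrm l) (nrm l) = 1;
  fvecN : forall l, l \in fvec -> - l \in fvec;
  nrmN : forall l, l \in fvec -> nrm (- l) = - nrm l;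
  hgtN : forall l, l \in fvec -> hgt (- l) = dot (nrm l) l - hgt l;
  apt_eq : forall l, l \in fvec -> dot (nrm l) (apt l) = hgt l;
  apt_lt : forall l m, l \in fvec -> m \in fvec -> m != l ->
    dot (nrm m) (apt l) < hgt m;
  ctr_lt : forall l, l \in fvec -> dot (nrm l) ctr < hgt l;
  step : forall t l, T t -> l \in fvec -> T (t + l);
  adj : forall l x, l \in fvec -> P x -> dot (nrm l) x = hgt l -> P (x - l);
  interior_disjoint : forall t t' x, T t -> T t' ->
    (forall l, l \in fvec -> dot (nrm l) (x - t) < hgt l) ->
    P (x - t') -> t = t';
  covered : forall x, exists2 t, T t & P (x - t);
  facewise : forall t t' x w r, T t -> T t' -> P (x - t) -> P (x - t') ->
    0 < r -> P (x + w - t) -> P (x - r *: w - t) -> P (x + w - t');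
  bounded : exists M, forall x, P x -> `|x| <= M;
  locfin : forall M, finite_set [set t | T t /\ `|t| <= M]
}.

Section Core.
Context {R : realType} {d : nat} {P T : set 'rV[R]_d} (D : facet_system P T).
Implicit Types (t x y f u v w l m e : 'rV[R]_d).
Local Notation L := (fvec D).
Local Notation n := (nrm D).
Local Notation h := (hgt D).

(** The point x lies on the hyperplane of the facet l of the cell P + t. *)
Definition tight t x l := (l \in L) && (dot (n l) (x - t) == h l).

Lemma tightP t x l : reflect (l \in L /\ dot (n l) (x - t) = h l) (tight t x l).
Proof. by apply: (iffP andP) => -[? /eqP]. Qed.

Lemma tight_shift t x l v : tight (t + v) (x + v) l = tight t x l.
Proof. by rewrite /tight opprD addrACA subrr addr0. Qed.

Lemma nrm_inj l m : l \in L -> m \in L -> n l = n m -> l = m.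
Proof.
move=> lL mL lm; apply/eqP/negPn/negP => nlm.
have := apt_lt mL lL nlm; rewrite lm apt_eq // => H1.
move: nlm; rewrite eq_sym => /(apt_lt lL mL); rewrite -lm apt_eq // => H2.
by have := lt_trans H1 H2; rewrite ltxx.
Qed.

Lemma nrm_opp l m : l \in L -> m \in L -> n m = - n l -> m = - l.
Proof.
move=> lL mL lm; apply: nrm_inj => //; first exact: fvecN.
by rewrite nrmN.
Qed.

Lemma nrm_parallel l m b c : l \in L -> m \in L -> b != 0 ->
  b *: n l + c *: n m = 0 -> m = l \/ m = - l.
Proof.
move=> lL mL b0 H.
have nlE : n l = - (c / b) *: n m.
  apply: (scalerI b0); rewrite scalerA mulrN mulrCA divff // mulr1 scaleNr.
  by apply/eqP; rewrite -addr_eq0 H.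
have := nrm1 lL; rewrite nlE !dotE (nrm1 mL) mulr1 mulrNN => /eqP.
rewrite -expr2 sqrf_eq1 => /orP[/eqP cb|/eqP cb].
  right; apply: nrm_opp => //; apply/eqP.
  by rewrite nlE cb scaleN1r opprK.
by left; apply: nrm_inj; rewrite // nlE cb opprK scale1r.
Qed.

Lemma tight_indep t x l m b c : tight t x l -> tight t x m -> l != m ->
  b *: n l + c *: n m = 0 -> b = 0 /\ c = 0.
Proof.
move=> /tightP[lL xl] /tightP[mL xm] lm H.
have lNm : m != - l.
  apply/eqP => mE; move: xm; rewrite mE => xm.
  have := ctr_lt (fvecN lL); have := ctr_lt lL; move: xm.
  rewrite nrmN // hgtN // !dotNl xl; lra.
have bc : b = 0.
  apply/eqP/negPn/negP => b0; case: (nrm_parallel lL mL b0 H) => mE.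
    by rewrite mE eqxx in lm.
  by rewrite mE eqxx in lNm.
split=> //; move: H; rewrite bc scale0r add0r => /eqP; rewrite scaler_eq0.
case/orP=> [/eqP //|/eqP n0]; move: (nrm1 mL); rewrite n0 dot0l => /eqP.
by rewrite eq_sym oner_eq0.
Qed.

Lemma cell_facet t x l : P (x - t) -> l \in L -> dot (n l) (x - t) <= h l.
Proof. by move=> /cellE; apply. Qed.

(** Near a point of a cell only the constraints that are tight there matter. *)
Lemma cell_ray t x v : P (x - t) ->
  (forall l, tight t x l -> dot (n l) v <= 0) ->
  exists2 e, 0 < e & forall k, 0 <= k -> k <= e -> P (x + k *: v - t).
Proof.
move=> Px tv.
have H (s : seq 'rV[R]_d) : {subset s <= L} ->
  exists2 e, 0 < e & forall k l, 0 <= k -> k <= e -> l \in s ->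
    dot (n l) (x + k *: v - t) <= h l.
  elim: s => [|l s IH] sL; first by exists 1.
  have [|e e0 He] := IH; first by move=> z zs; apply: sL; rewrite inE zs orbT.
  have lL : l \in L by apply: sL; rewrite inE eqxx.
  have [vl|vl] := lerP (dot (n l) v) 0.
    exists e => // k m k0 ke; rewrite inE => /orP[/eqP ->|]; last exact: He.
    rewrite addrAC dotDr dotZr; have := cell_facet Px lL.
    have : k * dot (n l) v <= 0 by rewrite mulr_ge0_le0.
    lra.
  have xl : dot (n l) (x - t) < h l.
    rewrite lt_neqAle cell_facet // andbT; apply/negP => xl.
    by have := tv l; rewrite /tight lL xl leNgt vl => /(_ isT).
  exists (Num.min e ((h l - dot (n l) (x - t)) / dot (n l) v)).
    by rewrite lt_min e0 divr_gt0 ?subr_gt0.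
  move=> k m k0; rewrite le_min => /andP[ke kl].
  rewrite inE => /orP[/eqP ->|]; last exact: He.
  rewrite addrAC dotDr dotZr; move: kl; rewrite ler_pdivlMr //; lra.
have [e e0 He] := H L (fun _ => id).
by exists e => // k k0 ke; apply/cellE => l lL; exact: He.
Qed.

Lemma cell_ray_int t x v : P (x - t) ->
  (forall l, tight t x l -> dot (n l) v < 0) ->
  exists2 e, 0 < e & forall k, 0 < k -> k <= e ->
    forall l, l \in L -> dot (n l) (x + k *: v - t) < h l.
Proof.
move=> Px tv; have [|e e0 He] := cell_ray (v := v) Px.
  by move=> l /tv /ltW.
exists (e / 2) => [|k k0 ke l lL]; first by rewrite divr_gt0.
rewrite addrAC dotDr dotZr.
have : P (x + (2 * k) *: v - t) by apply: He; lra.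
move=> /cell_facet /(_ lL); rewrite addrAC dotDr dotZr => H2.
have := cell_facet Px lL; rewrite le_eqVlt => /orP[/eqP xl|]; last by lra.
have /tv : tight t x l by rewrite /tight lL xl eqxx.
by rewrite xl gtrDl pmulr_rlt0.
Qed.

Lemma ctr_cell : P (ctr D).
Proof. by apply/cellE => l lL; apply/ltW/ctr_lt. Qed.

(** A line through x along which the cell t extends in both directions is, by
    the face-to-face condition, also contained in the other cells at x. *)
Lemma tight_lines t t' x v : T t -> T t' -> P (x - t) -> P (x - t') ->
  (forall l, tight t x l -> dot (n l) v = 0) ->
  forall l, tight t' x l -> dot (n l) v = 0.
Proof.
move=> Tt Tt' Px Px' tv l /tightP[lL xl].
have [|e1 e10 H1] := cell_ray (v := v) Px; first by move=> m /tv ->.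
have [|e2 e20 H2] := cell_ray (v := - v) Px.
  by move=> m /tv; rewrite dotNr => ->; rewrite oppr0.
pose e := Num.min e1 e2.
have e0 : 0 < e by rewrite /e lt_min e10.
have A1 : P (x + e *: v - t) by apply: H1; [exact: ltW | rewrite /e ge_min lexx].
have A2 : P (x - e *: v - t).
  by rewrite -scalerN; apply: H2; [exact: ltW | rewrite /e ge_min lexx orbT].
have B1 : P (x + e *: v - t').
  by apply: (facewise D Tt Tt' Px Px' ltr01 A1); rewrite scale1r.
have B2 : P (x - e *: v - t').
  by apply: (facewise D Tt Tt' Px Px' ltr01 A2); rewrite scale1r opprK.
have := cell_facet B1 lL; have := cell_facet B2 lL.
rewrite (addrAC x (e *: v)) (addrAC x (- (e *: v))).
rewrite ![dot _ (x - t' + _)]dotDr dotNr dotZr xl => C1 C2.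
have : e * dot (n l) v = 0 by lra.
by move=> /eqP; rewrite mulf_eq0 (gt_eqF e0) => /eqP.
Qed.

Lemma neighbour_cell t x l : P (x - t) -> tight t x l -> P (x - (t + l)).
Proof. by move=> Px /tightP[lL xl]; rewrite opprD addrA; exact: (adj lL Px xl). Qed.

Lemma neighbour_tight t x l : tight t x l -> tight (t + l) x (- l).
Proof.
move=> /tightP[lL xl]; rewrite /tight fvecN //= nrmN // hgtN //.
by rewrite dotNl opprD addrA dotDr xl dotNr opprD opprK addrC.
Qed.

Lemma tight_opp t x l : l \in L -> tight (t + l) x (- l) = tight t x l.
Proof.
move=> lL; apply/idP/idP; last exact: neighbour_tight.
by move=> /neighbour_tight; rewrite addrK opprK.
Qed.

End Core.

(** * The cells around a codimension two face *)

Section Ridge.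

(** The sign bookkeeping of [turn_neighbour]. *)
Lemma sign_compare (F : realDomainType) (x y z w : F) :
  x * z <= 0 -> y * z < 0 -> y != 0 -> w = - x -> w != 0 -> (w < 0) = (0 < y).
Proof.
move=> H1 H2 y0 -> {w}; rewrite oppr_eq0 oppr_lt0 => x0.
case: (ltrgtP 0 z) H1 H2 => [z0|z0|<-]; last by rewrite !mulr0 ltxx.
  rewrite pmulr_lle0 // pmulr_llt0 // => x1 y1.
  by rewrite !ltNge x1 (ltW y1).
rewrite nmulr_lle0 // nmulr_llt0 // => x1 y1.
by rewrite y1 lt_def x1 x0.
Qed.

Context {R : realType} {d : nat} {P T : set 'rV[R]_d} (D : facet_system P T).
Implicit Types (t x y f u v w l m k e : 'rV[R]_d).
Local Notation L := (fvec D).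
Local Notation n := (nrm D).
Local Notation a := (apt D).
Local Notation tight := (tight D).

(** The oriented area of the projections to the plane of e1 and e2. *)
Definition cross e1 e2 u v : R := dot e1 u * dot e2 v - dot e2 u * dot e1 v.

Definition in_plane e1 e2 u := u = dot e1 u *: e1 + dot e2 u *: e2.

Definition orthonormal e1 e2 :=
  [/\ dot e1 e1 = 1, dot e2 e2 = 1 & dot e1 e2 = 0].

Lemma in_plane_comb e1 e2 b c : orthonormal e1 e2 ->
  in_plane e1 e2 (b *: e1 + c *: e2).
Proof.
move=> [e11 e22 e12]; rewrite /in_plane !dotE (dotC e2 e1) e11 e22 e12.
by rewrite !mulr1 !mulr0 addr0 add0r.
Qed.

Lemma in_plane_dot e1 e2 u v : in_plane e1 e2 u ->
  dot u v = dot e1 u * dot e1 v + dot e2 u * dot e2 v.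
Proof. by move=> {1}->; rewrite !dotE. Qed.

(** The point f lies in the relative interior of a codimension two face of
    the tiling whose orthogonal plane has the orthonormal basis (e1, e2): the
    normals tight at f span this plane. *)
Definition ridge f e1 e2 := orthonormal e1 e2 /\
  forall t, T t -> P (f - t) ->
    (forall l, tight t f l -> in_plane e1 e2 (n l)) /\
    exists l m, [/\ tight t f l, tight t f m & l != m].

(** One cell is enough: the lines through f inside a cell are common to all the
    cells at f by [tight_lines], so that they all have the same span of tight
    normals. *)
Lemma ridge_of_cell f t e1 e2 l m : orthonormal e1 e2 -> T t -> P (f - t) ->
  (forall k, tight t f k -> in_plane e1 e2 (n k)) ->
  tight t f l -> tight t f m -> l != m -> ridge f e1 e2.
Proof.
move=> ON Tt Pt pl tl tm lm; split=> // t' Tt' Pt'.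
have [e11 e22 e12] := ON; have e21 : dot e2 e1 = 0 by rewrite dotC.
have pl' k : tight t' f k -> in_plane e1 e2 (n k).
  move=> tk; pose w := n k - (dot e1 (n k) *: e1 + dot e2 (n k) *: e2).
  have w1 : dot e1 w = 0 by rewrite !dotE e11 e12 mulr1 mulr0 addr0 subrr.
  have w2 : dot e2 w = 0 by rewrite !dotE e22 e21 mulr1 mulr0 add0r subrr.
  have kw : dot (n k) w = 0.
    apply: (tight_lines Tt Tt' Pt Pt' _ tk) => j /pl /in_plane_dot ->.
    by rewrite w1 w2 !mulr0 addr0.
  have : dot w w = dot (n k) w -
      (dot e1 (n k) * dot e1 w + dot e2 (n k) * dot e2 w).
    by rewrite [in LHS]/w dotDl dotNl dotDl !dotZl.
  rewrite kw w1 w2 !mulr0 addr0 subrr => /eqP.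
  by rewrite dot_eq0 subr_eq0 => /eqP.
split=> //.
have [//|no] := pselect (exists l m, [/\ tight t' f l, tight t' f m & l != m]).
have [c [c1 uc]] : exists c, in_plane e1 e2 c /\ dot c c = 1 /\
    forall k, tight t' f k -> n k = c.
  have [[k tk]|nk] := pselect (exists k, tight t' f k); last first.
    exists e1; split; last by split=> // k tk; case: nk; exists k.
    by rewrite /in_plane e11 e21 scale0r addr0 scale1r.
  exists (n k); split; first exact: pl'.
  split; first by apply: nrm1; case/tightP: tk.
  move=> j tj; congr (n _); apply/eqP/negPn/negP => jk; apply: no.
  by exists j, k.
case: uc => cc uc; exfalso.
move: (cc); rewrite (in_plane_dot _ c1) => cc'.
pose w := - dot e2 c *: e1 + dot e1 c *: e2.
have w1 : dot e1 w = - dot e2 c by rewrite !dotE e11 e12; ring.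
have w2 : dot e2 w = dot e1 c by rewrite !dotE e22 e21; ring.
have W k : tight t f k -> dot (n k) w = 0.
  apply: (tight_lines Tt' Tt Pt' Pt) => j /uc ->.
  by rewrite (in_plane_dot _ c1) w1 w2; ring.
have E k : tight t f k -> n k = dot (n k) c *: c.
  move=> tk; have := W _ tk.
  have /in_plane_dot K := pl _ tk; rewrite !K w1 w2 => H.
  rewrite [in LHS](pl _ tk).
  move: (c1) => /(congr1 ( *:%R (dot e1 (n k) * dot e1 c + dot e2 (n k) * dot e2 c))) ->.
  rewrite scalerDr !scalerA; move: cc' H.
  move: (dot e1 c) (dot e2 c) (dot e1 (n k)) (dot e2 (n k)) => c1' c2' x y cc' H.
  congr (_ *: _ + _ *: _).
    transitivity (x * (c1' * c1' + c2' * c2') + c2' * (x * - c2' + y * c1')).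
      by rewrite cc' H; ring.
    ring.
  transitivity (y * (c1' * c1' + c2' * c2') - c1' * (x * - c2' + y * c1')).
    by rewrite cc' H; ring.
  ring.
case: (tight_indep (b := dot (n m) c) (c := - dot (n l) c) tl tm lm).
  rewrite [X in _ *: X + _](E _ tl) [X in _ + _ *: X](E _ tm).
  by rewrite !scalerA -scalerDl mulNr mulrC subrr scale0r.
move=> _ /eqP; rewrite oppr_eq0 => /eqP l0.
have := E _ tl; rewrite l0 scale0r => nl0.
case/tightP: tl => /nrm1; rewrite nl0 dot0l => /eqP.
by rewrite eq_sym oner_eq0.
Qed.

(** Gram and Schmidt applied to the normals n l and n m. *)
Lemma mk_ridge f t l m : T t -> P (f - t) ->
  tight t f l -> tight t f m -> l != m ->
  (forall k, tight t f k -> exists b c, n k = b *: n l + c *: n m) ->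
  exists e1 e2, ridge f e1 e2.
Proof.
move=> Tt Pt tl tm lm span.
have l1 : dot (n l) (n l) = 1 by apply: nrm1; case/tightP: tl.
pose b := dot (n l) (n m); pose w := n m - b *: n l.
have w0 : w != 0.
  apply/eqP => w0; have [] := tight_indep (b := - b) (c := 1) tl tm lm.
    by rewrite scale1r scaleNr addrC.
  by move=> _ /eqP; rewrite oner_eq0.
pose s := Num.sqrt (dot w w).
have s0 : 0 < s by rewrite sqrtr_gt0 dot_gt0.
have ss : s * s = dot w w by rewrite -expr2 sqr_sqrtr ?dot_ge0.
have lw : dot (n l) w = 0 by rewrite !dotE l1 mulr1 subrr.
have ON : orthonormal (n l) (s^-1 *: w).
  split=> //; rewrite !(dotZl, dotZr) ?lw ?mulr0 // -ss; field.
  by rewrite gt_eqF.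
exists (n l), (s^-1 *: w); apply: (ridge_of_cell ON Tt Pt _ tl tm lm).
move=> k /span[x [y ->]].
have -> : x *: n l + y *: n m = (x + y * b) *: n l + (y * s) *: (s^-1 *: w).
  rewrite scalerA -mulrA divff ?gt_eqF // mulr1 /w scalerBr scalerDl scalerA.
  by rewrite -addrA; congr (_ + _); rewrite addrC subrK.
exact: in_plane_comb.
Qed.

Section AtRidge.
Variables (f e1 e2 : 'rV[R]_d) (rf : ridge f e1 e2).

(** Positive when the facet l of the cell t leaves f in the direction that is
    obtained by turning its outer normal counterclockwise. *)
Definition turn t l := cross e1 e2 (n l) (a l + t - f).

Local Notation cr := (cross e1 e2).

Lemma cr_anti u v : cr u v = - cr v u.
Proof. by rewrite /cross; ring. Qed.

Lemma crossNl u v : cr (- u) v = - cr u v.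
Proof. by rewrite /cross !dotNr !mulNr opprD. Qed.

(** In the plane, v is orthogonal to the unit vector u, hence a multiple of u
    turned by a right angle. *)
Lemma cr_dot u u' v : in_plane e1 e2 u -> in_plane e1 e2 u' ->
  dot u u = 1 -> dot u v = 0 -> dot u' v = cr u v * cr u u'.
Proof.
move=> pu pu'; rewrite (in_plane_dot _ pu) (in_plane_dot _ pu).
rewrite (in_plane_dot _ pu') /cross => H1 H2.
have -> : dot e1 u' * dot e1 v + dot e2 u' * dot e2 v =
  (dot e1 u * dot e1 u + dot e2 u * dot e2 u) *
  (dot e1 u' * dot e1 v + dot e2 u' * dot e2 v) by rewrite H1 mul1r.
apply/eqP; rewrite -subr_eq0; apply/eqP.
transitivity ((dot e1 u * dot e1 u' + dot e2 u * dot e2 u') *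
  (dot e1 u * dot e1 v + dot e2 u * dot e2 v)); last by rewrite H2 mulr0.
by ring.
Qed.

Lemma tight_facet_dir t l : tight t f l -> dot (n l) (a l + t - f) = 0.
Proof.
move=> /tightP[lL tl].
by rewrite -addrA -opprB dotDr dotNr tl apt_eq // subrr.
Qed.

Lemma tight_facet_lt t l m : tight t f l -> tight t f m -> m != l ->
  dot (n m) (a l + t - f) < 0.
Proof.
move=> /tightP[lL tl] /tightP[mL tm] ml.
by rewrite -addrA -opprB dotDr dotNr tm subr_lt0 apt_lt.
Qed.

(** The other facet of the cell lies on the inner side of the facet l. *)
Lemma turn_cr t l m : T t -> P (f - t) -> tight t f l -> tight t f m ->
  m != l -> turn t l * cr (n l) (n m) < 0.
Proof.
move=> Tt Pt tl tm ml; have [_ /(_ t Tt Pt)[pl _]] := rf.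
rewrite -cr_dot; [exact: tight_facet_lt | exact: pl | exact: pl | |].
  by apply: nrm1; case/tightP: tl.
exact: tight_facet_dir.
Qed.

Lemma ridge_other t l : T t -> P (f - t) -> exists2 m, tight t f m & m != l.
Proof.
move=> Tt Pt; have [_ /(_ t Tt Pt)[_ [k [m [tk tm km]]]]] := rf.
have [kl|kl] := eqVneq k l; last by exists k.
by exists m; rewrite // -kl eq_sym.
Qed.

Lemma turn_neq0 t l : T t -> P (f - t) -> tight t f l -> turn t l != 0.
Proof.
move=> Tt Pt tl; have [m tm ml] := ridge_other l Tt Pt.
by apply/eqP => t0; have := turn_cr Tt Pt tl tm ml; rewrite t0 mul0r ltxx.
Qed.

(** Of two facets of a cell at f each lies on the inner side of the other, so
    they leave f with opposite signs of [turn]. *)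
Lemma diamond t : T t -> P (f - t) -> exists l m,
  [/\ tight t f l, tight t f m, 0 < turn t l, turn t m < 0 &
      forall k, tight t f k -> k = l \/ k = m].
Proof.
move=> Tt Pt.
have U k j : tight t f k -> tight t f j -> 0 < turn t k * turn t j -> k = j.
  move=> tk tj kj; apply/eqP/negPn/negP => nkj.
  have := turn_cr Tt Pt tj tk nkj; rewrite eq_sym in nkj.
  have := turn_cr Tt Pt tk tj nkj; rewrite (cr_anti (n j)) mulrN oppr_lt0.
  move: kj; set x := turn t k; set y := turn t j; set z := cr _ _ => H1 H2 H3.
  have : x * z * (y * z) < 0 by rewrite nmulr_rlt0.
  by rewrite mulrACA pmulr_rlt0 // -expr2 ltNge sqr_ge0.
have [_ /(_ t Tt Pt)[_ [k [j [tk tj kj]]]]] := rf.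
wlog H : k j tk tj kj / 0 < turn t k => [W|].
  have := turn_neq0 Tt Pt tk; rewrite neq_lt => /orP[k0|]; last exact: (W k j tk tj kj).
  apply: (W j k) => //; first by rewrite eq_sym.
  rewrite lt_def (turn_neq0 Tt Pt tj) /= leNgt; apply/negP => j0.
  by move: kj; rewrite (U k j) ?eqxx // nmulr_rgt0.
have j0 : turn t j < 0.
  rewrite lt_def eq_sym (turn_neq0 Tt Pt tj) /= leNgt; apply/negP => j0.
  by move: kj; rewrite (U k j) ?eqxx // pmulr_rgt0.
exists k, j; split=> // i ti.
have := turn_neq0 Tt Pt ti; rewrite neq_lt => /orP[i0|i0].
  by right; apply: U; rewrite // nmulr_rgt0.
by left; apply: U; rewrite // pmulr_rgt0.
Qed.

(** The facet - l of the cell t + l is the facet l of t. So both points [apt] lie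
    on the same half of its hyperplane, the inner side of the second facet of t,
    while the outer normals are opposite. *)
Lemma turn_neighbour t l : T t -> P (f - t) -> tight t f l ->
  (turn (t + l) (- l) < 0) = (0 < turn t l).
Proof.
move=> Tt Pt tl; have lL : l \in L by case/tightP: tl.
have Pt' := neighbour_cell Pt tl; have tl' := neighbour_tight tl.
have Tt' := step Tt lL.
have N0 := turn_neq0 Tt Pt tl; have N0' := turn_neq0 Tt' Pt' tl'.
have [m tm ml] := ridge_other l Tt Pt.
have tE : turn (t + l) (- l) = - cr (n l) (a (- l) + l + t - f).
  by rewrite /turn nrmN // crossNl [t + l]addrC addrA.
have lL' := fvecN lL.
have Pa : P (a (- l) + l).
  rewrite -[X in _ + X]opprK; apply: (adj lL' _ (apt_eq lL')).
  apply/(cellE D) => k kL; have [->|kl] := eqVneq k (- l); first by rewrite apt_eq ?lexx.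
  by apply/ltW/(apt_lt lL' kL kl).
have [_ /(_ t Tt Pt)[pl _]] := rf.
have H : cr (n l) (a (- l) + l + t - f) * cr (n l) (n m) <= 0.
  have Hl : dot (n l) (a (- l) + l + t - f) = 0.
    rewrite -addrA -opprB dotDr dotNr; case/tightP: tl => _ ->.
    have /eqP := apt_eq lL'; rewrite nrmN // hgtN // dotNl eqr_oppLR => /eqP E.
    by rewrite dotDr E opprB subrK subrr.
  rewrite -(cr_dot (pl _ tl) (pl _ tm) (nrm1 lL) Hl).
  case/tightP: tm => mL tm; rewrite -addrA -opprB dotDr dotNr tm subr_le0.
  by move/(cellE D): Pa; apply.
have H2 := turn_cr Tt Pt tl tm ml.
exact: (sign_compare H H2 N0 tE N0').
Qed.

(** Each hyperface at f is listed once, as a facet of the cell from which it is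
    crossed when turning clockwise. *)
Definition rot : set ('rV[R]_d * 'rV[R]_d) :=
  [set tl | [/\ T tl.1, P (f - tl.1), tight tl.1 f tl.2 & 0 < turn tl.1 tl.2]].

End AtRidge.

(** The closedness condition: the values met around each codimension two face
    add up to zero. *)
Definition star (V : nmodType) (j : 'rV[R]_d -> 'rV[R]_d -> V) :=
  forall f e1 e2, ridge f e1 e2 ->
    \sum_(tl \in rot f e1 e2) j tl.1 tl.2 = 0.

End Ridge.

(** * Generic points *)

Lemma countable_image (A B : Type) (f : A -> B) (X : set A) :
  countable X -> countable (f @` X).
Proof. by move=> cX; apply: card_le_trans cX; exact: card_image_le. Qed.

Lemma countable_setU (A : Type) (X Y : set A) :
  countable X -> countable Y -> countable (X `|` Y).
Proof.
move=> cX cY; rewrite -bigcup2E; apply: bigcup_countable => //.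
by move=> [|[|i]] _ //=; exact: countable0.
Qed.

Section Generic.
Context {R : realType} {d : nat} {P T : set 'rV[R]_d} (D : facet_system P T).
Implicit Types (t x y f u v w l m k e : 'rV[R]_d).
Local Notation L := (fvec D).
Local Notation n := (nrm D).
Local Notation h := (hgt D).

Lemma finite_cells (M : R) :
  finite_set [set t | T t /\ exists2 x, `|x| <= M & P (x - t)].
Proof.
have [B HB] := bounded D.
apply: sub_finite_set (locfin D (M + B)) => t [Tt [x xM Px]]; split=> //.
have -> : t = x - (x - t) by rewrite opprB addrC subrK.
by apply: le_trans (ler_normB _ _) _; rewrite lerD // HB.
Qed.

Lemma countable_T : countable T.
Proof.
have : countable (\bigcup_k [set t | T t /\ `|t| <= k%:R]).
  apply: bigcup_countable => // k _; exact: finite_set_countable (locfin D _).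
apply: sub_countable; apply: subset_card_le => t Tt.
exists (Num.truncn `|t|).+1 => //=; split=> //.
by apply: ltW; rewrite truncnS_gt.
Qed.

(** The signed distance of x to the hyperplane of the facet l of the cell t. *)
Definition facet_gap t l x : R := dot (n l) (x - t) - h l.

Lemma cell_gap t x : P (x - t) <-> forall l, l \in L -> facet_gap t l x <= 0.
Proof.
by split=> [/cellE H l lL|H]; [rewrite subr_le0 H|
  apply/(cellE D) => l lL; rewrite -subr_le0 H].
Qed.

Definition lin2 l m := forall b c : R, b *: n l + c *: n m = 0 -> b = 0 /\ c = 0.
Definition lin3 l m k := forall b c e : R,
  b *: n l + c *: n m + e *: n k = 0 -> [/\ b = 0, c = 0 & e = 0].

(** A minor of the matrix of gaps: it vanishes when the line through x and y
    meets the intersection of the two hyperplanes. Likewise [minor3] for the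
    plane through three points and three hyperplanes. *)
Definition minor2 t l m x y := facet_gap t l x * facet_gap t m y - facet_gap t m x * facet_gap t l y.
Definition minor3 t l m k x y z := minor2 t m k x y * facet_gap t l z
  - minor2 t l k x y * facet_gap t m z + minor2 t l m x y * facet_gap t k z.

(** Genericity of one, two and three points: the point avoids the hyperplanes
    of all facets, the line all intersections of two of them, the plane all
    intersections of three of them. *)
Definition gen1 x := forall t l, T t -> l \in L -> facet_gap t l x != 0.
Definition gen2 x y := forall t l m, T t -> l \in L -> m \in L -> lin2 l m ->
  minor2 t l m x y != 0.
Definition gen3 x y z := forall t l m k, T t -> l \in L -> m \in L ->
  k \in L -> lin3 l m k -> minor3 t l m k x y z != 0.

Lemma gen2C x y : gen2 x y -> gen2 y x.
Proof.
move=> g t l m Tt lL mL lm; have := g t l m Tt lL mL lm.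
by rewrite /minor2 -oppr_eq0 opprB mulrC (mulrC (facet_gap t l x)).
Qed.

Local Notation aff := ('rV[R]_d * R)%type.
(** Affine functions are pairs, so that their combinations are computed in the
    vector space of pairs. *)
Definition affeval (b : aff) x := dot b.1 x + b.2.
Definition affgap t l : aff := (n l, - dot (n l) t - h l).

Lemma affeval_gap t l x : affeval (affgap t l) x = facet_gap t l x.
Proof. by rewrite /affeval /facet_gap !dotE addrA. Qed.

Lemma affevalD b c x : affeval (b + c) x = affeval b x + affeval c x.
Proof. by rewrite /affeval dotDl addrACA. Qed.

Lemma affevalZ (r : R) b x : affeval (r *: b) x = r * affeval b x.
Proof. by rewrite /affeval dotZl mulrDr. Qed.

Lemma countable_family (F : 'rV[R]_d -> 'rV[R]_d -> 'rV[R]_d -> 'rV[R]_d -> aff)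
    (C : 'rV[R]_d -> 'rV[R]_d -> 'rV[R]_d -> Prop) :
  countable [set b | exists t l m k,
    [/\ T t, l \in L, m \in L, k \in L & C l m k /\ b = F t l m k]].
Proof.
have cL : countable [set` L].
  by apply: finite_set_countable; apply/finite_seqP; exists L.
have := countable_image (fun q => F q.1.1.1 q.1.1.2 q.1.2 q.2)
  (countableX (countableX (countableX countable_T cL) cL) cL).
apply: sub_countable; apply: subset_card_le.
move=> b [t [l [m [k [Tt lL mL kL [_ ->]]]]]].
by exists (t, l, m, k).
Qed.

(** Each minor is an affine function of its last point, whose linear part is
    not zero by the genericity of the previous points; there are countably many
    of them, so [avoid_zeros] applies. *)
Lemma generic_point (O : set 'rV[R]_d) (Q : seq 'rV[R]_d)
    (S : seq ('rV[R]_d * 'rV[R]_d)) : open O -> O !=set0 ->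
  (forall q, q \in Q -> gen1 q) ->
  (forall pq, pq \in S -> gen2 pq.1 pq.2) ->
  exists x, [/\ O x, gen1 x, forall q, q \in Q -> gen2 q x &
    forall pq, pq \in S -> gen3 pq.1 pq.2 x].
Proof.
move=> Oop O0 HQ HS.
pose A1 := [set b | exists t l m k,
    [/\ T t, l \in L, m \in L, k \in L & True /\ b = affgap t l]].
pose A2 q := [set b | exists t l m k,
    [/\ T t, l \in L, m \in L, k \in L & lin2 l m /\
     b = facet_gap t l q *: affgap t m + (- facet_gap t m q) *: affgap t l]].
pose A3 (pq : 'rV[R]_d * 'rV[R]_d) := [set b | exists t l m k,
    [/\ T t, l \in L, m \in L, k \in L & lin3 l m k /\
     b = minor2 t m k pq.1 pq.2 *: affgap t l
       + (- minor2 t l k pq.1 pq.2) *: affgap t m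
       + minor2 t l m pq.1 pq.2 *: affgap t k]].
pose A := A1 `|` (\bigcup_(q in [set` Q]) A2 q) `|` (\bigcup_(pq in [set` S]) A3 pq).
have cs (U : choiceType) (s : seq U) : countable [set` s].
  by apply: finite_set_countable; apply/finite_seqP; exists s.
have cA : countable A.
  apply: countable_setU; first apply: countable_setU.
  - exact: countable_family (fun t l _ _ => affgap t l) (fun _ _ _ => True).
  - apply: bigcup_countable => [|q _]; first exact: cs.
    exact: countable_family (fun t l m _ => facet_gap t l q *: affgap t m
      + (- facet_gap t m q) *: affgap t l) (fun l m _ => lin2 l m).
  apply: bigcup_countable => [|pq _]; first exact: cs.
  exact: countable_family (fun t l m k => minor2 t m k pq.1 pq.2 *: affgap t l
       + (- minor2 t l k pq.1 pq.2) *: affgap t m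
       + minor2 t l m pq.1 pq.2 *: affgap t k) lin3.
have nA b : A b -> b.1 != 0.
  move=> [[[t [l [m [k [Tt lL mL kL [_ ->]]]]]]|[q /= qQ]]|[pq /= pqS]].
  - by rewrite /= -dot_eq0 (nrm1 lL) oner_eq0.
  - move=> [t [l [m [k [Tt lL mL kL [lm ->]]]]]] /=.
    apply/eqP; rewrite addrC => /lm [/eqP].
    by rewrite oppr_eq0 (negbTE (HQ q qQ t m Tt mL)).
  move=> [t [l [m [k [Tt lL mL kL [lmk ->]]]]]] /=.
  apply/eqP => /lmk [_ _ /eqP]; rewrite (negbTE (HS pq pqS t l m Tt lL mL _)) //.
  by move=> r c H; have [|-> -> _] := lmk r c 0; rewrite ?scale0r ?addr0.
have [x Ox Hx] := avoid_zeros cA nA Oop O0.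
exists x; split=> //.
- move=> t l Tt lL; rewrite -affeval_gap; apply: Hx; left; left.
  by exists t, l, l, l.
- move=> q qQ t l m Tt lL mL lm.
  have := Hx (facet_gap t l q *: affgap t m + (- facet_gap t m q) *: affgap t l).
  rewrite -/(affeval _ _) affevalD !affevalZ !affeval_gap mulNr; apply.
  by left; right; exists q => //; exists t, l, m, m.
move=> pq pqS t l m k Tt lL mL kL lmk.
have := Hx (minor2 t m k pq.1 pq.2 *: affgap t l
       + (- minor2 t l k pq.1 pq.2) *: affgap t m
       + minor2 t l m pq.1 pq.2 *: affgap t k).
rewrite -/(affeval _ _) !affevalD !affevalZ !affeval_gap mulNr; apply.
by right; exists pq => //; exists t, l, m, k.
Qed.

End Generic.

(** * Sums of crossings along a triangle *)

(** The first time at which one of finitely many affine constraints, all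
    satisfied at time 0, becomes an equality that is about to be violated. *)
Lemma exit_time {F : realFieldType} (s : seq (F * F)) :
  (forall c, c \in s -> c.1 <= 0) -> has (fun c => 0 < c.2) s ->
  exists r, [/\ 0 <= r, forall c, c \in s -> c.1 + c.2 * r <= 0 &
    exists2 c, c \in s & c.1 + c.2 * r = 0 /\ 0 < c.2].
Proof.
elim: s => // c s IH H0 /= Hs.
have c0 : c.1 <= 0 by apply: H0; rewrite inE eqxx.
have {}H0 b : b \in s -> b.1 <= 0 by move=> bs; apply: H0; rewrite inE bs orbT.
have Hc : 0 < c.2 -> c.1 + c.2 * (- c.1 / c.2) = 0.
  by move=> c2; rewrite mulrCA divff ?gt_eqF // mulr1 subrr.
have Hc0 : 0 < c.2 -> 0 <= - c.1 / c.2.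
  by move=> c2; rewrite divr_ge0 ?oppr_ge0 // ltW.
have [hs|hs] := boolP (has (fun c => 0 < c.2) s).
  have [r [r0 Hr [b bs [br b2]]]] := IH H0 hs.
  have [cr|cr] := lerP (c.1 + c.2 * r) 0.
    exists r; split=> //; last by exists b; rewrite ?inE ?bs ?orbT.
    by move=> b'; rewrite inE => /orP[/eqP ->|/Hr].
  have c2 : 0 < c.2 by rewrite ltNge; apply/negP => c2; have := mulr_le0_ge0 c2 r0; lra.
  exists (- c.1 / c.2); split; first exact: Hc0.
    move=> b'; rewrite inE => /orP[/eqP ->|b's]; first by rewrite Hc.
    have := Hr _ b's; have := H0 _ b's.
    have rr : - c.1 / c.2 <= r by rewrite ler_pdivrMr //; lra.
    have [p|p] := lerP b'.2 0.
      by have := mulr_le0_ge0 p (Hc0 c2); lra.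
    by have := ler_wpM2l (ltW p) rr; lra.
  by exists c; rewrite ?inE ?eqxx // Hc.
have c2 : 0 < c.2 by move: Hs; rewrite (negbTE hs) orbF.
exists (- c.1 / c.2); split; [exact: Hc0 | | by exists c; rewrite ?inE ?eqxx // Hc].
move=> b; rewrite inE => /orP[/eqP ->|bs]; first by rewrite Hc.
have b2 : b.2 <= 0 by rewrite leNgt; apply/negP => b2; case/hasP: hs; exists b.
by have := mulr_le0_ge0 b2 (Hc0 c2); have := H0 _ bs; lra.
Qed.

Section StarFull.
Context {R : realType} {d : nat} {P T : set 'rV[R]_d} (D : facet_system P T).
Context {W : lmodType R}.
Implicit Types (t x y f u v w l m k e : 'rV[R]_d).
Implicit Types (j : 'rV[R]_d -> 'rV[R]_d -> W).
Local Notation L := (fvec D).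

(** The values of j on the two descriptions (t, l) and (t + l, - l) of a
    hyperface are opposite. *)
Definition anti j := forall t l, T t -> l \in L -> j (t + l) (- l) = - j t l.

Definition facets_at f : set ('rV[R]_d * 'rV[R]_d) :=
  [set tl | [/\ T tl.1, P (f - tl.1) & tight D tl.1 f tl.2]].

Lemma finite_facets_at f : finite_set (facets_at f).
Proof.
have fL : finite_set [set` L] by apply/finite_seqP; exists L.
apply: sub_finite_set (finite_setX (finite_cells D `|f|) fL).
move=> [t l] [/= Tt Pt /tightP[lL _]]; split=> //=; split=> //.
by exists f.
Qed.

(** Each hyperface at f is now counted from both of its cells. The two
    contributions are equal, as both the sign of [turn] and j change. *)
Lemma star_full j f e1 e2 : star D j -> anti j -> ridge D f e1 e2 ->
  \sum_(tl \in facets_at f)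
    Num.sg (turn D f e1 e2 tl.1 tl.2) *: j tl.1 tl.2 = 0.
Proof.
move=> sj aj rf; rewrite (fsbigID (rot D f e1 e2)) /=; last exact: finite_facets_at.
have -> : facets_at f `&` rot D f e1 e2 = rot D f e1 e2.
  by apply/seteqP; split => [tl []|tl []] //= A B C E; split=> //; split.
rewrite (eq_fsbigr (fun tl => j tl.1 tl.2)); last first.
  by move=> tl; rewrite inE => -[_ _ _ /gtr0_sg ->]; rewrite scale1r.
rewrite (sj _ _ _ rf) add0r.
rewrite (reindex_fsbig (fun tl => (tl.1 + tl.2, - tl.2)) (rot D f e1 e2)).
  rewrite (eq_fsbigr (fun tl => j tl.1 tl.2)); first exact: (sj _ _ _ rf).
  move=> [t l]; rewrite inE => -[/= Tt Pt tt tl0].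
  rewrite ltr0_sg ?(turn_neighbour rf) // scaleN1r aj ?opprK //.
  by case/tightP: tt.
split.
- move=> [t l] [/= Tt Pt tt tl0]; have lL : l \in L by case/tightP: tt.
  split=> /=.
    by split=> /=; [exact: (step Tt lL) | exact: (neighbour_cell Pt tt) | exact: neighbour_tight].
  by case=> /= _ _ _; apply/negP; rewrite -leNgt ltW ?(turn_neighbour rf).
- by move=> [t l] [t' l'] _ _ [/= A /oppr_inj B]; move: A; rewrite B => /addIr ->.
move=> [t l] [[/= Tt Pt tt] no]; have lL : l \in L by case/tightP: tt.
exists (t + l, - l) => /=; last by rewrite addrK opprK.
have tt' := neighbour_tight tt; have Pt' := neighbour_cell Pt tt.
have Tt' := step Tt lL.
split=> //=; rewrite -(turn_neighbour rf Tt' Pt' tt') addrK opprK.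
have := turn_neq0 rf Tt Pt tt; rewrite neq_lt => /orP[//|tl0].
by case: no.
Qed.

End StarFull.

Lemma ord3_add (e : 'I_3) :
  [/\ e + 1 + 1 = e + 2, e + 1 + 2 = e, e + 2 + 1 = e & e + 2 + 2 = e + 1].
Proof. by case: e => [[|[|[|//]]] ?]; split; apply: val_inj. Qed.

Lemma ord3P (e i : 'I_3) : [\/ i = e, i = e + 1 | i = e + 2].
Proof.
case: e i => [[|[|[|//]]] ?] [[|[|[|//]]] ?];
  by [constructor 1; apply: val_inj | constructor 2; apply: val_inj |
      constructor 3; apply: val_inj].
Qed.

Lemma ord3_neq (e : 'I_3) : [/\ e + 1 != e, e + 2 != e & e + 1 != e + 2].
Proof. by case: e => [[|[|[|//]]] ?]; split. Qed.

Lemma sum3 (V : nmodType) (e : 'I_3) (F : 'I_3 -> V) :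
  \sum_i F i = F e + F (e + 1) + F (e + 2).
Proof.
have [h1 h2 h3] := ord3_neq e.
rewrite (bigD1 e) //= (bigD1 (e + 1)) //= (bigD1 (e + 2)) /=; last first.
  by rewrite h2 eq_sym h3.
rewrite big1 => [|i /andP[/andP[ia ib] ic]].
  by rewrite addr0 -[RHS]addrA.
by case: (ord3P e i) => E; move: ia ib ic; rewrite E eqxx.
Qed.

Section Triangle.
Context {R : realType} {d : nat} {P T : set 'rV[R]_d} (D : facet_system P T).
Context {W : lmodType R}.
Implicit Types (t x y f u w l m : 'rV[R]_d).
Local Notation L := (fvec D).
Local Notation n := (nrm D).
Local Notation gap := (facet_gap D).

Definition hits x y t l := exists r : R, [/\ 0 <= r <= 1,
  P (x + r *: (y - x) - t) & gap t l (x + r *: (y - x)) = 0].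

Definition facet_pairs : set ('rV[R]_d * 'rV[R]_d) :=
  [set tl | T tl.1 /\ tl.2 \in L].

(** Counts the facet l of the cell t, with a sign, when the segment from x to y
    meets it. *)
Definition crossing x y t l : R :=
  (`[< hits x y t l >])%:R * Num.sg (dot (n l) (y - x)).

(** The sum of j over the facets crossed by the segment; each hyperface is
    counted twice, once from each side. *)
Definition jump (j : 'rV[R]_d -> 'rV[R]_d -> W) x y : W :=
  \sum_(tl \in facet_pairs) crossing x y tl.1 tl.2 *: j tl.1 tl.2.

Variables (v : 'I_3 -> 'rV[R]_d).
Hypothesis g1 : forall i, gen1 D (v i).
Hypothesis g2 : forall i k : 'I_3, i != k -> gen2 D (v i) (v k).
Hypothesis g3 : gen3 D (v 0) (v 1) (v 2).

Implicit Types (z : 'rV[R]_3) (i : 'I_3).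

(** The points of the triangle are handled by their barycentric coordinates z:
    [ev c z] is the affine function with values c at the vertices, [pt z] the
    point itself. *)
Definition ev (c : 'I_3 -> R) z : R := \sum_i z 0 i * c i.
Definition pt z : 'rV[R]_d := \sum_i z 0 i *: v i.
Definition gam t l : 'I_3 -> R := fun i => gap t l (v i).
Definition tri z := (forall i, 0 <= z 0 i) /\ \sum_i z 0 i = 1.
(** The direction, in barycentric coordinates, of the intersection of the
    triangle with the hyperplane of the facet l of t. *)
Definition dir t l : 'rV[R]_3 := \row_i (gam t l (i + 2) - gam t l (i + 1)).
(** The part of the triangle in the facet l of the cell t: a segment. *)
Definition seg t l z := [/\ tri z, P (pt z - t) & gap t l (pt z) = 0].

Lemma evD c z z' r : ev c (z + r *: z') = ev c z + r * ev c z'.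
Proof.
rewrite mulr_sumr -big_split; apply: eq_bigr => i _ /=.
by rewrite !mxE mulrDl mulrA.
Qed.

Lemma gap_pt t l z : \sum_i z 0 i = 1 -> gap t l (pt z) = ev (gam t l) z.
Proof.
move=> z1; rewrite /gap /facet_gap /ev /gam /facet_gap.
rewrite dotDr [dot (n l) (pt z)]dotC dot_suml.
have -> : \sum_i z 0 i * (dot (n l) (v i - t) - hgt D l) =
  \sum_i dot (z 0 i *: v i) (n l) - \sum_i z 0 i * (dot (n l) t + hgt D l).
  rewrite -sumrB; apply: eq_bigr => i _.
  by rewrite dotZl dotDr dotNr (dotC (v i)); ring.
by rewrite -mulr_suml z1 mul1r dotNr; ring.
Qed.

Lemma sum_dir t l : \sum_i (dir t l) 0 i = 0.
Proof.
have [a b c e] := ord3_add 0.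
by rewrite (sum3 0) !mxE a b c e; ring.
Qed.

Lemma ev_dir t l : ev (gam t l) (dir t l) = 0.
Proof.
have [a b c e] := ord3_add 0.
by rewrite /ev (sum3 0) !mxE a b c e; ring.
Qed.

Lemma ev_dirE t l m : ev (gam t m) (dir t l) =
  dot (n m) (pt (dir t l)).
Proof.
rewrite /pt dotC dot_suml /ev.
transitivity (\sum_i (dot (dir t l 0 i *: v i) (n m) -
  dir t l 0 i * (dot (n m) t + hgt D m))).
  apply: eq_bigr => i _; rewrite /gam /facet_gap dotZl dotDr dotNr (dotC (v i)).
  by ring.
by rewrite sumrB -mulr_suml sum_dir mul0r subr0.
Qed.

(** The solutions w of two linear equations in three unknowns form a line. *)
Lemma line_param (c : 'I_3 -> R) (w : 'rV[R]_3) i k :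
  \sum_i w 0 i = 0 -> ev c w = 0 ->
  w 0 i * (c (k + 2) - c (k + 1)) = w 0 k * (c (i + 2) - c (i + 1)).
Proof.
rewrite /ev !(sum3 i); have [a b c' e] := ord3_add i.
move=> s0 s1; case: (ord3P i k) => -> //; rewrite ?a ?b ?c' ?e;
  apply/eqP; rewrite -subr_eq0; apply/eqP.
  transitivity ((w 0 i * c i + w 0 (i + 1) * c (i + 1) + w 0 (i + 2) * c (i + 2))
   - c (i + 2) * (w 0 i + w 0 (i + 1) + w 0 (i + 2))); first by ring.
  by rewrite s0 s1 mulr0 subrr.
transitivity (- (w 0 i * c i + w 0 (i + 1) * c (i + 1) + w 0 (i + 2) * c (i + 2))
  + c (i + 1) * (w 0 i + w 0 (i + 1) + w 0 (i + 2))); first by ring.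
by rewrite s0 s1 mulr0 oppr0 addr0.
Qed.

Section Segment.
Variables (t l : 'rV[R]_d) (Tt : T t) (lL : l \in L).
Local Notation dir := (dir t l).
Local Notation seg := (seg t l).

Lemma dir_neq0 z : seg z -> exists i, dir 0 i != 0.
Proof.
move=> [[z0 z1] Pz gz].
have [//|no] := pselect (exists i, dir 0 i != 0).
have H i : dir 0 i = 0.
  by apply/eqP/negPn/negP => i0; apply: no; exists i.
have [a b c e] := ord3_add 0.
have := H (0 + 1); have := H (0 + 2); rewrite !mxE a b c e.
move=> /subr0_eq H1 /subr0_eq H2.
move: gz; rewrite (gap_pt _ _ z1) /ev (sum3 0) H1 -H2 -!mulrDl.
rewrite -(sum3 0 (fun i => z 0 i)) z1 mul1r => /eqP.
by rewrite (negbTE (g1 0 Tt lL)).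
Qed.

Lemma seg_line z z' : seg z -> seg z' -> exists r, z' = z + r *: dir.
Proof.
move=> sz sz'; have [i i0] := dir_neq0 sz.
move: sz sz' => [[_ z1] _ gz] [[_ z1'] _ gz'].
exists ((z' - z) 0 i / dir 0 i); apply/rowP => k; rewrite mxE [X in _ = _ + X]mxE.
have s0 : \sum_i (z' - z) 0 i = 0.
  rewrite (eq_bigr (fun i => z' 0 i - z 0 i)); last by move=> q _; rewrite !mxE.
  by rewrite sumrB z1 z1' subrr.
have s1 : ev (gam t l) (z' - z) = 0.
  rewrite -scaleN1r evD -!gap_pt // gz gz'; ring.
have := line_param i k s0 s1; rewrite -/(dir 0 _).
have -> : gam t l (k + 2) - gam t l (k + 1) = dir 0 k by rewrite mxE.
have -> : gam t l (i + 2) - gam t l (i + 1) = dir 0 i by rewrite mxE.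
move=> E; rewrite mulrAC E -mulrA divff // mulr1 !mxE; ring.
Qed.

(** For s = 1 this is the last point of the segment in the direction [dir], for
    s = -1 the first one: going on means to leave the triangle or the facet. *)
Definition stop (s : R) z := seg z /\
  ((exists2 i, z 0 i = 0 & s * dir 0 i < 0) \/
   (exists2 m, m \in L & gap t m (pt z) = 0 /\ 0 < s * ev (gam t m) dir)).

Lemma seg_stay s z r : stop s z -> seg (z + r *: dir) -> r * s <= 0.
Proof.
move=> [_ [[i zi si]|[m mL [zm sm]]]] sz'; rewrite leNgt; apply/negP => rs.
  have s0 : s != 0 by apply/eqP => s0; move: rs; rewrite s0 mulr0 ltxx.
  have : r * s * (s * dir 0 i) < 0 by rewrite pmulr_rlt0.
  have -> : r * s * (s * dir 0 i) = s ^+ 2 * (r * dir 0 i) by rewrite expr2; ring.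
  rewrite pmulr_rlt0 ?exprn_even_gt0 // => ri.
  case: sz' => -[/(_ i)]; rewrite mxE [in X in _ + X]mxE zi add0r.
  by rewrite leNgt ri.
case: sz' => -[_ z1] /(cell_gap D) /(_ _ mL); rewrite leNgt => /negP[].
rewrite gap_pt // evD.
have zz : \sum_i z 0 i = 1.
  move: z1; rewrite (eq_bigr (fun i => z 0 i + r * dir 0 i)).
    by rewrite big_split /= -mulr_sumr sum_dir mulr0 addr0.
  by move=> i _; rewrite mxE [in X in _ + X]mxE.
rewrite -gap_pt // zm add0r.
have s0 : s != 0 by apply/eqP => s0; move: rs; rewrite s0 mulr0 ltxx.
have : 0 < r * s * (s * ev (gam t m) dir) by rewrite pmulr_rgt0.
have -> : r * s * (s * ev (gam t m) dir) = s ^+ 2 * (r * ev (gam t m) dir).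
  by rewrite expr2; ring.
by rewrite pmulr_rgt0 ?exprn_even_gt0.
Qed.

Lemma stop_uniq s z z' : stop s z -> stop s z' -> s != 0 -> z = z'.
Proof.
move=> sz sz' s0; have [r zr] := seg_line sz.1 sz'.1.
have := seg_stay (r := r) sz; rewrite -zr => /(_ sz'.1) r1.
have := seg_stay (r := - r) sz'.
rewrite {1}zr scaleNr addrK => /(_ sz.1); rewrite mulNr oppr_le0 => r2.
have : r * s == 0 by rewrite eq_le r1 r2.
by rewrite mulf_eq0 (negbTE s0) orbF => /eqP r0; rewrite zr r0 scale0r addr0.
Qed.

Lemma stop_ex s z : seg z -> s != 0 -> exists z', stop s z'.
Proof.
move=> sz s0; have [i i0] := dir_neq0 sz.
have [[z0 z1] Pz gz] := sz.
pose cs := [seq (- z 0 i, - (s * dir 0 i)) | i <- enum 'I_3] ++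
  [seq (gap t m (pt z), s * ev (gam t m) dir) | m <- L].
have [||r [r0 Hr Hs]] := @exit_time _ cs.
- move=> c; rewrite mem_cat => /orP[] /mapP[k kL ->] /=.
    by rewrite oppr_le0.
  by move/(cell_gap D): Pz; apply.
- rewrite has_cat has_map; apply/orP; left; apply/hasP.
  have [k k0] : exists k, s * dir 0 k < 0.
    apply: contrapT => no; move: i0; apply/negP/negPn.
    have : \sum_i (s * dir 0 i) = 0 by rewrite -mulr_sumr sum_dir mulr0.
    move=> /eqP; rewrite psumr_eq0 => [/allP /(_ i)|k _].
      by rewrite mem_index_enum => /(_ isT) /=; rewrite mulf_eq0 (negbTE s0).
    by rewrite leNgt; apply/negP => k0; apply: no; exists k.
  by exists k; rewrite ?mem_enum //= oppr_gt0.
pose z' := z + (r * s) *: dir.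
have z1' : \sum_i z' 0 i = 1.
  rewrite (eq_bigr (fun i => z 0 i + r * s * dir 0 i)).
    by rewrite big_split /= -mulr_sumr sum_dir mulr0 addr0.
  by move=> k _; rewrite mxE [in X in _ + X]mxE.
have gz' m : gap t m (pt z') = gap t m (pt z) + s * ev (gam t m) dir * r.
  by rewrite !gap_pt // evD; ring.
have z'E k : z' 0 k = - (- z 0 k + - (s * dir 0 k) * r).
  by rewrite mxE [in X in _ + X]mxE; ring.
have sz' : seg z'.
  split; first split=> // k.
  - rewrite z'E oppr_ge0; apply: (Hr (- z 0 k, - (s * dir 0 k))).
    by rewrite mem_cat map_f ?mem_enum.
  - apply/(cell_gap D) => m mL; rewrite gz'.
    apply: (Hr (gap t m (pt z), s * ev (gam t m) dir)).
    by rewrite mem_cat [X in _ || X]map_f ?orbT.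
  by rewrite gz' ev_dir gz mulr0 mul0r addr0.
exists z'; split=> //; case: Hs => c; rewrite mem_cat => /orP[] /mapP[k kL ->] /= [E1 E2].
  by left; exists k; [rewrite z'E E1 oppr0 | rewrite -oppr_gt0].
by right; exists k; rewrite // gz'.
Qed.

End Segment.

Definition endpoint (s : R) t l : 'rV[R]_3 := xget 0 (stop t l s).

Lemma endpointP s t l z : T t -> l \in L -> seg t l z -> s != 0 ->
  stop t l s (endpoint s t l).
Proof.
move=> Tt lL sz s0; have [z' Hz'] := stop_ex Tt lL sz s0.
exact: (xgetI 0 Hz').
Qed.

Lemma endpoint_eq s t l z z' : T t -> l \in L -> seg t l z' -> s != 0 ->
  endpoint s t l = z <-> stop t l s z.
Proof.
move=> Tt lL sz s0; have H := endpointP Tt lL sz s0.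
by split=> [<- //|Hz]; exact: (stop_uniq Tt lL H Hz s0).
Qed.

Lemma tri_pt z i : tri z -> z 0 i = 0 ->
  z 0 (i + 1) = 1 - z 0 (i + 2) /\
  pt z = v (i + 1) + z 0 (i + 2) *: (v (i + 2) - v (i + 1)).
Proof.
move=> [_]; rewrite /pt !(sum3 i) => z1 zi; move: z1; rewrite zi add0r => z1.
have E : z 0 (i + 1) = 1 - z 0 (i + 2) by rewrite -z1 addrK.
split=> //; rewrite E scale0r add0r scalerBl scale1r scalerBr -[LHS]addrA.
by congr (_ + _); rewrite [LHS]addrC.
Qed.

Lemma hits_seg t l i :
  hits (v (i + 1)) (v (i + 2)) t l <-> exists2 z, seg t l z & z 0 i = 0.
Proof.
have [n1 n2 n3] := ord3_neq i.
split=> [[r [/andP[r0 r1] Pr gr]]|[z [tz Pz gz] zi]].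
  pose z : 'rV[R]_3 := \row_k (if k == i then 0 else if k == i + 1 then 1 - r else r).
  have zi : z 0 i = 0 by rewrite mxE eqxx.
  have z2 : z 0 (i + 2) = r by rewrite mxE (negbTE n2) eq_sym (negbTE n3).
  have tz : tri z.
    split=> [k|]; last by rewrite (sum3 i) zi z2 mxE (negbTE n1) eqxx; ring.
    by rewrite mxE; case: ifP => // _; case: ifP => // _; rewrite subr_ge0.
  have [_ pz] := tri_pt tz zi; rewrite z2 in pz.
  by exists z => //; split; rewrite ?pz.
have [z1 pz] := tri_pt tz zi.
exists (z 0 (i + 2)); rewrite -pz; split=> //.
by have [z0 _] := tz; rewrite z0 /= -subr_ge0 -z1 z0.
Qed.

Lemma seg_edge t l z i : T t -> l \in L -> seg t l z -> z 0 i = 0 ->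
  [/\ z 0 (i + 1) != 0, z 0 (i + 2) != 0, dir t l 0 i != 0 &
      z 0 (i + 1) * gam t l (i + 1) + z 0 (i + 2) * gam t l (i + 2) = 0].
Proof.
move=> Tt lL [[z0 z1] _ gz] zi; move: gz; rewrite gap_pt // /ev (sum3 i) zi mul0r add0r.
move=> gz; have z1' := z1; rewrite (sum3 i) zi add0r in z1'.
have ga := g1 (i + 1) Tt lL; have gb := g1 (i + 2) Tt lL.
have za : z 0 (i + 1) != 0.
  apply/eqP => z0'; move: gz z1'; rewrite z0' mul0r !add0r => gz z1'.
  by move: gz; rewrite z1' mul1r => /eqP; rewrite (negbTE gb).
have zb : z 0 (i + 2) != 0.
  apply/eqP => z0'; move: gz z1'; rewrite z0' mul0r !addr0 => gz z1'.
  by move: gz; rewrite z1' mul1r => /eqP; rewrite (negbTE ga).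
split=> //; rewrite mxE; apply/eqP => /subr0_eq E.
move: gz; rewrite E -mulrDl z1' mul1r => /eqP.
by rewrite (negbTE ga).
Qed.

Lemma stop_edge s t l z i : T t -> l \in L -> seg t l z -> z 0 i = 0 ->
  s != 0 -> stop t l s z <-> s * dir t l 0 i < 0.
Proof.
move=> Tt lL sz zi s0; have [za zb di gz] := seg_edge Tt lL sz zi.
split=> [|si]; last by split=> //; left; exists i.
move=> [_ [[k zk]|[m mL [zm sm]]]].
  case: (ord3P i k) => kE; rewrite kE // in zk *; first by rewrite zk eqxx in za.
  by rewrite zk eqxx in zb.
exfalso; have [tz Pz gl] := sz.
have lm : l != m by apply/eqP => E; move: sm; rewrite -E ev_dir mulr0 ltxx.
have tl : tight D t (pt z) l by apply/tightP; split=> //; exact: subr0_eq gl.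
have tm : tight D t (pt z) m by apply/tightP; split=> //; exact: subr0_eq zm.
have [_ _ n3] := ord3_neq i.
have := g2 n3 Tt lL mL (fun b c => tight_indep tl tm lm (b := b) (c := c)).
have [_ _ _ gz'] := seg_edge Tt mL (And3 tz Pz zm) zi.
move/eqP; apply; apply: (mulfI za); rewrite mulr0 /minor2.
rewrite -/(gam t l _) -/(gam t m _) -/(gam t l _) -/(gam t m _).
move: gz gz'; move: (z 0 (i + 1)) (z 0 (i + 2)) (gam t l (i + 1)).
move: (gam t l (i + 2)) (gam t m (i + 1)) (gam t m (i + 2)).
move=> b c e p q a H1 H2.
transitivity ((p * a + q * b) * e - (p * c + q * e) * b); first by ring.
by rewrite H1 H2 !mul0r subrr.
Qed.

(** An endpoint of the segment on a side of the triangle is a crossing of that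
    side, and its sign tells whether the segment starts or ends there. *)
Lemma edge_count t l z0 i : T t -> l \in L -> seg t l z0 ->
  (endpoint 1 t l 0 i == 0)%:R - (endpoint (-1) t l 0 i == 0)%:R =
  - crossing (v (i + 1)) (v (i + 2)) t l :> R.
Proof.
move=> Tt lL sz0.
have N1 : (-1 : R) != 0 by rewrite oppr_eq0 oner_eq0.
have P1 := endpointP Tt lL sz0 (oner_neq0 R).
have P2 := endpointP Tt lL sz0 N1.
rewrite /crossing.
have [/hits_seg[z sz zi]|no] := pselect (hits (v (i + 1)) (v (i + 2)) t l); last first.
  have no' s : stop t l s (endpoint s t l) -> (endpoint s t l 0 i == 0) = false.
    by move=> [sE _]; apply/negP => /eqP E; apply: no; apply/hits_seg; exists (endpoint s t l).
  by rewrite (asboolF no) !no' // mul0r subrr oppr0.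
have H : hits (v (i + 1)) (v (i + 2)) t l by apply/hits_seg; exists z.
rewrite (asboolT H) mul1r.
have [_ _ di _] := seg_edge Tt lL sz zi.
have -> : dot (n l) (v (i + 2) - v (i + 1)) = dir t l 0 i.
  by rewrite mxE /gam /facet_gap !dotE; ring.
have E s : s != 0 -> stop t l s (endpoint s t l) ->
    (endpoint s t l 0 i == 0) = (s * dir t l 0 i < 0).
  move=> s0 sE; apply/eqP/idP => [Ei|si].
    by apply/(stop_edge Tt lL sE.1 Ei s0).
  have sz' : stop t l s z by apply/(stop_edge Tt lL sz zi s0).
  by rewrite (stop_uniq Tt lL sE sz' s0).
rewrite !E // ?oner_neq0 // mul1r mulN1r oppr_lt0.
case: (ltgtP (dir t l 0 i) 0) di => [d0|d0|->]; rewrite ?eqxx // => _.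
  by rewrite ltr0_sg // opprK subr0.
by rewrite gtr0_sg // sub0r.
Qed.

(** Otherwise the gaps of l and m, which both vanish at f, would be proportional
    on the plane of the triangle, against the genericity of its sides. *)
Lemma triangle_cross e1 e2 f t l m z : tri z -> f = pt z ->
  in_plane e1 e2 (n l) -> in_plane e1 e2 (n m) ->
  T t -> P (f - t) -> tight D t f l -> tight D t f m -> l != m ->
  cross e1 e2 (v 1 - v 0) (v 2 - v 0) != 0.
Proof.
move=> [z0 z1] -> pl pm Tt Pt tl tm lm.
have lL : l \in L by case/tightP: tl.
have mL : m \in L by case/tightP: tm.
have gl : gap t l (pt z) = 0 by case/tightP: tl => _ E; rewrite /facet_gap E subrr.
have gm : gap t m (pt z) = 0 by case/tightP: tm => _ E; rewrite /facet_gap E subrr.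
have M := g2 (isT : (0 : 'I_3) != 1) Tt lL mL
  (fun b c => tight_indep tl tm lm (b := b) (c := c)).
apply/eqP => C0; move/eqP: M; apply.
have z1' := z1; move: gl gm z1; rewrite !gap_pt // /ev !(sum3 0) !add0r => gl gm z1.
have dE k i : dot (n k) (v i - v 0) = gam t k i - gam t k 0.
  by rewrite /gam /facet_gap !dotE; ring.
have : cross e1 e2 (n l) (n m) * cross e1 e2 (v 1 - v 0) (v 2 - v 0) =
  (gam t l 1 - gam t l 0) * (gam t m 2 - gam t m 0) -
  (gam t l 2 - gam t l 0) * (gam t m 1 - gam t m 0).
  rewrite -!dE !(in_plane_dot _ pl) !(in_plane_dot _ pm) /cross.
  move: (dot e1 (n l)) (dot e2 (n l)) (dot e1 (n m)) (dot e2 (n m)).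
  move: (dot e1 (v 1 - _)) (dot e2 (v 1 - _)) (dot e1 (v 2 - _)) (dot e2 (v 2 - _)).
  by move=> a b c e a' b' c' e'; ring.
rewrite C0 mulr0; rewrite /minor2 -/(gam t l 0) -/(gam t m 0) -/(gam t l 1) -/(gam t m 1).
move: gl gm z1; move: (z 0 0) (z 0 1) (z 0 2) (gam t l 0) (gam t l 1) (gam t l 2).
move: (gam t m 0) (gam t m 1) (gam t m 2) => b0 b1 b2 x y w a0 a1 a2 E1 E2 E3 E4.
transitivity ((x + y + w) * (a0 * b1 - b0 * a1)); first by rewrite E3 mul1r.
transitivity (w * ((a1 - a0) * (b2 - b0) - (a2 - a0) * (b1 - b0)) +
  (x * a0 + y * a1 + w * a2) * (b1 - b0) -
  (x * b0 + y * b1 + w * b2) * (a1 - a0)); first by ring.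
by rewrite -E4 E1 E2 !mul0r mulr0 addr0 subrr.
Qed.

Lemma tight_gap t l x : l \in L -> gap t l x = 0 -> tight D t x l.
Proof. by move=> lL /subr0_eq E; apply/tightP. Qed.

Lemma gap_tight t l x : tight D t x l -> gap t l x = 0.
Proof. by move=> /tightP[_ E]; rewrite /facet_gap E subrr. Qed.

(** Inside the triangle a segment can only be stopped by another facet. *)
Lemma stop_inner s t l z : tri z -> (forall i, z 0 i != 0) ->
  P (pt z - t) -> tight D t (pt z) l ->
  stop t l s z <-> exists2 m, tight D t (pt z) m & 0 < s * ev (gam t m) (dir t l).
Proof.
move=> tz zi Pz tl; split=> [[sz [[i /eqP]|[m mL [zm sm]]]]|[m tm sm]].
- by rewrite (negbTE (zi i)).
- by exists m => //; exact: tight_gap.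
split; first by split=> //; exact: gap_tight.
right; exists m; first by case/tightP: tm.
by split=> //; exact: gap_tight.
Qed.

(** At an inner point z on a codimension two face the segment starts or ends,
    according to the side on which the facet leaves z, and to the orientation
    of the triangle. *)
Lemma endpoint_ridge e1 e2 t l z : tri z -> (forall i, z 0 i != 0) ->
  ridge D (pt z) e1 e2 -> T t -> P (pt z - t) -> tight D t (pt z) l ->
  (endpoint 1 t l == z)%:R - (endpoint (-1) t l == z)%:R =
  - Num.sg (cross e1 e2 (v 1 - v 0) (v 2 - v 0)) *
    Num.sg (turn D (pt z) e1 e2 t l) :> R.
Proof.
move=> tz zi rz Tt Pz tl; have lL : l \in L by case/tightP: tl.
have sz : seg t l z by split=> //; exact: gap_tight.
have N1 : (-1 : R) != 0 by rewrite oppr_eq0 oner_eq0.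
have [_ /(_ t Tt Pz)[pl _]] := rz.
have [m tm ml] := ridge_other rz l Tt Pz.
have D0 := triangle_cross tz erefl (pl _ tl) (pl _ tm) Tt Pz tl tm.
rewrite eq_sym in ml; have {}D0 := D0 ml; rewrite eq_sym in ml.
have t0 := turn_neq0 rz Tt Pz tl.
set C := cross e1 e2 _ _ in D0 *; set q := turn _ _ _ _ _ _ in t0 *.
have Hdir k : tight D t (pt z) k ->
    ev (gam t k) (dir t l) = C * cross e1 e2 (n l) (n k).
  move=> tk; rewrite ev_dirE (cr_dot (pl _ tl) (pl _ tk) (nrm1 lL)); last first.
    by rewrite -ev_dirE ev_dir.
  congr (_ * _).
  have -> : pt (dir t l) = dot (n l) (v 1 - v 0) *: (v 2 - v 0)
      - dot (n l) (v 2 - v 0) *: (v 1 - v 0).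
    rewrite /pt (sum3 0) !add0r !mxE !add0r.
    have [a b c e] := ord3_add 0; rewrite !add0r in a b c e.
    rewrite a b c e; apply/rowP => i; rewrite !mxE /gam /facet_gap !dotE; ring.
  rewrite !(in_plane_dot _ (pl _ tl)) /C /cross.
  have := nrm1 lL; rewrite (in_plane_dot _ (pl _ tl)) => nn.
  rewrite !(dotDr, dotNr, dotZr).
  move: nn; move: (dot e1 (n l)) (dot e2 (n l)) (dot e1 (v 1)) (dot e1 (v 2)).
  move: (dot e1 (v 0)) (dot e2 (v 0)) (dot e2 (v 1)) (dot e2 (v 2)).
  move=> a0 b0 b1 b2 x y a1 a2 nn.
  transitivity ((x * x + y * y) * ((a1 - a0) * (b2 - b0) - (b1 - b0) * (a2 - a0))).
    by ring.
  by rewrite nn mul1r.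
have E (s : R) : s != 0 -> (endpoint s t l == z) = (s * C * q < 0).
  move=> s0; apply/eqP/idP => [/(endpoint_eq z Tt lL sz s0)|].
    move/(stop_inner s tz zi Pz tl) => [k tk]; rewrite Hdir // => sk.
    have kl : k != l.
      apply/eqP => kl; move: sk; rewrite kl.
      have -> : cross e1 e2 (n l) (n l) = 0 by rewrite /cross; ring.
      by rewrite !mulr0 ltxx.
    have := turn_cr rz Tt Pz tl tk kl; rewrite -/q => H.
    have : (s * (C * cross e1 e2 (n l) (n k))) * (q * cross e1 e2 (n l) (n k)) < 0.
      by rewrite pmulr_rlt0.
    have -> : s * (C * cross e1 e2 (n l) (n k)) * (q * cross e1 e2 (n l) (n k)) =
      cross e1 e2 (n l) (n k) ^+ 2 * (s * C * q) by rewrite expr2; ring.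
    rewrite pmulr_rlt0 // exprn_even_gt0 //=.
    by apply/eqP => c0; move: H; rewrite c0 mulr0 ltxx.
  move=> sq; apply/(endpoint_eq z Tt lL sz s0)/(stop_inner s tz zi Pz tl).
  exists m; rewrite // Hdir //.
  have H := turn_cr rz Tt Pz tl tm ml; rewrite -/q in H.
  have : 0 < (s * C * q) * (q * cross e1 e2 (n l) (n m)) by rewrite nmulr_rgt0.
  have -> : (s * C * q) * (q * cross e1 e2 (n l) (n m)) =
    q ^+ 2 * (s * (C * cross e1 e2 (n l) (n m))) by rewrite expr2; ring.
  by rewrite pmulr_rgt0 // exprn_even_gt0.
rewrite !E // ?oner_neq0 // mul1r mulN1r mulNr oppr_lt0 mulNr -sgrM.
have : C * q != 0 by rewrite mulf_neq0.
case: (ltgtP (C * q) 0) => [d0|d0|->]; rewrite ?eqxx // => _.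
  by rewrite ltr0_sg // opprK subr0.
by rewrite gtr0_sg // sub0r.
Qed.

(** Inside a facet a segment neither starts nor ends. *)
Lemma endpoint_flat t l z : tri z -> (forall i, z 0 i != 0) -> T t ->
  P (pt z - t) -> tight D t (pt z) l ->
  (forall m, tight D t (pt z) m -> m = l) ->
  (endpoint 1 t l == z)%:R - (endpoint (-1) t l == z)%:R = 0 :> R.
Proof.
move=> tz zi Tt Pz tl U; have lL : l \in L by case/tightP: tl.
have sz : seg t l z by split=> //; exact: gap_tight.
have E (s : R) : s != 0 -> (endpoint s t l == z) = false.
  move=> s0; apply/eqP => /(endpoint_eq z Tt lL sz s0).
  move/(stop_inner s tz zi Pz tl) => [k /U ->].
  by rewrite ev_dir mulr0 ltxx.
by rewrite !E ?oppr_eq0 ?oner_eq0 // subrr.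
Qed.

(** The plane of the triangle avoids the intersections of three independent
    hyperplanes. *)
Lemma tight_span t z l m k : tri z -> (forall i, z 0 i != 0) -> T t ->
  tight D t (pt z) l -> tight D t (pt z) m -> tight D t (pt z) k -> l != m ->
  exists b c, n k = b *: n l + c *: n m.
Proof.
move=> tz zi Tt tl tm tk lm.
have [//|no] := pselect (exists b c, n k = b *: n l + c *: n m).
have l3 : lin3 D l m k.
  move=> b c e H; have e0 : e = 0.
    apply/eqP/negPn/negP => e0; apply: no; exists (- (b / e)), (- (c / e)).
    apply: (scalerI e0); rewrite scalerDr !scalerA !mulrN.
    rewrite !(mulrC e) !divfK // !scaleNr -opprD; apply/eqP.
    by rewrite -addr_eq0 addrC H.
  move: H; rewrite e0 scale0r addr0 => /(tight_indep tl tm lm)[-> ->].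
  by split.
have [lL mL kL] : [/\ l \in L, m \in L & k \in L].
  by split; [case/tightP: tl | case/tightP: tm | case/tightP: tk].
have /eqP[] := g3 Tt lL mL kL l3; apply: (mulfI (zi 2)); rewrite mulr0.
have [_ z1] := tz.
move: (gap_tight tl) (gap_tight tm) (gap_tight tk).
rewrite !gap_pt // /ev !(sum3 0) !add0r /minor3 /minor2.
rewrite -/(gam t l 0) -/(gam t m 0) -/(gam t k 0) -/(gam t l 1) -/(gam t m 1)
  -/(gam t k 1) -/(gam t l 2) -/(gam t m 2) -/(gam t k 2).
move: (z 0 0) (z 0 1) (z 0 2) (gam t l 0) (gam t l 1) (gam t l 2).
move: (gam t m 0) (gam t m 1) (gam t m 2) (gam t k 0) (gam t k 1) (gam t k 2).
move=> b0 b1 b2 c0 c1 c2 x y w a0 a1 a2 E1 E2 E3.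
transitivity ((b0 * c1 - c0 * b1) * (x * a0 + y * a1 + w * a2)
 - (a0 * c1 - c0 * a1) * (x * b0 + y * b1 + w * b2)
 + (a0 * b1 - b0 * a1) * (x * c0 + y * c1 + w * c2)); first by ring.
by rewrite E1 E2 E3 !mulr0 subrr addr0.
Qed.

Variable j : 'rV[R]_d -> 'rV[R]_d -> W.
Hypotheses (sj : star D j) (aj : anti D j).

(** By [endpoint_ridge] the endpoints at an inner point on a codimension two face
    are counted, up to a common sign, by the sum around that face; by
    [endpoint_flat] there is no endpoint at the other inner points. *)
Lemma inner_sum (r : seq ('rV[R]_d * 'rV[R]_d)) z : uniq r ->
  (forall tl, tl \in r <-> facet_pairs tl /\ exists z', seg tl.1 tl.2 z') ->
  tri z -> (forall i, z 0 i != 0) ->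
  \sum_(tl <- r) ((endpoint 1 tl.1 tl.2 == z)%:R -
    (endpoint (-1) tl.1 tl.2 == z)%:R : R) *: j tl.1 tl.2 = 0.
Proof.
move=> ur Hr tz zi.
have N1 : (-1 : R) != 0 by rewrite oppr_eq0 oner_eq0.
pose F (tl : 'rV[R]_d * 'rV[R]_d) := ((endpoint 1 tl.1 tl.2 == z)%:R -
    (endpoint (-1) tl.1 tl.2 == z)%:R : R) *: j tl.1 tl.2.
have -> : \sum_(tl <- r) ((endpoint 1 tl.1 tl.2 == z)%:R -
    (endpoint (-1) tl.1 tl.2 == z)%:R : R) *: j tl.1 tl.2 =
  \sum_(tl \in facets_at D (pt z)) F tl.
  rewrite (fsbig_widen (facets_at D (pt z)) [set` r]).
  - rewrite (fsbigE r) //; last by move=> i /= ->.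
    by rewrite big_seq [RHS]big_seq_cond; apply: eq_bigl => i; rewrite mem_setE andbb.
  - move=> [t l] [/= Tt Pz tl]; apply/Hr; split.
      by split=> //; case/tightP: tl.
    by exists z; split=> //; exact: gap_tight.
  move=> [t l] [/= /Hr [[/= Tt lL] [z' sz']] nf]; rewrite /F /=.
  have E (s : R) : s != 0 -> (endpoint s t l == z) = false.
    move=> s0; apply/eqP => /(endpoint_eq z Tt lL sz' s0) [[_ Pz gz] _].
    by apply: nf; split=> //=; exact: tight_gap.
  by rewrite !E ?oner_eq0 // subrr scale0r.
have [[t [l [m [Tt Pz tl tm lm]]]]|no] := pselect (exists t l m,
    [/\ T t, P (pt z - t), tight D t (pt z) l, tight D t (pt z) m & l != m]).
  have [e1 [e2 rz]] : exists e1 e2, ridge D (pt z) e1 e2.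
    apply: (mk_ridge Tt Pz tl tm lm) => k tk.
    exact: (tight_span tz zi Tt tl tm tk lm).
  rewrite (eq_fsbigr (fun tl => (- Num.sg (cross e1 e2 (v 1 - v 0) (v 2 - v 0))) *:
    (Num.sg (turn D (pt z) e1 e2 tl.1 tl.2) *: j tl.1 tl.2))).
    rewrite fsbig_finite /=; last exact: finite_facets_at.
    rewrite -scaler_sumr -fsbig_finite /=; last exact: finite_facets_at.
    by rewrite (star_full sj aj rz) scaler0.
  move=> [t' l']; rewrite inE => -[/= Tt' Pz' tl'].
  by rewrite /F /= (endpoint_ridge tz zi rz) // scalerA.
apply: fsbig1 => -[t l] [/= Tt Pz tl]; rewrite /F /=.
rewrite endpoint_flat ?scale0r // => m tm; apply/eqP/negPn/negP => ml.
by apply: no; exists t, m, l.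
Qed.

Lemma seg_finite : finite_set [set tl : 'rV[R]_d * 'rV[R]_d |
  facet_pairs tl /\ exists z, seg tl.1 tl.2 z].
Proof.
have fL : finite_set [set` L] by apply/finite_seqP; exists L.
apply: sub_finite_set
  (finite_setX (finite_cells D (\sum_i `|v i|)) fL).
move=> [t l] [[/= Tt lL] [z [[z0 z1] Pz _]]]; split=> //; split=> //.
exists (pt z) => //; apply: le_trans (ler_norm_sum _ _ _) _.
apply: ler_sum => i _; rewrite normrZ ger0_norm //.
rewrite ler_piMl // -z1 (bigD1 i) //= lerDl sumr_ge0 //.
Qed.

(** The hyperplanes avoid the vertices, so an endpoint lies on one side of the
    triangle at most. *)
Lemma zero_coords z t l : T t -> l \in L -> seg t l z ->
  \sum_i (z 0 i == 0)%:R = 1 - ([forall i, z 0 i != 0])%:R :> R.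
Proof.
move=> Tt lL sz; case: (boolP [forall i, z 0 i != 0]) => [/forallP zi|].
  by rewrite big1 ?subrr // => i _; rewrite (negbTE (zi i)).
rewrite negb_forall => /existsP[i]; rewrite negbK => /eqP zi.
have [za zb _ _] := seg_edge Tt lL sz zi.
by rewrite (sum3 i) zi eqxx (negbTE za) (negbTE zb) !addr0 subr0.
Qed.

(** Each segment has one first and one last point, so that the signed count of
    all endpoints vanishes. The endpoints inside the triangle contribute
    nothing by [inner_sum], and those on the sides are the crossings. *)
Lemma jump_triangle : \sum_i jump j (v (i + 1)) (v (i + 2)) = 0.
Proof.
have /finite_seqP[r0 Hr0] := seg_finite.
pose r := undup r0.
have ur : uniq r by exact: undup_uniq.
have Hr tl : tl \in r <-> facet_pairs tl /\ exists z', seg tl.1 tl.2 z'.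
  have -> : (tl \in r) = (tl \in r0) by rewrite mem_undup.
  by have := congr1 (fun X => X tl) Hr0; rewrite /= => ->.
have N1 : (-1 : R) != 0 by rewrite oppr_eq0 oner_eq0.
have jE i : jump j (v (i + 1)) (v (i + 2)) =
    \sum_(tl <- r) crossing (v (i + 1)) (v (i + 2)) tl.1 tl.2 *: j tl.1 tl.2.
  rewrite /jump -(fsbig_widen [set` r]).
  - rewrite (fsbigE r) //; last by move=> k /= ->.
    by rewrite [RHS]big_seq; apply: eq_bigl => k; rewrite mem_setE.
  - by move=> tl /Hr[].
  move=> [t l] [/= tlP no]; rewrite /crossing asboolF ?mul0r ?scale0r //.
  move=> /hits_seg[z sz _]; apply: no; apply/Hr; split=> //.
  by exists z.
rewrite (eq_bigr _ (fun i _ => jE i)) exchange_big /=.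
pose inn (s : R) (tl : 'rV[R]_d * 'rV[R]_d) : R :=
  ([forall i, endpoint s tl.1 tl.2 0 i != 0])%:R.
transitivity (\sum_(tl <- r) (inn 1 tl - inn (-1) tl) *: j tl.1 tl.2).
  rewrite big_seq [RHS]big_seq; apply: eq_bigr => -[t l] /Hr [[/= Tt lL] [z sz]].
  rewrite -scaler_suml; congr (_ *: _).
  transitivity (\sum_i ((endpoint (-1) t l 0 i == 0)%:R -
    (endpoint 1 t l 0 i == 0)%:R : R)).
    apply: eq_bigr => i _; apply: oppr_inj; rewrite -(edge_count i Tt lL sz).
    by rewrite opprB.
  rewrite sumrB !(zero_coords Tt lL (endpointP Tt lL sz _).1) ?oner_neq0 //.
  by rewrite /inn /=; ring.
pose Z := undup ([seq endpoint 1 tl.1 tl.2 | tl <- r] ++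
                 [seq endpoint (-1) tl.1 tl.2 | tl <- r]).
have innE s tl : endpoint s tl.1 tl.2 \in Z -> inn s tl =
    \sum_(z <- Z | [forall i, z 0 i != 0]) (endpoint s tl.1 tl.2 == z)%:R.
  move=> eZ; rewrite big_mkcond (bigD1_seq _ eZ (undup_uniq _)) /= eqxx.
  rewrite big1 ?addr0; first by rewrite /inn; case: ifP.
  by move=> z; rewrite eq_sym => /negbTE ->; case: ifP.
transitivity (\sum_(z <- Z | [forall i, z 0 i != 0])
  \sum_(tl <- r) ((endpoint 1 tl.1 tl.2 == z)%:R -
    (endpoint (-1) tl.1 tl.2 == z)%:R : R) *: j tl.1 tl.2).
  rewrite exchange_big /= big_seq [RHS]big_seq; apply: eq_bigr => tl tlr.
  rewrite !innE.
  - by rewrite -sumrB -scaler_suml.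
  - by rewrite mem_undup mem_cat (map_f (fun tl => endpoint (-1) tl.1 tl.2) tlr) orbT.
  by rewrite mem_undup mem_cat (map_f (fun tl => endpoint 1 tl.1 tl.2) tlr).
rewrite big_seq_cond big1 // => z /andP[zZ /forallP zi].
apply: inner_sum => //.
move: zZ; rewrite mem_undup mem_cat => /orP[] /mapP[[t l] /Hr [[/= Tt lL] [z' sz]] ->].
  by case: (endpointP Tt lL sz (oner_neq0 R)) => -[].
by case: (endpointP Tt lL sz N1) => -[].
Qed.

End Triangle.

(** * Potentials of closed functions on facets *)

Section Potential.
Context {R : realType} {d : nat} {P T : set 'rV[R]_d} (D : facet_system P T).
Implicit Types (t u x y z p q v l m k : 'rV[R]_d).
Local Notation L := (fvec D).
Local Notation n := (nrm D).
Local Notation gap := (facet_gap D).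
Local Notation gen1 := (gen1 D).
Local Notation gen2 := (gen2 D).
Local Notation gen3 := (gen3 D).

Definition inside t x := forall l, l \in L -> gap t l x < 0.

Lemma gap_line t l x v (r : R) :
  gap t l (x + r *: v) = gap t l x + r * dot (n l) v.
Proof. by rewrite /facet_gap !dotE; ring. Qed.

Lemma gap_conv t l x y (r : R) :
  gap t l (x + r *: (y - x)) = (1 - r) * gap t l x + r * gap t l y.
Proof. by rewrite gap_line /facet_gap !dotE; ring. Qed.

Lemma gap_opp t l x : l \in L -> gap (t + l) (- l) x = - gap t l x.
Proof. by move=> lL; rewrite /facet_gap nrmN // hgtN // !dotE; ring. Qed.

Lemma inside_cell t x : inside t x -> P (x - t).
Proof. by move=> xt; apply/(cell_gap D) => l lL; apply/ltW/xt. Qed.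

Lemma inside_uniq t u x : T t -> T u -> inside t x -> P (x - u) -> t = u.
Proof.
move=> Tt Tu xt; apply: (interior_disjoint (f := D)) => // l lL.
by rewrite -subr_lt0; exact: xt.
Qed.

Lemma open_gaps (s : seq 'rV[R]_d) t :
  open [set x | forall l, l \in s -> gap t l x < 0].
Proof.
elim: s => [|l s IH].
  by rewrite (_ : mkset _ = setT); [exact: openT | apply/seteqP; split].
rewrite (_ : mkset _ = [set x | dot (n l) x < hgt D l + dot (n l) t] `&`
    [set x | forall l, l \in s -> gap t l x < 0]).
  by apply: openI => //; exact: open_lt.
apply/seteqP; split => x /=.
  move=> H; split; last by move=> m ms; apply: H; rewrite inE ms orbT.
  have := H l; rewrite inE eqxx => /(_ isT).
  by rewrite /facet_gap dotDr dotNr -addrA -opprD subr_lt0 addrC.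
move=> [H1 H2] m; rewrite inE => /orP[/eqP ->|]; last exact: H2.
by rewrite /facet_gap dotDr dotNr -addrA -opprD subr_lt0 addrC.
Qed.

Lemma inside_ctr t : inside t (ctr D + t).
Proof. by move=> l lL; rewrite /facet_gap addrK subr_lt0 ctr_lt. Qed.

(** Every point of a cell is a limit of points inside the cell. *)
Lemma inside_near t x (O : set 'rV[R]_d) : P (x - t) -> open O -> O x ->
  exists y, O y /\ inside t y.
Proof.
move=> Px Oop Ox.
have [e e0 He] := open_line (ctr D + t - x) (open_nbhs_nbhs (conj Oop Ox)).
pose r := Num.min (e / 2) 1.
have r0 : 0 < r by rewrite /r lt_min ltr01 divr_gt0.
have r1 : r <= 1 by rewrite /r ge_min lexx orbT.
exists (x + r *: (ctr D + t - x)); split.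
  apply: He; rewrite ger0_norm ?ltW //; apply: (@le_lt_trans _ _ (e / 2)).
    by rewrite /r ge_min lexx.
  by rewrite ltr_pdivrMr // mulr_natr mulr2n ltrDl.
move=> l lL; rewrite gap_conv.
have /(cell_gap D) /(_ l lL) H1 := Px; have H2 := inside_ctr t lL.
have : (1 - r) * gap t l x <= 0 by rewrite mulr_ge0_le0 ?subr_ge0.
have : r * gap t l (ctr D + t) < 0 by rewrite pmulr_rlt0.
by move=> a b; rewrite -[ltRHS]addr0 ler_ltD.
Qed.

(** A neighbourhood of the points of the facet l of t that lie on no other
    facet. It meets only the cells t and t + l, and is cut in two by their
    common facet. *)
Definition near_facet t l : set 'rV[R]_d :=
  [set x | forall m, m \in rem l L -> gap t m x < 0] `&`
  [set x | forall m, m \in rem (- l) L -> gap (t + l) m x < 0].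

Section Facet.
Variables (t l : 'rV[R]_d) (Tt : T t) (lL : l \in L).
Let lL' : - l \in L := fvecN lL.
Let Tt' : T (t + l) := step Tt lL.

Lemma apt_tight : tight D t (apt D l + t) l.
Proof. by apply/tightP; rewrite addrK apt_eq. Qed.

Lemma apt_cell : P (apt D l + t - t).
Proof.
rewrite addrK; apply/(cellE D) => m mL.
by have [->|ml] := eqVneq m l; [rewrite apt_eq | apply/ltW/apt_lt].
Qed.

Lemma apt_only m : tight D t (apt D l + t) m -> m = l.
Proof.
move=> /tightP[mL]; rewrite addrK => E; apply/eqP/negPn/negP => ml.
by have := apt_lt lL mL ml; rewrite E ltxx.
Qed.

Lemma fvec_neqN : l != - l.
Proof.
apply/eqP => E; have := nrmN lL; rewrite -E => H.
have := nrm1 lL; rewrite H dotNl; have := nrm1 lL; rewrite {1}H dotNl.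
by have := dot_ge0 (n l); rewrite -H => ? ?; have := nrm1 lL; lra.
Qed.

(** Near a point that is interior to the facet l of t, the whole facet lies in
    any other cell containing the point. *)
Lemma apt_parallel u m : T u -> P (apt D l + t - u) ->
  tight D u (apt D l + t) m -> m = l \/ m = - l.
Proof.
move=> Tu Pu tm; have mL : m \in L by case/tightP: tm.
pose w := n m - dot (n l) (n m) *: n l.
have lw : dot (n l) w = 0 by rewrite /w !dotE nrm1 // mulr1 subrr.
have mw : dot (n m) w = 0.
  apply: (tight_lines Tt Tu apt_cell Pu _ tm) => k /apt_only ->; exact: lw.
have w0 : w = 0.
  have : dot w w = dot (n m) w - dot (n l) (n m) * dot (n l) w.
    by rewrite [in LHS]/w dotDl dotNl dotZl.
  by rewrite mw lw mulr0 subrr => /eqP; rewrite dot_eq0 => /eqP.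
have := nrm_parallel (b := 1) (c := - dot (n l) (n m)) mL lL (oner_neq0 R).
by rewrite scale1r scaleNr -/w => /(_ w0)[->|->]; [left | right; rewrite opprK].
Qed.

Lemma near_facet_open : open (near_facet t l).
Proof. by apply: openI; exact: open_gaps. Qed.

Lemma near_facetP x : near_facet t l x <->
  (forall m, m \in L -> m != l -> gap t m x < 0) /\
  (forall m, m \in L -> m != - l -> gap (t + l) m x < 0).
Proof.
have H k m : (m \in rem k L) = (m != k) && (m \in L).
  by rewrite mem_rem_uniq ?fvec_uniq // inE.
split=> -[H1 H2]; split=> m.
- by move=> mL ml; apply: H1; rewrite H ml.
- by move=> mL ml; apply: H2; rewrite H ml.
- by rewrite H => /andP[ml mL]; exact: H1.
by rewrite H => /andP[ml mL]; exact: H2.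
Qed.

Lemma near_facet_apt : near_facet t l (apt D l + t).
Proof.
have Pa' := neighbour_cell apt_cell apt_tight.
have tl' := neighbour_tight apt_tight.
apply/near_facetP; split=> m mL ml.
  have /(cell_gap D) /(_ m mL) := apt_cell.
  rewrite le_eqVlt => /orP[/eqP E|//].
  by move: ml; rewrite (apt_only (tight_gap mL E)) eqxx.
have /(cell_gap D) /(_ m mL) := Pa'.
rewrite le_eqVlt => /orP[/eqP /(tight_gap mL) tm|//].
have [E|E] := apt_parallel Tt' Pa' tm; last by rewrite E eqxx in ml.
rewrite E in tm; have [] := tight_indep (b := 1) (c := 1) tm tl' fvec_neqN.
  by rewrite !scale1r nrmN // subrr.
by move/eqP; rewrite oner_eq0.
Qed.

Lemma near_facet_neg x : near_facet t l x -> gap t l x < 0 -> inside t x.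
Proof.
by move=> /near_facetP[H _] xl m mL; have [->//|ml] := eqVneq m l; exact: H.
Qed.

Lemma near_facet_pos x : near_facet t l x -> 0 < gap t l x -> inside (t + l) x.
Proof.
move=> /near_facetP[_ H] xl m mL; have [->|ml] := eqVneq m (- l); last exact: H.
by rewrite gap_opp // oppr_lt0.
Qed.

Lemma near_facet_zero x : near_facet t l x -> gap t l x = 0 -> P (x - t).
Proof.
move=> /near_facetP[H _] x0; apply/(cell_gap D) => m mL.
by have [->|ml] := eqVneq m l; [rewrite x0 | exact/ltW/H].
Qed.

Lemma near_facet_cells x u : near_facet t l x -> T u -> P (x - u) ->
  u = t \/ u = t + l.
Proof.
move=> Ox Tu Pu; have [y [Oy yu]] := inside_near Pu near_facet_open Ox.
case: (ltgtP (gap t l y) 0) => y0.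
- by left; apply: (inside_uniq Tu Tt yu); exact/inside_cell/near_facet_neg.
- by right; apply: (inside_uniq Tu Tt' yu); exact/inside_cell/near_facet_pos.
by left; apply: (inside_uniq Tu Tt yu); exact: near_facet_zero.
Qed.

End Facet.

Section Jump.
Context {W : lmodType R} (j : 'rV[R]_d -> 'rV[R]_d -> W).
Hypotheses (sj : star D j) (aj : anti D j).
Local Notation jump := (jump D j).
Local Notation hits := (hits D).

Lemma jump_finite x y (r : seq ('rV[R]_d * 'rV[R]_d)) : uniq r ->
  (forall tl, tl \in r -> facet_pairs D tl) ->
  (forall tl, facet_pairs D tl -> hits x y tl.1 tl.2 -> tl \in r) ->
  jump x y = \sum_(tl <- r) crossing D x y tl.1 tl.2 *: j tl.1 tl.2.
Proof.
move=> ur rP Hr; rewrite /jump -(fsbig_widen [set` r]).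
- rewrite (fsbigE r) //; last by move=> k /= ->.
  by rewrite [RHS]big_seq; apply: eq_bigl => k; rewrite mem_setE.
- exact: rP.
move=> tl [/= tlP no]; rewrite /crossing asboolF ?mul0r ?scale0r // => h.
by apply: no; exact: Hr.
Qed.

Lemma hitsC x y t l : hits x y t l -> hits y x t l.
Proof.
move=> [r [/andP[r0 r1] Pr gr]]; exists (1 - r).
have -> : y + (1 - r) *: (x - y) = x + r *: (y - x).
  by apply/rowP => i; rewrite !mxE; ring.
by split=> //; rewrite subr_ge0 r1 gerBl.
Qed.

Lemma finite_hits x y :
  finite_set [set tl | facet_pairs D tl /\ hits x y tl.1 tl.2].
Proof.
have fL : finite_set [set` L] by apply/finite_seqP; exists L.
apply: sub_finite_set (finite_setX (finite_cells D (`|x| + `|y - x|)) fL).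
move=> [t l] [[/= Tt lL] [r [/andP[r0 r1] Pr _]]]; split=> //; split=> //.
exists (x + r *: (y - x)) => //; apply: le_trans (ler_normD _ _) _.
by rewrite lerD2l normrZ ger0_norm // ler_piMl.
Qed.

Lemma jumpC x y : jump y x = - jump x y.
Proof.
have /finite_seqP[r0 Hr0] := finite_hits x y.
have Hr tl : tl \in undup r0 <-> facet_pairs D tl /\ hits x y tl.1 tl.2.
  by rewrite mem_undup; have := congr1 (fun X => X tl) Hr0; rewrite /= => ->.
rewrite !(@jump_finite _ _ (undup r0)) ?undup_uniq //.
- rewrite -sumrN; apply: eq_bigr => tl _; rewrite -scaleNr; congr (_ *: _).
  rewrite /crossing -mulrN -sgrN -dotNr opprB; congr ((nat_of_bool _)%:R * _).
  by apply: asbool_equiv_eq; split; exact: hitsC.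
- by move=> tl /Hr[].
- by move=> tl tlP h; apply/Hr.
- by move=> tl /Hr[].
by move=> tl tlP /hitsC h; apply/Hr.
Qed.

Lemma jump_inside t x y : T t -> inside t x -> inside t y -> jump x y = 0.
Proof.
move=> Tt tx ty; apply: fsbig1 => -[u l] [/= Tu lL].
rewrite /crossing asboolF ?mul0r ?scale0r // => -[r [/andP[r0 r1] Pr gr]].
have I : inside t (x + r *: (y - x)).
  move=> k kL; rewrite gap_conv; have := tx k kL; have := ty k kL => H1 H2.
  move: r0; rewrite le_eqVlt => /orP[/eqP <-|r0].
    by rewrite subr0 mul1r mul0r addr0.
  have : (1 - r) * gap t k x <= 0 by rewrite mulr_ge0_le0 ?subr_ge0 // ltW.
  have : r * gap t k y < 0 by rewrite pmulr_rlt0.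
  by move=> a b; rewrite -[ltRHS]addr0 ler_ltD.
have E := inside_uniq Tt Tu I Pr.
by have := I l lL; rewrite E gr ltxx.
Qed.

Lemma jump_cycle x y z : gen1 x -> gen1 y -> gen1 z ->
  gen2 x y -> gen2 x z -> gen2 y z -> gen3 x y z ->
  jump x y + jump y z + jump z x = 0.
Proof.
move=> x1 y1 z1 xy xz yz xyz.
pose v (i : 'I_3) := if i == 0 then x else if i == 1 then y else z.
have := @jump_triangle _ _ _ _ D W v _ _ _ j sj aj.
rewrite (sum3 (2 : 'I_3)).
have -> : (2 + 1 : 'I_3) = 0 by apply: val_inj.
have -> : (2 + 2 : 'I_3) = 1 by apply: val_inj.
have -> : (0 + 1 : 'I_3) = 1 by apply: val_inj.
have -> : (0 + 2 : 'I_3) = 2 by apply: val_inj.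
have -> : (1 + 1 : 'I_3) = 2 by apply: val_inj.
have -> : (1 + 2 : 'I_3) = 0 by apply: val_inj.
apply.
- by move=> i; rewrite /v; case: ifP => // _; case: ifP.
- move=> i k; rewrite /v; case: (ord3P 0 i) => ->; case: (ord3P 0 k) => -> //= _;
    by [|exact: gen2C].
by [].
Qed.

(** Only the common facet of t and t + l is crossed; it is counted twice. *)
Lemma jump_step t l x y : T t -> l \in L -> near_facet t l x ->
  near_facet t l y -> inside t x -> inside (t + l) y -> jump x y = 2 *: j t l.
Proof.
move=> Tt lL Ox Oy xt yt; have lL' := fvecN lL; have Tt' := step Tt lL.
have l0 := fvec_neqN lL.
have xl : gap t l x < 0 by exact: xt.
have yl : 0 < gap t l y by rewrite -oppr_lt0 -gap_opp //; exact: yt.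
have Oc (r : R) : 0 <= r <= 1 -> near_facet t l (x + r *: (y - x)).
  move=> /andP[r0 r1]; case: Ox Oy => x1 x2 [y1 y2].
  have C (a b : R) : a < 0 -> b < 0 -> (1 - r) * a + r * b < 0.
    move=> a0 b0; have := mulr_ge0_le0 r0 (ltW b0).
    move: r0; rewrite le_eqVlt => /orP[/eqP <- _|r0 _].
      by rewrite subr0 mul1r mul0r addr0.
    rewrite -[ltRHS]addr0; apply: ler_ltD; last by rewrite pmulr_rlt0.
    by rewrite mulr_ge0_le0 ?subr_ge0 // ltW.
  by split=> m ms /=; rewrite gap_conv; apply: C; [exact: x1 | exact: y1 | exact: x2 | exact: y2].
pose r := - gap t l x / (gap t l y - gap t l x).
have den : 0 < gap t l y - gap t l x by rewrite subr_gt0 (lt_trans xl yl).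
have r01 : 0 <= r <= 1.
  rewrite /r divr_ge0 ?oppr_ge0 ?(ltW xl) ?(ltW den) //= ler_pdivrMr // mul1r.
  by rewrite lerDr ltW.
have gr : gap t l (x + r *: (y - x)) = 0.
  rewrite gap_conv /r; move: den; set a := gap t l x; set b := gap t l y => den.
  by field; rewrite gt_eqF.
have Pr := near_facet_zero (Oc r r01) gr.
have h1 : hits x y t l by exists r.
have h2 : hits x y (t + l) (- l).
  exists r; rewrite r01; split=> //; last by rewrite gap_opp // gr oppr0.
  exact: (neighbour_cell Pr (tight_gap lL gr)).
rewrite (@jump_finite _ _ [:: (t, l); (t + l, - l)]).
- rewrite !big_cons big_nil addr0 /= /crossing !asboolT // !mul1r aj // nrmN //.
  rewrite dotNl sgrN; have -> : Num.sg (dot (n l) (y - x)) = 1.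
    apply: gtr0_sg; have -> : dot (n l) (y - x) = gap t l y - gap t l x.
      by rewrite /facet_gap !dotE; ring.
    exact: den.
  by rewrite scale1r scalerN scaleN1r opprK scaler_nat mulr2n.
- rewrite /= andbT inE; apply/negP => /eqP[_ E].
  by move: l0; rewrite -E eqxx.
- by move=> tl0; rewrite !inE => /orP[]/eqP->; split.
move=> [u k] [/= Tu kL] [r' [r01' Pr' gr']].
have Oz := Oc r' r01'.
have /near_facetP[H1 H2] := Oz.
have [uE|uE] := near_facet_cells Tt lL Oz Tu Pr'; rewrite uE in gr' *.
  have -> : k = l; last by rewrite inE eqxx.
  by apply/eqP/negPn/negP => kl; have := H1 k kL kl; rewrite gr' ltxx.
have -> : k = - l; last by rewrite !inE eqxx orbT.
by apply/eqP/negPn/negP => kl; have := H2 k kL kl; rewrite gr' ltxx.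
Qed.

(** The value at the cell t is half the jump from a fixed generic point x0 to a
    generic point inside t. By [jump_cycle] the choice of that point does not
    matter, and the difference of two neighbours is the jump across their
    common facet. *)
Lemma potential : exists a : 'rV[R]_d -> W,
  forall t l, T t -> l \in L -> a (t + l) = a t + j t l.
Proof.
have [x0 [_ x01 _ _]] := @generic_point _ _ _ _ D setT [::] [::] openT
  (ex_intro _ 0 I) (fun _ => ltac:(by [])) (fun _ => ltac:(by [])).
have open_in t : open (inside t) by exact: open_gaps.
pose good t y := [/\ inside t y, gen1 y & gen2 x0 y].
have good_ex t O : open O -> (exists y, O y /\ inside t y) -> exists y, O y /\ good t y.
  move=> Oop [y0 [Oy0 ty0]].
  have [||//|y [[Oy ty] y1 xy _]] := @generic_point _ _ _ _ D (O `&` inside t) [:: x0] [::]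
    (openI Oop (open_in t)).
  - by exists y0.
  - by move=> q; rewrite inE => /eqP ->.
  by exists y; split=> //; split=> //; apply: xy; rewrite inE.
have indep t y y' : T t -> good t y -> good t y' -> jump x0 y = jump x0 y'.
  move=> Tt [ty y1 xy] [ty' y1' xy'].
  have [||q|z [tz z1 Hz Hz3]] := @generic_point _ _ _ _ D (inside t) [:: x0; y; y'] [:: (x0, y); (x0, y')]
    (open_in t).
  - by exists y.
  - by move=> q; rewrite !inE => /or3P[]/eqP->.
  - by rewrite !inE => /orP[]/eqP->.
  have C w : good t w -> w \in [:: x0; y; y'] -> (x0, w) \in [:: (x0, y); (x0, y')] ->
      jump x0 w = jump x0 z.
    move=> [tw w1 xw] wQ wS.
    have := jump_cycle x01 w1 z1 xw (Hz _ (mem_head _ _)) (Hz _ wQ) (Hz3 _ wS).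
    rewrite (jump_inside Tt tw tz) addr0 (jumpC x0 z) => /eqP.
    by rewrite subr_eq0 => /eqP.
  by rewrite (C y) ?(C y') ?inE ?eqxx ?orbT //; split.
pose yy t := xget 0 (good t).
have yyP t : good t (yy t).
  have [|y [_ gy]] := good_ex t setT openT; last exact: (xgetI 0 gy).
  by exists (ctr D + t); split=> //; exact: inside_ctr.
(* the factor 2 of [jump_step] *)
exists (fun t => 2^-1 *: jump x0 (yy t)) => t l Tt lL.
have Uop := @near_facet_open t l; have Ua := near_facet_apt Tt lL.
have Tt' := step Tt lL; have tl := apt_tight t lL; have Pa := apt_cell t lL.
have [y [Oy gy]] := good_ex t (near_facet t l) Uop (inside_near Pa Uop Ua).
have [ty y1 xy] := gy.
have [z0 [Oz0 tz0]] := inside_near (neighbour_cell Pa tl) Uop Ua.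
have [||q|z [[Oz tz] z1 Hz Hz3]] := @generic_point _ _ _ _ D (near_facet t l `&` inside (t + l)) [:: x0; y]
  [:: (x0, y)] (openI Uop (open_in (t + l))).
- by exists z0.
- by move=> q; rewrite !inE => /orP[]/eqP->.
- by rewrite !inE => /eqP->.
have xz : gen2 x0 z by apply: Hz; rewrite inE eqxx.
have gz : good (t + l) z by [].
rewrite (indep _ _ _ Tt (yyP t) gy) (indep _ _ _ Tt' (yyP (t + l)) gz).
have yz : gen2 y z by apply: Hz; rewrite !inE eqxx orbT.
have := jump_cycle x01 y1 z1 xy xz yz (Hz3 _ (mem_head _ _)).
rewrite (jump_step Tt lL Oy Oz ty tz) (jumpC x0 z) => /eqP; rewrite subr_eq0 => /eqP <-.
by rewrite scalerDr scalerA mulVf ?scale1r // pnatr_eq0.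
Qed.

End Jump.

End Potential.

(** * Walks across facets *)

Lemma count_lt (A : eqType) (a b : pred A) (s : seq A) x :
  x \in s -> subpred a b -> ~~ a x -> b x -> (count a s < count b s)%N.
Proof.
move=> xs ab ax bx; elim: s xs => //= y s IH; rewrite inE => /orP[/eqP <-|xs].
  by rewrite (negbTE ax) bx add0n add1n ltnS sub_count.
by rewrite -addnS leq_add ?IH //; case: (a y) (ab y) => // ->.
Qed.

Section Walk.
Context {R : realType} {d : nat} {P T : set 'rV[R]_d} (D : facet_system P T).
Implicit Types (t u x y z p q v l m k : 'rV[R]_d).
Local Notation L := (fvec D).
Local Notation n := (nrm D).
Local Notation gap := (facet_gap D).

(** A generic line avoids the codimension two faces. *)
Lemma line_facet p q t l m (r : R) : gen2 D p q -> T t ->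
  tight D t (p + r *: (q - p)) l -> tight D t (p + r *: (q - p)) m -> l = m.
Proof.
move=> pq Tt tl tm; apply/eqP/negPn/negP => lm.
have [lL mL] : l \in L /\ m \in L by case/tightP: tl; case/tightP: tm.
have /eqP[] := pq t l m Tt lL mL (fun b c => tight_indep tl tm lm (b := b) (c := c)).
move: (gap_tight tl) (gap_tight tm); rewrite !gap_conv /minor2.
move: (gap t l p) (gap t l q) (gap t m p) (gap t m q) => a b a' b' E1 E2.
have [r0|r0] := eqVneq r 0.
  move: E1 E2; rewrite r0 subr0 !mul1r !mul0r !addr0 => -> ->.
  by rewrite !mul0r subrr.
apply: (mulfI r0); rewrite mulr0.
transitivity (a * ((1 - r) * a' + r * b') - a' * ((1 - r) * a + r * b)).
  by ring.
by rewrite E1 E2 !mulr0 subrr.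
Qed.

(** The cells met by a generic segment [p, q] form a chain from t to t', and every
    facet in this chain is crossed in the direction q - p. So a property of t
    spreads to t' as soon as it passes through facets crossed in this way. *)
Lemma walk t t' : T t -> T t' -> exists p q,
  [/\ inside D t p, inside D t' q &
    forall Q : 'rV[R]_d -> Prop, Q t ->
      (forall u l, T u -> l \in L -> Q u -> 0 < dot (n l) (q - p) -> Q (u + l)) ->
      Q t'].
Proof.
move=> Tt Tt'.
have open_in u : open [set x | inside D u x] by exact: open_gaps.
have [||//|p [tp p1 _ _]] := @generic_point _ _ _ _ D [set x | inside D t x] [::] [::] (open_in t).
- by exists (ctr D + t); exact: inside_ctr.
- by [].
have [||//|q [tq q1 pq _]] := @generic_point _ _ _ _ D [set x | inside D t' x] [:: p] [::]
  (open_in t').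
- by exists (ctr D + t'); exact: inside_ctr.
- by move=> q; rewrite inE => /eqP ->.
have {}tp : inside D t p := tp.
have {}tq : inside D t' q := tq.
have {}pq : gen2 D p q by apply: pq; rewrite inE.
exists p, q; split=> // Q Qt Qs.
pose X (r : R) := p + r *: (q - p).
have /finite_seqP[C HC] := finite_cells D (`|p| + `|q - p|).
have CP u (r : R) : T u -> 0 <= r <= 1 -> P (X r - u) -> u \in C.
  move=> Tu /andP[r0 r1] Pu; have := congr1 (fun Z => Z u) HC; rewrite /= => <-.
  split=> //; exists (X r) => //; apply: le_trans (ler_normD _ _) _.
  by rewrite lerD2l normrZ ger0_norm // ler_piMl.
pose ahead u (r : R) := `[< exists r', [/\ r < r', r' <= 1 & P (X r' - u)] >].
suff H (k : nat) u (r : R) : (count (fun u => ahead u r) C < k)%N ->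
    T u -> Q u -> 0 <= r -> P (X r - u) -> ahead u r -> Q t'.
  apply: (H (count (fun u => ahead u 0) C).+1 t 0) => //.
    by rewrite /X scale0r addr0; exact: (inside_cell tp).
  have [|e e0 He] := cell_ray_int (D := D) (v := q - p) (inside_cell tp).
    move=> l tl; have lL : l \in L by case/tightP: tl.
    by have := tp l lL; rewrite (gap_tight tl) ltxx.
  apply/asboolP.
  exists (Num.min e 1); split; [by rewrite lt_min e0 ltr01 | by rewrite ge_min lexx orbT |].
  apply/(cellE D) => l lL; apply/ltW/He => //; last by rewrite ge_min lexx.
  by rewrite lt_min e0 ltr01.
elim: k u r => // k IH u r ck Tu Qu r0 Pu /asboolP[r' [rr' r'1 Pr']].
have r'0 : 0 <= r' by apply: le_trans r0 (ltW rr').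
pose cs := (r' - 1, 1) :: [seq (gap u m (X r'), dot (n m) (q - p)) | m <- L].
have [||s [s0 Hs]] := @exit_time _ cs.
- move=> c; rewrite inE => /orP[/eqP ->|/mapP[m mL ->]] /=; first by rewrite subr_le0.
  by move/(cell_gap D): Pr'; apply.
- by rewrite /= ltr01.
pose r1 := r' + s.
have r1r : r < r1 by rewrite /r1 ltr_wpDr.
have r10 : 0 <= r1 by rewrite addr_ge0.
have X1 : X r1 = X r' + s *: (q - p) by rewrite /X scalerDl addrA.
have P1 : P (X r1 - u).
  apply/(cell_gap D) => m mL; rewrite X1 gap_line mulrC.
  apply: (Hs (gap u m (X r'), dot (n m) (q - p))).
  by rewrite inE (map_f (fun m => (gap u m (X r'), dot (n m) (q - p)))) ?orbT.
have r11 : r1 <= 1.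
  by have := Hs (r' - 1, 1) (mem_head _ _); rewrite /= mul1r addrAC subr_le0.
have [r1E|r1N] := eqVneq r1 1.
  move=> _; have -> // : t' = u.
  apply: (inside_uniq Tt' Tu tq); move: P1; rewrite r1E /X scale1r.
  by rewrite [p + _]addrC subrK.
have r1lt : r1 < 1 by rewrite lt_neqAle r1N.
move=> [c]; rewrite inE => /orP[/eqP -> [/= E _]|/mapP[m mL ->] [/= E m0]].
  by move: r1N; rewrite -subr_eq0 /r1 addrAC -[s]mul1r E eqxx.
have tm : tight D u (X r1) m.
  by apply: tight_gap => //; rewrite X1 gap_line mulrC.
have Tum := step Tu mL; have Pum := neighbour_cell P1 tm.
have tm' := neighbour_tight tm.
have am : ahead (u + m) r1.
  (* the segment goes on into the cell u + m *)
  have [|e e0 He] := cell_ray (D := D) (v := q - p) Pum.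
    by move=> l tl; rewrite (line_facet pq Tum tl tm') nrmN // dotNl oppr_le0 ltW.
  apply/asboolP; exists (r1 + Num.min e (1 - r1)).
  have me : 0 < Num.min e (1 - r1) by rewrite lt_min e0 subr_gt0.
  split; first by rewrite ltrDl.
    by rewrite -lerBrDl ge_min lexx orbT.
  rewrite /X scalerDl addrA; apply: He; first exact: ltW.
  by rewrite ge_min lexx.
apply: (IH (u + m) r1) => //; last exact: Qs.
(* the number of cells still ahead on the segment decreases *)
rewrite -ltnS; apply: leq_trans ck; rewrite ltnS.
have uC : u \in C by apply: (CP u r1) => //; rewrite r10.
have sub w : ahead w r1 -> ahead w r.
  move=> /asboolP[r2 [h1 h2 h3]]; apply/asboolP; exists r2; split=> //.
  exact: lt_trans h1.
have nu : ~~ ahead u r1.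
  apply/asboolPn => -[r2 [h1 h2 h3]].
  have := cell_facet h3 mL; rewrite -subr_le0 leNgt => /negP[].
  have -> : X r2 = X r1 + (r2 - r1) *: (q - p).
    by rewrite /X -addrA -scalerDl [r1 + _]addrC subrK.
  rewrite -/(gap u m _) gap_line (gap_tight tm) add0r mulr_gt0 // subr_gt0 //.
have au : ahead u r by apply/asboolP; exists r'.
exact: count_lt uC sub nu au.
Qed.

End Walk.

(** * Convex polytopes *)

Section Hull.
Context {R : realType} {d : nat}.
Implicit Types (x y z u v w : 'rV[R]_d) (A B P : set 'rV[R]_d).

Definition segment_closed A := forall x y (r : R), A x -> A y ->
  0 <= r -> r <= 1 -> A (x + r *: (y - x)).

Lemma convex_setP A : convex_set A <-> segment_closed A.
Proof.
have E x y (r : R) : x + r *: (y - x) = r *: y + (1 - r) *: x.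
  by apply/rowP => i; rewrite !mxE; ring.
split=> [cA x y r Ax Ay r0 r1|cA x y r].
  have := cA y x (Itv01 r0 r1); rewrite !inE => /(_ Ay Ax) H.
  by rewrite E; exact: H.
rewrite !inE => Ax Ay.
have := cA y x r%:num Ay Ax (ge0 r) (le1 r).
by rewrite E; exact.
Qed.

Lemma hull_convex A : segment_closed (convex_hull A).
Proof.
move=> x y r Ax Ay r0 r1 B [/= cB AB].
move/convex_setP: (cB); apply => //; [exact: Ax | exact: Ay].
Qed.

Lemma hull_sub A B : segment_closed B -> A `<=` B -> convex_hull A `<=` B.
Proof. by move=> cB AB; apply: smallest_sub => //; apply/convex_setP. Qed.

Lemma sub_hull A : A `<=` convex_hull A.
Proof. exact: sub_gen_smallest. Qed.

Lemma segment_closed_ball (M : R) : segment_closed [set x | `|x| <= M].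
Proof.
move=> x y r /= xM yM r0 r1.
have -> : x + r *: (y - x) = (1 - r) *: x + r *: y.
  by apply/rowP => i; rewrite !mxE; ring.
apply: le_trans (ler_normD _ _) _; rewrite !normrZ !ger0_norm ?subr_ge0 //.
have -> : M = (1 - r) * M + r * M by ring.
by rewrite lerD // ler_wpM2l ?subr_ge0.
Qed.

Lemma polytope_bounded P : polytope P -> exists M, forall x, P x -> `|x| <= M.
Proof.
move=> [s ->]; exists (\sum_(y <- undup s) `|y|) => x.
apply: (hull_sub (@segment_closed_ball _)) => y /= ys.
by rewrite (bigD1_seq y) ?mem_undup ?undup_uniq //= lerDl sumr_ge0.
Qed.

Lemma convex_comb A (s : seq (R * 'rV[R]_d)) : segment_closed A ->
  (forall c, c \in s -> 0 <= c.1 /\ A c.2) -> \sum_(c <- s) c.1 = 1 ->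
  A (\sum_(c <- s) c.1 *: c.2).
Proof.
move=> cA Hs W1.
suff H : 0 <= \sum_(c <- s) c.1 /\
   ((\sum_(c <- s) c.1 = 0 /\ \sum_(c <- s) c.1 *: c.2 = 0) \/
    (0 < \sum_(c <- s) c.1 /\
     A ((\sum_(c <- s) c.1)^-1 *: (\sum_(c <- s) c.1 *: c.2)))).
  case: H => _ []; rewrite W1; first by case=> /eqP; rewrite oner_eq0.
  by rewrite invr1 scale1r => -[].
move: Hs {W1}; elim: s => [|c s IH] Hs; first by rewrite !big_nil; split=> //; left.
have [c0 Ac] := Hs c (mem_head _ _).
have {IH}[|W0 IH] := IH; first by move=> b bs; apply: Hs; rewrite inE bs orbT.
rewrite !big_cons; move: W0 IH; move: (\sum_(j <- s) _) (\sum_(j <- s) _) => S W W0 IH.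
split; first exact: addr_ge0.
move: c0; rewrite le_eqVlt => /orP[/eqP <-|c0].
  by rewrite scale0r !add0r.
right; split; first exact: ltr_wpDr.
case: IH => [[-> ->]|[Wp AW]].
  by rewrite !addr0 scalerA mulVf ?scale1r // gt_eqF.
have cW : 0 < c.1 + W by rewrite addr_gt0.
have r0 : 0 <= W / (c.1 + W) by rewrite divr_ge0 // ltW.
have r1 : W / (c.1 + W) <= 1 by rewrite ler_pdivrMr // mul1r lerDr ltW.
have := cA _ _ _ Ac AW r0 r1; congr A.
apply/rowP => i; rewrite !mxE; field.
by rewrite !gt_eqF.
Qed.

Definition simplex n : set 'rV[R]_n :=
  [set w | (forall i, 0 <= w 0 i) /\ \sum_i w 0 i = 1].

Lemma coord_dot n (w : 'rV[R]_n) i : w 0 i = dot (delta_mx 0 i) w.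
Proof.
rewrite /dot (bigD1 i) //= mxE !eqxx mul1r big1 ?addr0 // => k ki.
by rewrite mxE eqxx (negbTE ki) mul0r.
Qed.

Lemma sum_dot n (w : 'rV[R]_n) : \sum_i w 0 i = dot (const_mx 1) w.
Proof. by apply: eq_bigr => i _; rewrite mxE mul1r. Qed.

Lemma simplex_compact n : compact (@simplex n).
Proof.
apply: bounded_closed_compact.
  exists 1; split; first exact: num_real.
  move=> M M1 w [w0 w1] /=; rewrite [leLHS]mx_normrE; apply/bigmax_leP.
  split=> [|[i k] _ /=]; first by rewrite (le_trans ler01) ?ltW.
  rewrite ord1 ger0_norm //; apply: le_trans (ltW M1).
  by rewrite -w1 (bigD1 k) //= lerDl sumr_ge0.
have -> : @simplex n = (\bigcap_i [set w | dot (- delta_mx 0 i) w <= 0]) `&`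
   ([set w | dot (const_mx 1) w <= 1] `&` [set w | dot (- const_mx 1) w <= - 1]).
  apply/seteqP; split => w /=.
    move=> [w0 w1]; split.
      by move=> i _ /=; rewrite dotNl -coord_dot oppr_le0.
    by rewrite dotNl -sum_dot w1.
  move=> [w0]; rewrite dotNl -sum_dot lerN2 => -[a b].
  split; last by apply/eqP; rewrite eq_le a b.
  by move=> i; have := w0 i I; rewrite /= dotNl -coord_dot oppr_le0.
apply: closedI; last by apply: closedI; exact: closed_le.
by apply: closed_bigI => i _; exact: closed_le.
Qed.

(** A polytope is the image of a simplex, which is compact. *)
Lemma polytope_closed P : polytope P -> closed P.
Proof.
move=> [s ->].
pose S : 'M[R]_(size s, d) := \matrix_i s`_i.
have fE (w : 'rV_(size s)) : w *m S = \sum_i w 0 i *: s`_i.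
  rewrite mulmx_sum_row; apply: eq_bigr => i _; congr (_ *: _).
  by apply/rowP => k; rewrite !mxE.
have -> : convex_hull [set` s] = [set w *m S | w in @simplex (size s)].
  apply/seteqP; split.
    apply: hull_sub => [x y r [w [w0 w1] <-] [w' [w0' w1'] <-] r0 r1|x /= xs].
      exists (w + r *: (w' - w)); last first.
        by rewrite mulmxDl -scalemxAl mulmxBl.
      split=> [i|].
        rewrite !mxE; have := w0 i; have := w0' i => a b.
        have := mulr_ge0 r0 a; have : 0 <= (1 - r) * w 0 i.
          by rewrite mulr_ge0 ?subr_ge0.
        lra.
      rewrite (eq_bigr (fun i => w 0 i + r * (w' 0 i - w 0 i))); last first.
        by move=> i _; rewrite !mxE.
      by rewrite big_split /= -mulr_sumr sumrB w1 w1' subrr mulr0 addr0.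
    have ix : (index x s < size s)%N by rewrite index_mem.
    exists (delta_mx 0 (Ordinal ix)).
      split=> [i|]; first by rewrite mxE; case: (_ && _).
      rewrite (bigD1 (Ordinal ix)) //= mxE !eqxx big1 ?addr0 // => i ii.
      by rewrite mxE eqxx (negbTE ii).
    rewrite -rowE; apply/rowP => k; rewrite !mxE /=.
    by rewrite nth_index.
  move=> _ [w [w0 w1] <-]; rewrite fE.
  have := @convex_comb (convex_hull [set` s])
    [seq (w 0 i, s`_i) | i <- index_enum 'I_(size s)] (@hull_convex _).
  rewrite !big_map /=; apply => // c /mapP[i _ ->] /=; split=> //.
  by apply: sub_hull => /=; exact: mem_nth.
apply: compact_closed; first exact: norm_hausdorff.
apply: continuous_compact; last exact: simplex_compact.
apply: continuous_subspaceT.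
pose C := (size s)%:R * `|S| + 1.
have C0 : 0 < C by rewrite ltr_wpDl ?mulr_ge0.
move=> w A /nbhs_ballP[e /= e0 eA]; apply/nbhs_ballP.
exists (e / C); first by rewrite /= divr_gt0.
move=> w'; rewrite mx_norm_ball /ball_ /= ltr_pdivlMr // mulrC => ww.
apply: eA; rewrite mx_norm_ball /ball_ /= -mulmxBl.
apply: le_lt_trans ww; rewrite [leLHS]mx_normrE; apply/bigmax_leP.
split=> [|[i k] _ /=]; first by rewrite mulr_ge0 // ltW.
rewrite mxE; apply: le_trans (ler_norm_sum _ _ _) _.
have H q : `|(w - w') i q * S q k| <= `|w - w'| * `|S|.
  rewrite normrM; apply: ler_pM => //; rewrite [leRHS]mx_normrE.
    exact: (le_bigmax _ (fun ij => `|(w - w') ij.1 ij.2|) (i, q)).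
  exact: (le_bigmax _ (fun ij => `|S ij.1 ij.2|) (q, k)).
apply: le_trans (ler_sum _ (fun q _ => H q)) _.
rewrite sumr_const card_ord -[_ *+ _]mulr_natl /C mulrDl mul1r.
by rewrite mulrCA [X in _ <= X + _]mulrC lerDl.
Qed.

End Hull.

Section Body.
Context {R : realType} {d : nat}.
Implicit Types (x y z u v w : 'rV[R]_d) (A B P : set 'rV[R]_d).

(** A family of differences of maximal rank spans the direction space. *)
Lemma spanning_differences P x0 : has_dim P d -> P x0 ->
  exists2 X : seq 'rV[R]_d, (forall v, v \in X -> P (x0 + v)) &
    <<X>>%VS = fullv.
Proof.
move=> [_ [U [Ud Umin] dimU]] Px0.
pose Q k := `[< exists2 X : seq 'rV[R]_d, (forall v, v \in X -> P (x0 + v)) &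
  \dim <<X>>%VS = k >].
have Q0 : exists k, Q k by exists (\dim <<[::] : seq 'rV[R]_d>>); apply/asboolP; exists [::].
have Qd k : Q k -> (k <= d)%N.
  move=> /asboolP[X _ <-]; apply: leq_trans (dimvS (subvf _)) _.
  by rewrite dimvf /dim /= mul1n.
case: (ex_maxnP Q0 Qd) => k /asboolP[X HX dX] kmax.
exists X => //; apply/eqP; rewrite eqEdim subvf /= dimvf /dim /= mul1n -[leqLHS]dimU.
apply: dimvS; apply: Umin => x y Px Py.
have H z : P z -> z - x0 \in <<X>>%VS.
  move=> Pz; have : (\dim <<(z - x0)%R :: X>>%VS <= \dim <<X>>%VS)%N.
    rewrite dX; apply: kmax; apply/asboolP; exists ((z - x0) :: X) => //.
    by move=> v; rewrite inE => /orP[/eqP ->|/HX //]; rewrite addrC subrK.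
  move=> dd; have : (<<X>> == <<(z - x0)%R :: X>>)%VS.
    by rewrite eqEdim dd andbT; apply: sub_span => v vX; rewrite inE vX orbT.
  by move=> /eqP ->; rewrite memv_span ?mem_head.
by rewrite -(subrKA x0) -[x0 - y]opprB rpredB // H.
Qed.

(** The barycentre of finitely many points of P with spanning differences is an
    inner point. *)
Lemma full_dim_interior P : has_dim P d -> segment_closed P ->
  exists z, nbhs z P.
Proof.
move=> Pd cP; have [[x0 Px0] _] := Pd.
have [X HX spX] := spanning_differences Pd Px0.
pose m := size X; pose Y := in_tuple X.
pose c : R := m.+1%:R^-1.
have c0 : 0 < c by rewrite invr_gt0 ltr0n.
pose K := \sum_(i < m) \sum_j `|coord Y i (delta_mx 0 j)|.
have K0 : 0 <= K by apply: sumr_ge0 => i _; apply: sumr_ge0.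
have HK w : \sum_(i < m) `|coord Y i w| <= K * `|w|.
  rewrite mulr_suml; apply: ler_sum => i _.
  rewrite {1}(row_sum_delta w) linear_sum mulr_suml.
  apply: le_trans (ler_norm_sum _ _ _) _; apply: ler_sum => k _.
  rewrite linearZ /= normrM mulrC ler_wpM2l // [leRHS]mx_normrE.
  exact: (le_bigmax _ (fun ij => `|w ij.1 ij.2|) (0, k)).
exists (x0 + \sum_(i < m) c *: X`_i); apply/nbhs_ballP.
exists (c / (K + 1)); first by rewrite /= divr_gt0 // ltr_wpDl.
move=> y; rewrite mx_norm_ball /ball_ /= ltr_pdivlMr ?ltr_wpDl // => yc.
pose w := y - (x0 + \sum_(i < m) c *: X`_i).
have Hw : \sum_(i < m) `|coord Y i w| <= c.
  apply: le_trans (HK w) _; apply: ltW; apply: le_lt_trans yc.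
  by rewrite /w distrC mulrC ler_wpM2l // lerDl.
have wE : w = \sum_(i < m) coord Y i w *: X`_i.
  by apply: coord_span; rewrite spX memvf.
have [t tE] : {t : 'I_m -> R | forall i, t i = c + coord Y i w} by eexists.
have t0 i : 0 <= t i.
  have : `|coord Y i w| <= c.
    by apply: le_trans Hw; rewrite (bigD1 i) //= lerDl sumr_ge0.
  by rewrite ler_norml tE => /andP[]; rewrite -subr_ge0 opprK addrC.
have st : \sum_(i < m) t i <= 1.
  rewrite (eq_bigr _ (fun i _ => tE i)) big_split /= sumr_const card_ord.
  have : \sum_(i < m) coord Y i w <= c.
    by apply: le_trans Hw; apply: ler_sum => i _; exact: ler_norm.
  move=> H; apply: (@le_trans _ _ (c *+ m + c)); first by rewrite lerD2l.
  by rewrite -mulrSr -[_ *+ _]mulr_natl divff // pnatr_eq0.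
have := @convex_comb _ _ P ((1 - \sum_(i < m) t i, x0) ::
  [seq (t i, x0 + X`_i) | i <- index_enum 'I_m]) cP.
rewrite !big_cons !big_map /= => /(_ _ _)/=.
have -> : (1 - \sum_i t i) *: x0 + \sum_i t i *: (x0 + X`_i) = y.
  rewrite (eq_bigr (fun i : 'I_m => t i *: x0 + t i *: X`_i)); last first.
    by move=> i _; rewrite scalerDr.
  rewrite big_split /= -scaler_suml addrA -scalerDl subrK scale1r.
  rewrite (eq_bigr (fun i : 'I_m => c *: X`_i + coord Y i w *: X`_i)); last first.
    by move=> i _; rewrite tE scalerDl.
  by rewrite big_split /= -wE addrA /w addrC subrK.
apply; last by rewrite subrK.
move=> b; rewrite inE => /orP[/eqP ->|/mapP[i _ ->]] /=.
  by rewrite subr_ge0.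
by split=> //; apply: HX; exact: mem_nth.
Qed.

Section ConvexSet.
Variable P : set 'rV[R]_d.
Hypothesis cP : segment_closed P.

Lemma interior_segment x z (r : R) : P x -> nbhs z P -> 0 < r -> r <= 1 ->
  nbhs (x + r *: (z - x)) P.
Proof.
move=> Px /nbhs_ballP[e /= e0 eP] r0 r1; apply/nbhs_ballP.
exists (r * e); first by rewrite /= mulr_gt0.
move=> y; rewrite mx_norm_ball /ball_ /= => yr.
pose z' := x + r^-1 *: (y - x).
have Pz' : P z'.
  apply: eP; rewrite mx_norm_ball /ball_ /=.
  have -> : z - z' = r^-1 *: (x + r *: (z - x) - y).
    by apply/rowP => i; rewrite !mxE; field; rewrite gt_eqF.
  by rewrite normrZ gtr0_norm ?invr_gt0 // ltr_pdivrMl.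
have -> : y = x + r *: (z' - x).
  by apply/rowP => i; rewrite !mxE; field; rewrite gt_eqF.
exact: cP (ltW r0) r1.
Qed.

Lemma interior_strict z u (h : R) : nbhs z P -> u != 0 ->
  (forall x, P x -> dot u x <= h) -> dot u z < h.
Proof.
move=> zP u0 H; have [e e0 He] := open_line u zP.
have : P (z + (e / 2) *: u).
  apply: He; rewrite ger0_norm ?divr_ge0 ?ltW // ltr_pdivrMr //.
  by rewrite mulr_natr mulr2n ltrDl.
move=> /H; rewrite dotDr dotZr; apply: lt_le_trans.
by rewrite ltrDl mulr_gt0 ?dot_gt0 // divr_gt0.
Qed.

Hypothesis Pcl : closed P.

(** The last point of the segment from z to x that is in P. *)
Lemma exit_point z x : nbhs z P -> ~ P x -> exists r : R,
  [/\ 0 < r, r < 1, P (z + r *: (x - z)) & ~ nbhs (z + r *: (x - z)) P].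
Proof.
move=> zP nPx; have Pz : P z by exact: nbhs_singleton zP.
pose S := [set r : R | 0 <= r <= 1 /\ P (z + r *: (x - z))].
have S0 : S 0 by split; rewrite ?lexx ?ler01 // scale0r addr0.
have Sub : has_sup S.
  by split; [exists 0 | exists 1 => r [/andP[]]].
pose r := sup S.
have r0 : 0 <= r by exact: (sup_upper_bound Sub).
have r1 : r <= 1 by apply: ge_sup; [exists 0 | move=> q [/andP[]]].
have PS q : 0 <= q -> q < r -> P (z + q *: (x - z)).
  move=> q0 qr; have [|s Ss qs] := sup_adherent (eps := r - q) _ Sub.
    by rewrite subr_gt0.
  rewrite opprB addrC subrK in qs; case: Ss => /andP[s0 s1] Ps.
  have s00 : 0 < s by apply: le_lt_trans qs.
  have -> : z + q *: (x - z) = z + (q / s) *: (z + s *: (x - z) - z).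
    by apply/rowP => i; rewrite !mxE; field; rewrite gt_eqF.
  by apply: cP => //; [rewrite divr_ge0 // ltW | rewrite ler_pdivrMr // mul1r ltW].
have Pr : P (z + r *: (x - z)).
  have : closure P (z + r *: (x - z)); last by rewrite -(closure_id _).1.
  move=> B /(open_line (x - z))[e e0 He].
  move: r0; rewrite le_eqVlt => /orP[/eqP rE|rp].
    exists z; split=> //; have := He 0; rewrite normr0 => /(_ e0).
    by rewrite -rE !scale0r !addr0.
  pose q := Num.max 0 (r - e / 2).
  have qr : q < r by rewrite /q gt_max rp ltrBlDr ltrDl divr_gt0.
  have q0 : 0 <= q by rewrite /q le_max lexx.
  exists (z + q *: (x - z)); split; first exact: PS.
  have -> : z + q *: (x - z) = z + r *: (x - z) + (q - r) *: (x - z).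
    by apply/rowP => i; rewrite !mxE; ring.
  apply: He; rewrite ltr0_norm ?subr_lt0 // opprB.
  apply: (@le_lt_trans _ _ (e / 2)); last first.
    by rewrite ltr_pdivrMr // mulr_natr mulr2n ltrDl.
  by rewrite lerBlDr -lerBlDl /q le_max lexx orbT.
have rlt1 : r < 1.
  rewrite lt_neqAle r1 andbT; apply/eqP => rE; apply: nPx.
  by move: Pr; rewrite rE scale1r addrC subrK.
have rgt0 : 0 < r.
  have [e e0 He] := open_line (x - z) zP.
  pose q := Num.min (e / 2) 1.
  have q0 : 0 < q by rewrite /q lt_min ltr01 divr_gt0.
  apply: (lt_le_trans q0); apply: (sup_upper_bound Sub); split.
    by rewrite (ltW q0) /= /q ge_min lexx orbT.
  apply: He; rewrite gtr0_norm //; apply: (@le_lt_trans _ _ (e / 2)).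
    by rewrite /q ge_min lexx.
  by rewrite ltr_pdivrMr // mulr_natr mulr2n ltrDl.
exists r; split=> // nP.
have [e e0 He] := open_line (x - z) nP.
pose q := Num.min (e / 2) (1 - r).
have q0 : 0 < q by rewrite /q lt_min subr_gt0 rlt1 divr_gt0.
have : r + q <= r.
  apply: (sup_upper_bound Sub); split.
    by rewrite (addr_ge0 (ltW rgt0) (ltW q0)) /= -lerBrDl /q ge_min lexx orbT.
  rewrite scalerDl addrA; apply: He; rewrite gtr0_norm //.
  apply: (@le_lt_trans _ _ (e / 2)); first by rewrite /q ge_min lexx.
  by rewrite ltr_pdivrMr // mulr_natr mulr2n ltrDl.
by rewrite gerDl leNgt q0.
Qed.

End ConvexSet.

End Body.

(** * From face-to-face tilings to facet systems *)

Lemma finite_bounded_int d (N : nat) :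
  finite_set [set z : 'rV[int]_d | forall i : 'I_d, (absz (z 0%R i) <= N)%N].
Proof.
pose f (g : {ffun 'I_d -> 'I_(N + N).+1}) : 'rV[int]_d := \row_i ((g i)%:Z - N%:Z).
apply: (@sub_finite_set _ _ (f @` setT)); last exact/finite_image/finite_finset.
move=> z /= zN.
have H i : (absz (z 0%R i + N%:Z)%R < (N + N).+1)%N by have := zN i; lia.
exists [ffun i => Ordinal (H i)] => //; apply/rowP => i.
by rewrite !mxE ffunE /=; have := zN i; lia.
Qed.

Section Sep.
Context {R : realType} {d : nat}.

(** Rounding to a grid of mesh e / 2 separates the points. *)
Lemma separated_finite (T : set 'rV[R]_d) (e M : R) : 0 < e ->
  (forall t t', T t -> T t' -> `|t - t'| < e -> t = t') ->
  finite_set [set t | T t /\ `|t| <= M].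
Proof.
move=> e0 He; pose e2 := e / 2; have e20 : 0 < e2 by rewrite divr_gt0.
pose f (t : 'rV[R]_d) : 'rV[int]_d := \row_i Num.floor (t 0 i / e2).
pose N := (Num.truncn (M / e2)).+1.
pose A := [set t | T t /\ `|t| <= M].
have fin : finite_set (f @` A).
  apply: sub_finite_set (finite_bounded_int d N) => _ [t [_ tM] <-] i.
  rewrite mxE; set q := t 0 i / e2.
  have qN : `|q| < N%:R.
    apply: le_lt_trans (truncnS_gt (M / e2)).
    rewrite normrM [`|_^-1|]gtr0_norm ?invr_gt0 // ler_wpM2r ?invr_ge0 ?(ltW e20) //.
    by apply: le_trans tM; exact: coord_norm.
  move: qN; rewrite ltr_norml => /andP[q1 q2].
  have : (- N%:Z <= Num.floor q)%R by rewrite floor_ge_int rmorphN /= ltW.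
  have : (Num.floor q < N%:Z)%R by rewrite -(ltr_int R) (le_lt_trans (floor_le _)).
  lia.
pose g z := xget 0 [set t | A t /\ f t = z].
apply: (@sub_finite_set _ _ (g @` (f @` A))); last exact: finite_image.
move=> t At; exists (f t); first by exists t.
rewrite /g; case: xgetP => [t' _ [At' ff]|/(_ t)]; last by case; split.
apply: He; [by case: At' | by case: At |].
apply: (@le_lt_trans _ _ e2); last by rewrite /e2 ltr_pdivrMr // mulr_natr mulr2n ltrDl.
rewrite [leLHS]mx_normrE; apply/bigmax_leP; split=> [|[i k] _ /=]; first exact: ltW.
rewrite ord1; have := congr1 (fun z : 'rV[int]_d => z 0 k) ff; rewrite !mxE => E.
have /andP[a1 a2] := floor_itv (t 0 k / e2).
have /andP[b1 b2] := floor_itv (t' 0 k / e2).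
move: b1 b2; rewrite E => b1 b2; rewrite intrD in a2 b2.
have -> : t' 0 k - t 0 k = e2 * (t' 0 k / e2 - t 0 k / e2).
  by field; rewrite gt_eqF.
rewrite normrM gtr0_norm // -[leRHS]mulr1 ler_wpM2l ?(ltW e20) //.
rewrite ler_norml; apply/andP; split; lra.
Qed.

Lemma open_system (s : seq 'rV[R]_d) (n : 'rV[R]_d -> 'rV[R]_d) (h : 'rV[R]_d -> R) :
  open [set x | forall l, l \in s -> dot (n l) x < h l].
Proof.
elim: s => [|l s IH].
  by rewrite (_ : mkset _ = setT); [exact: openT | apply/seteqP; split].
rewrite (_ : mkset _ = [set x | dot (n l) x < h l] `&`
    [set x | forall l, l \in s -> dot (n l) x < h l]).
  by apply: openI => //; exact: open_lt.
apply/seteqP; split => x /=.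
  move=> H; split; last by move=> m ms; apply: H; rewrite inE ms orbT.
  by apply: H; rewrite inE eqxx.
by move=> [H1 H2] m; rewrite inE => /orP[/eqP ->|]; last exact: H2.
Qed.

(** Used to drop redundant inequalities. *)
Lemma minimal_seq (Q : seq 'rV[R]_d -> Prop) (s : seq 'rV[R]_d) : Q s -> uniq s ->
  exists s', [/\ Q s', uniq s', {subset s' <= s} & forall l, l \in s' -> ~ Q (rem l s')].
Proof.
have [k] := ubnP (size s); elim: k s => // k IH s; rewrite ltnS => sk Qs us.
have [[l ls Ql]|no] := pselect (exists2 l, l \in s & Q (rem l s)); last first.
  by exists s; split=> // l ls Ql; apply: no; exists l.
have sk' : (size (rem l s) < k)%N.
  by apply: leq_trans sk; rewrite size_rem // prednK //; case: (s) ls.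
have [s' [Q' u' sub H]] := IH (rem l s) sk' Ql (rem_uniq l us).
by exists s'; split=> // x /sub /mem_rem.
Qed.

End Sep.

Section Tiling.
Context {R : realType} {d : nat} {P T : set 'rV[R]_d}.
Hypotheses (hP : polytope P) (hd : has_dim P d) (hT : face_to_face_tiling P T).
Implicit Types (t u x y z v w l m b : 'rV[R]_d).

Let cP : segment_closed P.
Proof. by case: hP => s ->; exact: hull_convex. Qed.

Let Pcl : closed P := polytope_closed hP.

Lemma translateE (A : set 'rV[R]_d) t x : translate A t x <-> A (x - t).
Proof.
by split=> [[y Ay <-]|Ax]; [rewrite addrK | exists (x - t); rewrite ?subrK].
Qed.

Lemma nbhs_shift (A : set 'rV[R]_d) t x : nbhs (x - t) A ->
  nbhs x [set y | A (y - t)].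
Proof.
move=> /nbhs_ballP[e /= e0 eA]; apply/nbhs_ballP; exists e => // y.
rewrite mx_norm_ball /ball_ /= => xy; apply: eA.
by rewrite mx_norm_ball /ball_ /= opprB addrA subrK.
Qed.

Lemma tiles_disjoint t u x : T t -> T u -> nbhs (x - t) P -> nbhs (x - u) P -> t = u.
Proof.
move=> Tt Tu xt xu; apply/eqP/negPn/negP => /eqP tu.
have [_ /(_ t u Tt Tu tu) D _] := hT.
have N w : nbhs (x - w) P -> (translate P w)° x.
  move=> /nbhs_shift; apply: filterS => y /= Py; exact/translateE.
have : (set0 : set 'rV[R]_d) x; last by [].
by rewrite -D; split; exact: N.
Qed.

(** A point of the second cell next to x is inside this cell, and still inside
    the first one. *)
Lemma tile_inside t u x : T t -> T u -> nbhs (x - t) P -> P (x - u) -> t = u.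
Proof.
move=> Tt Tu xt xu; have [z zP] := full_dim_interior hd cP.
have /nbhs_interior xi := xt.
have [e e0 He] := open_line (z - (x - u)) xi.
pose r := Num.min (e / 2) 1.
have r0 : 0 < r by rewrite /r lt_min ltr01 divr_gt0.
apply: (@tiles_disjoint t u (x + r *: (z - (x - u)))) => //.
  rewrite addrAC; apply: He; rewrite gtr0_norm //.
  apply: (@le_lt_trans _ _ (e / 2)); first by rewrite /r ge_min lexx.
  by rewrite ltr_pdivrMr // mulr_natr mulr2n ltrDl.
rewrite addrAC; apply: interior_segment => //.
by rewrite /r ge_min lexx orbT.
Qed.

(** Cells with close translation vectors have common inner points. *)
Lemma tiles_locfin (M : R) : finite_set [set t | T t /\ `|t| <= M].
Proof.
have [z zP] := full_dim_interior hd cP.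
have /nbhs_ballP[e /= e0 eP] := zP.
apply: (separated_finite (e := e)) => // t t' Tt Tt' tt'.
apply: (@tile_inside t t' (z + t)) => //; first by rewrite addrK.
apply: eP; rewrite mx_norm_ball /ball_ /=.
by rewrite -addrA opprD addrA subrr sub0r normrN.
Qed.

Lemma tiles_meeting (M : R) : finite_set [set t | T t /\ exists2 x, `|x| <= M & P (x - t)].
Proof.
have [B HB] := polytope_bounded hP.
apply: sub_finite_set (tiles_locfin (M + B)) => t [Tt [x xM Px]]; split=> //.
have -> : t = x - (x - t) by rewrite opprB addrC subrK.
by apply: le_trans (ler_normB _ _) _; rewrite lerD // HB.
Qed.

(** By local finiteness and closedness, the cells that do not contain x stay away
    from x; if t alone contained x, it would contain a neighbourhood of x. *)
Lemma boundary_shared t x : T t -> P (x - t) -> ~ nbhs (x - t) P ->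
  exists u, [/\ T u, u != t & P (x - u)].
Proof.
move=> Tt Pt nb; apply: contrapT => no.
have /finite_seqP[s Hs] := tiles_meeting (`|x| + 1).
have sE u : u \in s <-> T u /\ exists2 x0, `|x0| <= `|x| + 1 & P (x0 - u).
  by have := congr1 (fun Z => Z u) Hs; rewrite /= => ->.
have H (r : seq 'rV[R]_d) : {subset r <= s} ->
    nbhs x [set y | forall u, u \in r -> u != t -> ~ P (y - u)].
  elim: r => [|u r IH] rs; first by apply: filterS filterT => y _.
  have IH' := IH (fun v vr => rs v ltac:(by rewrite inE vr orbT)).
  have [ut|ut] := eqVneq u t.
    apply: filterS IH' => y Hy v; rewrite inE => /orP[/eqP ->|]; last exact: Hy.
    by rewrite ut eqxx.
  have [/sE[Tu _] nPu] : u \in s /\ ~ P (x - u).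
    split; first by apply: rs; rewrite inE eqxx.
    move=> Pu; apply: no; exists u; split=> //.
    by have /sE[] : u \in s by apply: rs; rewrite inE eqxx.
  have : nbhs (x - u) (~` P).
    by apply: open_nbhs_nbhs; split=> //; exact: closed_openC.
  move=> /nbhs_shift; apply: filterS2 IH' => y Hy Hyu v.
  by rewrite inE => /orP[/eqP -> _|]; last exact: Hy.
apply: nb; have N : nbhs x [set y | P (y - t)].
  have B1 : nbhs x (ball x 1) by apply: nbhsx_ballx.
  have := H s (fun u us => us); apply: filterS2 B1 => y.
  rewrite mx_norm_ball /ball_ /= => xy Hy.
  have [cov _ _] := hT; have : [set: 'rV[R]_d] y by [].
  rewrite -cov => -[u Tu /translateE Pu].
  have [<- //|ut] := eqVneq u t.
  case: (Hy u _ ut Pu); apply/sE; split=> //; exists y => //.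
  have -> : y = x - (x - y) by rewrite opprB addrC subrK.
  by apply: le_trans (ler_normB _ _) _; rewrite lerD2l ltW.
have := @nbhs_shift [set y | P (y - t)] (- t) (x - t).
rewrite opprK subrK => /(_ N); apply: filterS => y /=.
by rewrite addrK.
Qed.

(** The common face is proper, since the cells have disjoint interiors; so it is
    cut out by a nonzero functional. *)
Lemma tiles_face t u x : T t -> T u -> t != u -> P (x - t) -> P (x - u) ->
  exists b (h : R), [/\ b != 0, forall y, P y -> dot b y <= h &
    forall y, P y -> (P (y + t - u) <-> dot b y = h)].
Proof.
move=> Tt Tu tu xt xu; have [_ _ /(_ t u Tt Tu)] := hT.
case=> [I0|[[_ [b Hb]] _]].
  by have : (set0 : set 'rV[R]_d) x by rewrite -I0; split; exact/translateE.
have HI y : (P (y - t) /\ P (y - u)) <->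
    (P (y - t) /\ forall y', P y' -> dot b y' <= dot b (y - t)).
  have := congr1 (fun Z => Z y) Hb; rewrite /= /setI /= => E.
  rewrite -(translateE P t) -(translateE P u) E.
  split=> -[H1 H2]; split=> //.
    move=> y' Py'; have /H2 : translate P t (y' + t) by exists y'.
    by rewrite !dotE lerBrDr.
  move=> _ [y' Py' <-]; have := H2 _ Py'; rewrite !dotE; lra.
have [_ xm] := (HI x).1 (conj xt xu).
exists b, (dot b (x - t)); split=> //.
  apply/eqP => b0; have [z zP] := full_dim_interior hd cP.
  have Pz : P z by exact: nbhs_singleton zP.
  move/eqP: tu; apply; apply: (@tile_inside t u (z + t)) => //; first by rewrite addrK.
  apply: ((HI (z + t)).2 _).2; rewrite addrK; split=> // y' _.
  by rewrite b0 !dot0l.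
move=> y Py; have := HI (y + t); rewrite addrK => -[H1 H2]; split.
  move=> Pu; have [_ ym] := H1 (conj Py Pu).
  by apply/eqP; rewrite eq_le ym // xm.
move=> E; apply: (H2 _).2; split=> // y' Py'; rewrite E; exact: xm.
Qed.

End Tiling.

Section Neighbours.
Context {R : realType} {d : nat} {P T : set 'rV[R]_d}.
Hypotheses (hP : polytope P) (hd : has_dim P d) (hT : face_to_face_tiling P T).
Implicit Types (t u x v w l m b : 'rV[R]_d).

Lemma periodic_bounded (A : set 'rV[R]_d) x v : (forall y, A y -> P y) -> A x ->
  (forall y, A y -> A (y + v)) -> v = 0.
Proof.
move=> AP; have [M HM] := polytope_bounded hP.
by apply: (@bounded_periodic _ _ A M) => y /AP; exact: HM.
Qed.

Variables (L : seq 'rV[R]_d) (n y : 'rV[R]_d -> 'rV[R]_d) (h : 'rV[R]_d -> R).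
Variable z : 'rV[R]_d.
Hypothesis uL : uniq L.
Hypothesis PE : forall x, P x <-> forall l, l \in L -> dot (n l) x <= h l.
Hypothesis n1 : forall l, l \in L -> dot (n l) (n l) = 1.
Hypothesis yh : forall l, l \in L -> dot (n l) (y l) = h l.
Hypothesis ylt : forall l m, l \in L -> m \in L -> m != l -> dot (n m) (y l) < h m.
Hypothesis zlt : forall l, l \in L -> dot (n l) z < h l.

Lemma strict_nbhs x : (forall l, l \in L -> dot (n l) x < h l) -> nbhs x P.
Proof.
move=> Hx; have := open_nbhs_nbhs (conj (@open_system _ _ L n h) Hx).
by apply: filterS => w Hw; apply/PE => l lL; apply/ltW/Hw.
Qed.

Lemma facet_point_in l : l \in L -> P (y l).
Proof.
move=> lL; apply/PE => m mL; have [->|ml] := eqVneq m l; first by rewrite yh.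
exact/ltW/ylt.
Qed.

Lemma facet_point_ray l v : l \in L -> dot (n l) v <= 0 ->
  exists2 e, 0 < e & forall k : R, 0 <= k -> k <= e -> P (y l + k *: v).
Proof.
move=> lL lv.
have Hy : [set x | forall m, m \in rem l L -> dot (n m) x < h m] (y l).
  by move=> m; rewrite mem_rem_uniq // inE => /andP[ml mL]; exact: ylt.
have [e e0 He] := open_line v (open_nbhs_nbhs (conj (@open_system _ _ _ n h) Hy)).
exists (e / 2); first by rewrite divr_gt0.
move=> k k0 ke; apply/PE => m mL.
have [->|ml] := eqVneq m l.
  by rewrite dotDr dotZr yh // gerDl mulr_ge0_le0.
apply: ltW; apply: He; last by rewrite mem_rem_uniq // inE ml.
rewrite ger0_norm //; apply: le_lt_trans ke _.
by rewrite ltr_pdivrMr // mulr_natr mulr2n ltrDl.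
Qed.

Lemma facet_point_ray_int l v : l \in L -> dot (n l) v < 0 ->
  exists2 e, 0 < e & forall k : R, 0 < k -> k <= e -> nbhs (y l + k *: v) P.
Proof.
move=> lL lv; have [e e0 He] := facet_point_ray lL (ltW lv).
exists (e / 2) => [|k k0 ke]; first by rewrite divr_gt0.
apply: strict_nbhs => m mL; have [->|ml] := eqVneq m l.
  by rewrite dotDr dotZr yh // gtrDl pmulr_rlt0.
have : P (y l + (2 * k) *: v) by apply: He; lra.
move/PE => /(_ m mL); have := ylt lL mL ml; rewrite !dotDr !dotZr.
lra.
Qed.

Lemma facet_point_line l v : l \in L -> dot (n l) v = 0 ->
  exists2 e : R, 0 < e & P (y l + e *: v) /\ P (y l - e *: v).
Proof.
move=> lL lv; have [|e1 e10 H1] := @facet_point_ray l v lL; first by rewrite lv.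
have [|e2 e20 H2] := @facet_point_ray l (- v) lL; first by rewrite dotNr lv oppr0.
exists (Num.min e1 e2); first by rewrite lt_min e10.
have e0 : 0 <= Num.min e1 e2 by rewrite le_min !ltW.
split; first by apply: H1 => //; rewrite ge_min lexx.
by rewrite -scalerN; apply: H2 => //; rewrite ge_min lexx orbT.
Qed.

(** A functional constant on a facet is a multiple of the normal of the facet. *)
Lemma normal_unique l b : l \in L -> (forall v, dot (n l) v = 0 -> dot b v = 0) ->
  b = dot (n l) b *: n l.
Proof.
move=> lL H; pose w := b - dot (n l) b *: n l.
have lw : dot (n l) w = 0 by rewrite /w !dotE n1 // mulr1 subrr.
have bw := H _ lw.
have : dot w w = dot b w - dot (n l) b * dot (n l) w.
  by rewrite [in LHS]/w dotDl dotNl dotZl.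
rewrite lw bw mulr0 subrr => /eqP; rewrite dot_eq0 subr_eq0 => /eqP.
by [].
Qed.

(** A functional that is maximal at an inner point of a facet is constant on
    the facet, and it increases from the inner point z to the facet. *)
Lemma max_at_facet_point l b : l \in L -> b != 0 ->
  (forall x, P x -> dot b x <= dot b (y l)) ->
  0 < dot (n l) b /\ b = dot (n l) b *: n l.
Proof.
move=> lL b0 H.
have bE : b = dot (n l) b *: n l.
  apply: normal_unique => // v lv; have [e e0 [P1 P2]] := facet_point_line lL lv.
  have := H _ P1; have := H _ P2; rewrite !(dotDr, dotNr, dotZr) => A1 A2.
  have : e * dot b v = 0 by lra.
  by move=> /eqP; rewrite mulf_eq0 (gt_eqF e0) => /eqP.
split=> //; have Pz : P z by apply/PE => m mL; apply/ltW/zlt.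
have A : dot (n l) b * dot (n l) z <= dot (n l) b * h l.
  by have := H _ Pz; rewrite -(yh lL) -!dotZl -bE.
have k0 : dot (n l) b != 0 by apply/eqP => k0; move: b0; rewrite bE k0 scale0r eqxx.
rewrite lt_def k0 /= leNgt; apply/negP => k1; move: A.
by rewrite ler_nM2l // leNgt zlt.
Qed.

Hypothesis zP : nbhs z P.

(** The cell u at an inner point of the facet l of t contains this whole facet.
    The intersection is a face of u as well, where the functional is a negative
    multiple of the normal, because otherwise both cells would lie on the same
    side of the facet and overlap. *)
Lemma shared_facet t u l : T t -> T u -> t != u -> l \in L -> P (y l + t - u) ->
  (forall x, P x -> (P (x + t - u) <-> dot (n l) x = h l)) /\
  (forall x, P x -> (P (x + u - t) <-> forall w, P w -> dot (n l) x <= dot (n l) w)).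
Proof.
move=> Tt Tu tu lL Pu; have Py := facet_point_in lL.
have Pyt : P (y l + t - t) by rewrite addrK.
have [b [hb [b0 bm bE]]] := tiles_face hP hd hT Tt Tu tu Pyt Pu.
have hbE : hb = dot b (y l) by rewrite (bE _ Py).1.
have [k0 kE] := max_at_facet_point lL b0 (fun x Px => ltac:(by rewrite -hbE; exact: bm)).
have F1 x : P x -> (P (x + t - u) <-> dot (n l) x = h l).
  move=> Px; rewrite bE // hbE kE !dotZl yh //; split=> [|->] //.
  by apply: mulfI; rewrite gt_eqF.
have ut : u != t by rewrite eq_sym.
have [b' [hb' [b0' bm' bE']]] := tiles_face hP hd hT Tu Tt ut Pu Pyt.
have [m mE] : {m | m = y l + t - u} by eexists.
have mt : m + u - t = y l by rewrite mE subrK addrK.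
have Pm : P m by rewrite mE.
have Em : dot b' m = hb' by apply/(bE' m) => //; rewrite mt.
have b'E : b' = dot (n l) b' *: n l.
  apply: normal_unique => // v lv; have [e e0 [P1 P2]] := facet_point_line lL lv.
  have Q1 : P (m + e *: v).
    have -> : m + e *: v = (y l + e *: v) + t - u by rewrite mE; apply/rowP => i; rewrite !mxE; ring.
    by apply/F1 => //; rewrite dotDr dotZr lv mulr0 addr0 yh.
  have Q2 : P (m - e *: v).
    have -> : m - e *: v = (y l - e *: v) + t - u by rewrite mE; apply/rowP => i; rewrite !mxE; ring.
    by apply/F1 => //; rewrite dotDr dotNr dotZr lv mulr0 oppr0 addr0 yh.
  have := bm' _ Q1; have := bm' _ Q2; rewrite !(dotDr b', dotNr b', dotZr _ b') Em => A1 A2.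
  have : e * dot b' v = 0 by lra.
  by move=> /eqP; rewrite mulf_eq0 (gt_eqF e0) => /eqP.
have k0' : dot (n l) b' != 0.
  by apply/eqP => E; move: b0'; rewrite b'E E scale0r eqxx.
have kneg : dot (n l) b' < 0.
  rewrite lt_neqAle k0' leNgt; apply/negP => kpos; move/eqP: tu; apply.
  have Pz : P z by exact: nbhs_singleton zP.
  have zm : dot (n l) (z - m) < 0.
    have := interior_strict zP b0' bm'; rewrite -Em b'E !dotZl ltr_pM2l //.
    by rewrite dotDr dotNr subr_lt0.
  have [e e0 He] := facet_point_ray_int lL zm.
  pose r := Num.min e 1.
  have r0 : 0 < r by rewrite /r lt_min e0 ltr01.
  apply: (tiles_disjoint hT Tt Tu (x := y l + r *: (z - m) + t)).
    by rewrite addrK; apply: He; rewrite // /r ge_min lexx.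
  have -> : y l + r *: (z - m) + t - u = m + r *: (z - m).
    by rewrite mE; apply/rowP => i; rewrite !mxE; ring.
  apply: interior_segment => //; first by case: hP => s ->; exact: hull_convex.
  by rewrite /r ge_min lexx orbT.
split=> // x Px; rewrite bE' // -Em b'E !dotZl; split=> [/(mulfI k0') xm w Pw|H].
  rewrite xm; have := bm' _ Pw; rewrite -Em b'E !dotZl.
  by rewrite ler_nM2l.
congr (_ * _); apply/eqP; rewrite eq_le H //=.
by have := bm' _ Px; rewrite -Em b'E !dotZl ler_nM2l.
Qed.

(** Two neighbours across the same facet would differ by a translation that moves
    the facet of P to itself. *)
Lemma shared_facet_unique t u t' u' l : T t -> T u -> t != u ->
  T t' -> T u' -> t' != u' -> l \in L ->
  P (y l + t - u) -> P (y l + t' - u') -> u - t = u' - t'.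
Proof.
move=> Tt Tu tu Tt' Tu' tu' lL Pu Pu'.
have [A1 A2] := shared_facet Tt Tu tu lL Pu.
have [B1 B2] := shared_facet Tt' Tu' tu' lL Pu'.
apply/eqP; rewrite -subr_eq0; apply/eqP.
pose A := [set x | P x /\ dot (n l) x = h l].
have PK x a b : P (x + a - b + b - a) = P x by congr P; rewrite subrK addrK.
apply: (@periodic_bounded A (y l)).
- by move=> x [].
- by split; [exact: facet_point_in | exact: yh].
move=> x [Px xh].
have E : x + (u - t - (u' - t')) = (x + t' - u') + u - t.
  by apply/rowP => i; rewrite !mxE; ring.
have Px' : P (x + t' - u') by apply/B1.
have : P (x + t' - u' + u' - t') by rewrite PK.
move/(B2 _ Px')/(A2 _ Px') => Q; rewrite E; split=> //.
by apply/(A1 _ Q); rewrite PK.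
Qed.

End Neighbours.

(** All inequalities come from the neighbours of a single cell: a point outside P
    is separated from an inner point by a boundary point, which belongs to a
    neighbour by [boundary_shared], and the functional of the common face is
    violated. A minimal subsystem is a facet description of P. It is invariant
    under l |-> - l because the neighbour t0 + l has the common facet in the
    direction - l, where the functional is a negative multiple of n l. *)
Lemma facet_system_exists {R : realType} {d : nat} (P T : set 'rV[R]_d) :
  polytope P -> has_dim P d -> face_to_face_tiling P T ->
  inhabited (facet_system P T).
Proof.
move=> hP hd hT.
have cP : segment_closed P by case: hP => s ->; exact: hull_convex.
have Pcl : closed P := polytope_closed hP.
have [M HM] := polytope_bounded hP.
have [z zP] := full_dim_interior hd cP.
have Pz : P z by exact: nbhs_singleton zP.
have [cov _ _] := hT.
have covered x : exists2 t, T t & P (x - t).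
  have : [set: 'rV[R]_d] x by [].
  by rewrite -cov => -[t Tt /translateE Pt]; exists t.
have [t0 Tt0 _] := covered 0.
have : finite_set [set u | [/\ T u, u != t0 & exists x, P (x - t0) /\ P (x - u)]].
  apply: sub_finite_set (tiles_meeting hP hd hT (M + `|t0|)) => u [Tu _ [x [x0 xu]]].
  split=> //; exists x => //; rewrite -[x](subrK t0).
  by apply: le_trans (ler_normD _ _) _; rewrite lerD2r HM.
move=> /finite_seqP[us Hus].
have usP u : u \in us <-> [/\ T u, u != t0 & exists x, P (x - t0) /\ P (x - u)].
  by have := congr1 (fun Z => Z u) Hus; rewrite /= => ->.
pose s0 := undup [seq u - t0 | u <- us].
have s0P l : l \in s0 -> [/\ T (t0 + l), t0 != t0 + l & exists x, P x /\ P (x - l)].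
  rewrite mem_undup => /mapP[u /usP[Tu ut [x [x0 xu]]] ->].
  rewrite addrC subrK eq_sym; split=> //; exists (x - t0); split=> //.
  by rewrite opprB addrA subrK.
have : forall l, exists bh : 'rV[R]_d * R, l \in s0 ->
    [/\ dot bh.1 bh.1 = 1, forall x, P x -> dot bh.1 x <= bh.2 &
     forall x, P x -> (P (x - l) <-> dot bh.1 x = bh.2)].
  move=> l; have [ls|] := boolP (l \in s0); last by exists (0, 0).
  have [Tl tl [x [Px Pxl]]] := s0P l ls.
  have [||b [h [b0 bm bE]]] := tiles_face hP hd hT Tt0 Tl tl (x := x + t0).
  - by rewrite addrK.
  - by rewrite opprD addrA addrK.
  have r0 : 0 < enorm b by rewrite sqrtr_gt0 dot_gt0.
  exists ((enorm b)^-1 *: b, (enorm b)^-1 * h) => _ /=; split.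
  - rewrite dotZl dotZr -sqr_enorm expr2; field.
    by rewrite gt_eqF.
  - by move=> w Pw; rewrite dotZl ler_wpM2l ?bm // invr_ge0 ltW.
  move=> w Pw; have := bE w Pw; rewrite opprD addrA addrK => ->.
  rewrite dotZl; split=> [->//|]; apply: mulfI.
  by rewrite invr_neq0 // gt_eqF.
move=> /choice[bh Hbh].
pose n l := (bh l).1; pose h l := (bh l).2.
pose Q (s : seq 'rV[R]_d) := {subset s <= s0} /\
  forall x, P x <-> forall l, l \in s -> dot (n l) x <= h l.
have Qs0 : Q s0.
  split=> // x; split=> [Px l /Hbh[_ H _]|H]; first exact: H.
  apply: contrapT => nPx.
  have [r [r0 r1 Pr nr]] := exit_point cP Pcl zP nPx.
  set w := z + r *: (x - z) in Pr nr.
  have [|| u [Tu ut Pu]] := boundary_shared hP hd hT (x := w + t0) Tt0.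
  - by rewrite addrK.
  - by rewrite addrK.
  pose l := u - t0.
  have ls : l \in s0.
    rewrite mem_undup; apply: map_f; apply/usP; split=> //.
    by exists (w + t0); rewrite addrK.
  have [nn nm nE] := Hbh l ls.
  have n0 : (bh l).1 != 0.
    by apply/eqP => n0; move: nn; rewrite n0 dot0l => /eqP; rewrite eq_sym oner_eq0.
  have wh : dot (n l) w = h l.
    apply/nE => //; move: Pu; rewrite /l opprB addrA; congr P.
  have zh : dot (n l) z < h l by exact: interior_strict zP n0 nm.
  have := H l ls; rewrite leNgt => /negP; apply.
  move: wh; rewrite /w dotDr dotZr dotDr dotNr => wh.
  have E : dot (n l) x - h l = (1 - r) / r * (h l - dot (n l) z).
    by rewrite -wh; field; rewrite gt_eqF.
  by rewrite -subr_gt0 E mulr_gt0 ?divr_gt0 ?subr_gt0.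
have [L [[Ls PE] uL sub0 Lmin]] := minimal_seq Qs0 (undup_uniq _).
have LB l : l \in L -> [/\ dot (n l) (n l) = 1, forall x, P x -> dot (n l) x <= h l &
     forall x, P x -> (P (x - l) <-> dot (n l) x = h l)].
  by move=> /Ls; exact: Hbh.
have n1 l : l \in L -> dot (n l) (n l) = 1 by case/LB.
have n0 l : l \in L -> n l != 0 by move=> /n1 H; rewrite -dot_eq0 H oner_eq0.
have zlt l : l \in L -> dot (n l) z < h l.
  by move=> lL; have [_ H _] := LB l lL; exact: interior_strict zP (n0 l lL) H.
have : forall l, exists y, l \in L -> dot (n l) y = h l /\
    forall m, m \in L -> m != l -> dot (n m) y < h m.
  move=> l; have [lL|] := boolP (l \in L); last by exists 0.
  have [x Hx nx] : exists2 x, (forall m, m \in L -> m != l -> dot (n m) x <= h m) &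
      h l < dot (n l) x.
    apply: contrapT => no; apply: (Lmin l lL); split.
      by move=> m /mem_rem /Ls.
    move=> x; split=> [Px m /mem_rem mL|H]; first by have [_ H _] := LB m mL; exact: H.
    apply/PE => m mL; have [->|ml] := eqVneq m l; last first.
      by apply: H; rewrite mem_rem_uniq // inE ml.
    rewrite leNgt; apply/negP => lx; apply: no; exists x => // k kL kl.
    by apply: H; rewrite mem_rem_uniq // inE kl.
  have zl := zlt l lL.
  pose r := (h l - dot (n l) z) / (dot (n l) x - dot (n l) z).
  have den : 0 < dot (n l) x - dot (n l) z by rewrite subr_gt0 (lt_trans zl nx).
  have r0 : 0 < r by rewrite divr_gt0 // subr_gt0.
  have r1 : r < 1 by rewrite ltr_pdivrMr // mul1r ltrD2r.
  exists (z + r *: (x - z)) => _; split.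
    by rewrite !(dotDr, dotZr, dotNr) /r; field; rewrite gt_eqF.
  move=> m mL ml; rewrite !(dotDr, dotZr, dotNr).
  have := Hx m mL ml; have := zlt m mL; move: (dot (n m) z) (dot (n m) x) => a b a1 b1.
  have : (1 - r) * (a - h m) < 0 by rewrite pmulr_rlt0 ?subr_gt0 // subr_lt0.
  have : r * (b - h m) <= 0 by rewrite pmulr_rle0 // subr_le0.
  lra.
move=> /choice[y Hy].
have yh l : l \in L -> dot (n l) (y l) = h l by case/Hy.
have ylt l m : l \in L -> m \in L -> m != l -> dot (n m) (y l) < h m.
  by move=> /Hy[_]; apply.
have Py l : l \in L -> P (y l) by exact: (facet_point_in PE yh ylt).
have Pyl l : l \in L -> P (y l - l).
  by move=> lL; have [_ _ H] := LB l lL; apply/H; [exact: Py | exact: yh].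
have Tl l : l \in L -> T (t0 + l) /\ t0 != t0 + l by move=> /Ls /s0P[].
have Pyl' l : l \in L -> P (y l + t0 - (t0 + l)).
  by move=> lL; rewrite opprD addrA addrK; exact: Pyl.
have SFU := shared_facet_unique hP hd hT uL PE n1 yh ylt zlt zP.
have SF := shared_facet hP hd hT uL PE n1 yh ylt zlt zP.
have step t l : T t -> l \in L -> T (t + l).
  move=> Tt lL; have [|| u [Tu ut Pu]] := boundary_shared hP hd hT (x := y l + t) Tt.
  - by rewrite addrK; exact: Py.
  - rewrite addrK => nb; have [_ H _] := LB l lL.
    by have := interior_strict nb (n0 l lL) H; rewrite yh // ltxx.
  rewrite eq_sym in ut; have [Ttl ntl] := Tl l lL.
  have := SFU _ _ _ _ _ Tt Tu ut Tt0 Ttl ntl lL Pu (Pyl' l lL).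
  rewrite (addrC t0) addrK => /eqP; rewrite subr_eq addrC => /eqP E.
  by rewrite -E.
have opp l : l \in L -> [/\ - l \in L, n (- l) = - n l & h (- l) = dot (n l) l - h l].
  move=> lL; have [Ttl ntl] := Tl l lL.
  have [_ F2] := SF _ _ _ Tt0 Ttl ntl lL (Pyl' l lL).
  have Pm := Pyl l lL.
  have mmin : forall w, P w -> dot (n l) (y l - l) <= dot (n l) w.
    by apply/F2 => //; rewrite [t0 + l]addrC addrA addrK subrK; exact: Py.
  (* the facet of P that contains the translate by - l of the facet l *)
  have [k kL kt] : exists2 k, k \in L & dot (n k) (y l - l) = h k.
    apply: contrapT => no.
    have nb : nbhs (y l - l) P.
      apply: (strict_nbhs PE) => k kL; rewrite lt_neqAle.
      have [_ H _] := LB k kL; rewrite H // andbT.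
      by apply/eqP => E; apply: no; exists k.
    have : - n l != 0 by rewrite oppr_eq0 n0.
    move=> /(interior_strict nb (h := - dot (n l) (y l - l))).
    rewrite dotNl ltxx => H; suff : false by [].
    by apply: H => w Pw; rewrite dotNl lerN2 mmin.
  have kE : n k = dot (n l) (n k) *: n l.
    apply: (normal_unique n1) => // v lv.
    have [e e0 [P1 P2]] := facet_point_line uL PE yh ylt lL lv.
    have [_ _ Hl] := LB l lL; have [_ Hk _] := LB k kL.
    have Q1 : P (y l + e *: v - l).
      by apply/Hl => //; rewrite dotDr dotZr lv mulr0 addr0 yh.
    have Q2 : P (y l - e *: v - l).
      by apply/Hl => //; rewrite dotDr dotNr dotZr lv mulr0 subr0 yh.
    have := Hk _ Q1; have := Hk _ Q2; rewrite -kt.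
    rewrite (addrAC (y l) (e *: v)) (addrAC (y l) (- (e *: v))) !(dotDr (n k) (y l - l)).
    rewrite dotNr dotZr => A1 A2.
    have : e * dot (n k) v = 0 by lra.
    by move=> /eqP; rewrite mulf_eq0 (gt_eqF e0) => /eqP.
  have := n1 k kL; rewrite kE dotZl dotZr n1 // mulr1 => /eqP.
  rewrite -expr2 sqrf_eq1 => /orP[/eqP k1|/eqP k1].
    exfalso; have := zlt k kL; rewrite -kt ltNge => /negP; apply.
    by rewrite kE k1 scale1r; exact: mmin.
  have nk : n k = - n l by rewrite kE k1 scaleN1r.
  have [Ttk ntk] := Tl k kL.
  have ntl' : t0 + l != t0 by rewrite eq_sym.
  have Pk : P (y k + (t0 + l) - t0).
    apply/F2; first exact: Py.
    move=> w Pw; have [_ H _] := LB k kL; have := H w Pw.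
    by rewrite -(yh k kL) nk !dotNl lerN2.
  have := SFU _ _ _ _ _ Tt0 Ttk ntk Ttl Tt0 ntl' kL (Pyl' k kL) Pk.
  rewrite (addrC t0) addrK opprD addrA subrr sub0r => E; rewrite E in kL kt nk.
  by split=> //; rewrite -kt nk dotNl dotDr dotNr yh // opprB.
constructor.
apply: (@FacetSystem _ _ P T L n h y z uL PE n1) => //.
- by move=> l /opp[].
- by move=> l /opp[].
- by move=> l /opp[].
- by move=> l x lL Px xh; have [_ _ H] := LB l lL; apply/H.
- move=> t u x Tt Tu Hx Pu.
  by apply: (tile_inside hP hd hT Tt Tu _ Pu); exact: (strict_nbhs PE).
- move=> t u x w r Tt Tu Pt Pu r0 P1 P2.
  have [<- //|tu] := eqVneq t u.
  have [b [hb [b0 bm bE]]] := tiles_face hP hd hT Tt Tu tu Pt Pu.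
  have xh : dot b (x - t) = hb by apply/bE => //; rewrite subrK.
  have := bm _ P1; have := bm _ P2; rewrite (addrAC x w) (addrAC x (- (r *: w))) !(dotDr b (x - t)) dotNr dotZr xh => A1 A2.
  have := (bE _ P1).2; rewrite subrK; apply.
  have w0 : 0 <= dot b w by rewrite -(pmulr_rge0 _ r0); lra.
  by rewrite addrAC dotDr xh; lra.
- by exists M.
exact: (tiles_locfin hP hd hT).
Qed.

(** * Faces of the tiling and torsion *)

Section Orth.
Context {R : realType} {d : nat}.
Implicit Types (u v w x y : 'rV[R]_d).

(** The orthogonal complement of the rows of M. *)
Definition orth k (M : 'M[R]_(k, d)) : {vspace 'rV[R]_d} :=
  lker (linfun (mulmxr M^T : 'rV[R]_d -> 'rV[R]_k)).

Lemma orthP k (M : 'M[R]_(k, d)) v :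
  v \in orth M <-> forall i, dot (row i M) v = 0.
Proof.
rewrite memv_ker lfunE /=.
have E i : (v *m M^T) 0 i = dot (row i M) v.
  by rewrite dotC mxE; apply: eq_bigr => q _; rewrite !mxE.
split=> [/eqP H i|H]; first by rewrite -E H mxE.
by apply/eqP/rowP => i; rewrite E H mxE.
Qed.

Lemma dim_orth k (M : 'M[R]_(k, d)) : M *m M^T = 1%:M ->
  (\dim (orth M) + k = d)%N.
Proof.
move=> MM; pose f := linfun (mulmxr M^T : 'rV[R]_d -> 'rV[R]_k).
have := limg_ker_dim f fullv; rewrite capfv -/(orth M) dimvf /dim /= mul1n => E.
rewrite -[RHS]E; congr (_ + _)%N.
have -> : limg f = fullv.
  apply/eqP; rewrite eqEsubv subvf /=; apply/subvP => w _.
  have -> : w = f (w *m M) by rewrite lfunE /= -mulmxA MM mulmx1.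
  by rewrite memv_img ?memvf.
by rewrite dimvf /dim /= mul1n.
Qed.

Lemma orth1 u : dot u u = 1 -> (u : 'M[R]_(1, d)) *m u^T = 1%:M.
Proof.
move=> uu; apply/matrixP => i k; rewrite !ord1 mxE !mxE eqxx -[RHS]uu.
by apply: eq_bigr => q _; rewrite mxE.
Qed.

Lemma orth2 u v : orthonormal u v -> (col_mx u v : 'M[R]_(1 + 1, d)) *m (col_mx u v)^T = 1%:M.
Proof.
move=> [uu vv uv]; rewrite tr_col_mx mul_col_row !orth1 //.
have E x y : x *m y^T = (dot x y)%:M.
  apply/matrixP => i k; rewrite !ord1 !mxE eqxx mulr1n.
  by apply: eq_bigr => q _; rewrite mxE.
by rewrite !E (dotC v) uv raddf0 -scalar_mx_block.
Qed.

Lemma orth_row u v : v \in orth (u : 'M[R]_(1, d)) <-> dot u v = 0.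
Proof.
rewrite orthP; split=> [/(_ 0)|H i]; first by rewrite row_id.
by rewrite ord1 row_id.
Qed.

Lemma orth_pair u w v : v \in orth (col_mx u w : 'M[R]_(1 + 1, d)) <->
  dot u v = 0 /\ dot w v = 0.
Proof.
rewrite orthP; split=> [H|[H1 H2] i].
  have := H (lshift 1 0); have := H (rshift 1 0).
  by rewrite rowKu rowKd !row_id.
by case: (split_ordP i) => k ->; rewrite ?rowKu ?rowKd ord1 row_id.
Qed.

End Orth.

Section Faces.
Context {R : realType} {d : nat} {P T : set 'rV[R]_d} (D : facet_system P T).
Implicit Types (t u x y f v l m : 'rV[R]_d) (F G : set 'rV[R]_d).
Local Notation L := (fvec D).
Local Notation n := (nrm D).
Local Notation tight := (tight D).

(** The smallest face of the cell t that contains f. *)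
Definition min_face t f : set 'rV[R]_d :=
  [set x | P (x - t) /\ forall l, tight t f l -> tight t x l].

Definition facet t l : set 'rV[R]_d := [set x | P (x - t) /\ tight t x l].

Lemma min_face_id t f : P (f - t) -> min_face t f f.
Proof. by []. Qed.

Lemma tight_sub t x y l : tight t x l -> tight t y l -> dot (n l) (x - y) = 0.
Proof.
move=> /tightP[_ xl] /tightP[_ yl].
have -> : x - y = (x - t) - (y - t) by rewrite opprB addrA subrK.
by rewrite dotDr dotNr xl yl subrr.
Qed.

(** At a point f of the face with as few tight constraints as possible, all of
    them are tight on the whole face: consider midpoints. *)
Lemma face_min_face t F : face (translate P t) F ->
  exists f, [/\ F f, P (f - t) & F = min_face t f].
Proof.
move=> [[x0 Fx0] [b FE]].
have FP x : F x <-> P (x - t) /\ forall y, P (y - t) -> dot b y <= dot b x.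
  rewrite FE /=; split=> -[/translateE Px H]; split=> //.
    by move=> y Py; apply: H; apply/translateE.
  by move=> y /translateE; exact: H.
pose c x := count (tight t x) L.
pose Q (k : nat) := `[< exists2 x, F x & c x = k >].
have Qex : exists k, Q k by exists (c x0); apply/asboolP; exists x0.
case: (ex_minnP Qex) => k /asboolP[f Ff ck] kmin.
have [Pf fmax] := (FP f).1 Ff.
exists f; split=> //; apply/seteqP; split => x.
  move=> Fx; have [Px xmax] := (FP x).1 Fx; split=> // l tl.
  pose g := 2^-1 *: (f + x).
  have gt' : g - t = 2^-1 *: (f - t) + 2^-1 *: (x - t).
    by apply/rowP => i; rewrite !mxE; field.
  have tg m : tight t g m -> tight t f m /\ tight t x m.
    move=> /tightP[mL]; rewrite gt' dotDr !dotZr => E.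
    have := cell_facet Pf mL; have := cell_facet Px mL => A1 A2.
    by split; apply/tightP; split=> //; lra.
  have Fg : F g.
    apply/FP; split.
      apply/(cellE D) => m mL; rewrite gt' dotDr !dotZr.
      have := cell_facet Pf mL; have := cell_facet Px mL; lra.
    move=> y Py; have := fmax _ Py; have := xmax _ Py.
    rewrite /g dotZr dotDr; lra.
  have : (c f <= c g)%N by rewrite ck; apply: kmin; apply/asboolP; exists g.
  rewrite leqNgt => /negP cg; apply: contrapT => nx; apply: cg.
  have lL : l \in L by case/tightP: tl.
  rewrite /c; elim: (L) lL => // m s IH; rewrite inE => /orP[/eqP <-|ls] /=.
    have -> : tight t g l = false by apply/negP => /tg[].
    rewrite tl add0n add1n ltnS; apply: sub_count => q /tg[]//.
  rewrite -addnS leq_add //; last exact: IH.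
  by case E: (tight t g m) => //; have [-> _] := tg _ E.
move=> [Px tx]; apply/FP; split=> // y Py.
have [|e e0 He] := cell_ray (D := D) (v := f - x) Pf.
  by move=> l tl; rewrite (tight_sub tl (tx l tl)).
have := fmax _ (He e (ltW e0) (lexx e)).
rewrite dotDr dotZr gerDl pmulr_rle0 // dotDr dotNr subr_le0.
exact: le_trans (fmax _ Py).
Qed.

(** The sum of the tight normals is maximal exactly where all of them are. *)
Lemma min_face_face t f : P (f - t) -> face (translate P t) (min_face t f).
Proof.
move=> Pf; split; first by exists f.
pose b := \sum_(l <- L | tight t f l) n l.
exists b.
have bE x : dot b x = \sum_(l <- L | tight t f l) dot (n l) x.
  by rewrite dot_suml.
have bf : dot b (f - t) = \sum_(l <- L | tight t f l) hgt D l.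
  by rewrite bE; apply: eq_bigr => l /tightP[].
have bx x : P (x - t) -> dot b (x - t) <= dot b (f - t).
  move=> Px; rewrite bf bE big_seq_cond [leRHS]big_seq_cond.
  by apply: ler_sum => l /andP[lL _]; exact: cell_facet.
apply/seteqP; split => x.
  move=> [Px tx]; split; first exact/translateE.
  move=> y /translateE Py; rewrite -(lerD2r (- dot b t)) -dotNr -!dotDr.
  apply: le_trans (bx _ Py) _; rewrite bf bE le_eqVlt; apply/orP; left.
  by apply/eqP/eq_bigr => l tl; case/tightP: (tx _ tl).
move=> [/translateE Px xm]; split=> // l tl.
have Tf : translate P t f by apply/translateE.
have := xm _ Tf; rewrite -(lerD2r (- dot b t)) -dotNr -!dotDr => fx.
apply/negPn/negP => nt; have lL : l \in L by case/tightP: tl.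
have := bx _ Px; rewrite le_eqVlt ltNge fx orbF eq_sym bf bE -subr_eq0 -sumrB.
rewrite big_seq_cond psumr_eq0.
  move=> /allP /(_ l lL); rewrite lL tl /= subr_eq0 => /eqP E.
  by move/negP: nt; apply; apply/tightP.
by move=> k /andP[kL _]; rewrite subr_ge0 cell_facet.
Qed.

(** From f one can move in every direction that is orthogonal to the tight normals. *)
Lemma min_face_direction t f k (M : 'M[R]_(k, d)) : P (f - t) ->
  (forall v, v \in orth M <-> forall l, tight t f l -> dot (n l) v = 0) ->
  direction (min_face t f) (orth M).
Proof.
move=> Pf ME; split=> [x y [Px tx] [Py ty]|W HW].
  by apply/ME => l tl; apply: tight_sub; [exact: tx | exact: ty].
apply/subvP => v /ME tv.
have [|e e0 He] := cell_ray (D := D) (v := v) Pf; first by move=> l /tv ->.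
have Ff : min_face t f (f + e *: v).
  split; first exact: He (ltW e0) (lexx e).
  move=> l tl; have /tightP[lL E] := tl; apply/tightP; split=> //.
  by rewrite addrAC dotDr dotZr tv // mulr0 addr0.
have := HW _ _ Ff (min_face_id Pf); rewrite addrAC subrr add0r.
by move=> /(memvZ e^-1); rewrite scalerA mulVf ?gt_eqF // scale1r.
Qed.

Lemma min_face_dim t f k k' (M : 'M[R]_(k, d)) : P (f - t) ->
  M *m M^T = 1%:M -> (k' + k = d)%N ->
  (forall v, v \in orth M <-> forall l, tight t f l -> dot (n l) v = 0) ->
  has_dim (min_face t f) k'.
Proof.
move=> Pf MM kd ME; split; first by exists f.
exists (orth M); first exact: min_face_direction.
by apply/eqP; rewrite -(eqn_add2r k) dim_orth // kd.
Qed.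

Lemma min_face_sub_direction t f (U : {vspace 'rV[R]_d}) v : P (f - t) ->
  direction (min_face t f) U ->
  v \in U <-> forall l, tight t f l -> dot (n l) v = 0.
Proof.
move=> Pf [U1 U2]; split=> [vU l tl|tv].
  apply/orth_row; apply: (subvP (U2 _ _)) vU => x y [_ tx] [_ ty].
  by apply/orth_row/tight_sub; [exact: tx | exact: ty].
have [|e e0 He] := cell_ray (D := D) (v := v) Pf; first by move=> l /tv ->.
have Ff : min_face t f (f + e *: v).
  split; first exact: He (ltW e0) (lexx e).
  move=> l tl; have /tightP[lL E] := tl; apply/tightP; split=> //.
  by rewrite addrAC dotDr dotZr tv // mulr0 addr0.
have := U1 _ _ Ff (min_face_id Pf); rewrite addrAC subrr add0r.
by move=> /(memvZ e^-1); rewrite scalerA mulVf ?gt_eqF // scale1r.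
Qed.

Lemma facet_min_face t l : l \in L -> facet t l = min_face t (apt D l + t).
Proof.
move=> lL; apply/seteqP; split => x [Px tx]; split=> //.
  by move=> m /(apt_only lL) ->.
exact/tx/apt_tight.
Qed.

Lemma facet_hyperface t l : T t -> l \in L -> hyperface P T (facet t l).
Proof.
move=> Tt lL; rewrite facet_min_face //; have Pa := apt_cell t lL.
split; first by exists t => //; exact: min_face_face.
have MM := orth1 (nrm1 lL).
exists (\dim (orth (n l : 'M[R]_(1, d)))); last by rewrite -addn1; exact: dim_orth MM.
apply: (min_face_dim Pa MM); first exact: dim_orth.
move=> v; rewrite orth_row; split=> [H m /(apt_only lL) -> //|H].
exact/H/apt_tight.
Qed.

Lemma hyperface_facet G : hyperface P T G ->
  exists t l, [/\ T t, l \in L & G = facet t l].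
Proof.
move=> [[t Tt /face_min_face[f [_ Pf ->]]] [k [_ [U dU dimU]] kd]].
have UE v := min_face_sub_direction v Pf dU.
have [l tl] : exists l, tight t f l.
  apply: contrapT => no.
  have : U = fullv.
    apply/eqP; rewrite eqEsubv subvf; apply/subvP => v _.
    by apply/UE => l tl; case: no; exists l.
  move=> E; move: dimU; rewrite E dimvf /dim /= mul1n => E2.
  lia.
have lL : l \in L by case/tightP: tl.
exists t, l; split=> //.
have Ul : U = orth (n l : 'M[R]_(1, d)).
  apply/eqP; rewrite eqEdim; apply/andP; split.
    by apply/subvP => v /UE H; apply/orth_row; exact: H.
  have := dim_orth (orth1 (nrm1 lL)); rewrite dimU; lia.
have only m : tight t f m -> m = l.
  move=> tm; apply/eqP/negPn/negP => ml.
  have mL : m \in L by case/tightP: tm.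
  pose w := n m - dot (n l) (n m) *: n l.
  have lw : dot (n l) w = 0 by rewrite /w !dotE nrm1 // mulr1 subrr.
  have mw : dot (n m) w = 0 by apply: (UE w).1 tm; rewrite Ul; apply/orth_row.
  have w0 : w = 0.
    have : dot w w = dot (n m) w - dot (n l) (n m) * dot (n l) w.
      by rewrite [in LHS]/w dotDl dotNl dotZl.
    by rewrite mw lw mulr0 subrr => /eqP; rewrite dot_eq0 => /eqP.
  have [] := tight_indep (b := 1) (c := - dot (n l) (n m)) tm tl ml.
    by rewrite scale1r scaleNr.
  by move/eqP; rewrite oner_eq0.
by apply/seteqP; split => x [Px tx]; split=> //; [exact: tx | move=> m /only ->].
Qed.

(** The tight constraints of u at f are constant along the lines of t through f. *)
Lemma min_face_sub t u f x : T t -> T u -> P (f - t) -> P (f - u) ->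
  min_face t f x -> min_face u f x.
Proof.
move=> Tt Tu Pt Pu [Px tx].
have tv l : tight t f l -> dot (n l) (x - f) = 0.
  by move=> tl; exact: (tight_sub (tx l tl) tl).
split.
  have [|e e0 He] := cell_ray (D := D) (v := f - x) Pt.
    by move=> l /tv; rewrite -opprB dotNr => /eqP; rewrite oppr_eq0 => /eqP ->.
  have := @facewise _ _ _ _ D t u f (x - f) e Tt Tu Pt Pu e0.
  rewrite [f + _]addrC subrK; apply=> //.
  by rewrite -scalerN opprB; exact: He (ltW e0) (lexx e).
move=> l tl; have := tight_lines Tt Tu Pt Pu tv tl.
have /tightP[lL E] := tl => H; apply/tightP; split=> //.
by rewrite -[x](subrK f) -addrA dotDr H add0r.
Qed.

Lemma facet_opp t l : T t -> l \in L -> facet (t + l) (- l) = facet t l.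
Proof.
move=> Tt lL; apply/seteqP; split => x [Px tx].
  have tl : tight t x l by rewrite -tight_opp.
  split=> //; have := neighbour_cell Px tx.
  by rewrite addrK.
by split; [exact: neighbour_cell tx | exact: neighbour_tight].
Qed.

(** By [near_facet_cells] the point [apt] of a facet belongs to two cells only. *)
Lemma facet_inj t l u m : T t -> l \in L -> T u -> m \in L ->
  facet t l = facet u m -> (u = t /\ m = l) \/ (u = t + l /\ m = - l).
Proof.
move=> Tt lL Tu mL E.
have [Pu tu] : facet u m (apt D l + t).
  by rewrite -E; split; [exact: apt_cell | exact: apt_tight].
have near := near_facet_apt Tt lL.
have /near_facetP[H1 H2] := near.
have [uE|uE] := near_facet_cells Tt lL near Tu Pu; [left | right]; split=> //;
  apply/eqP/negPn/negP => nE; move: tu; rewrite uE => /gap_tight.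
  by have := H1 m mL nE => /[swap] ->; rewrite ltxx.
by have := H2 m mL nE => /[swap] ->; rewrite ltxx.
Qed.

End Faces.

Section Torsion.
Context {R : realType} {d : nat} {P T : set 'rV[R]_d} (D : facet_system P T).
Implicit Types (t u x y f v l m : 'rV[R]_d) (F G : set 'rV[R]_d).
Local Notation L := (fvec D).
Local Notation n := (nrm D).
Local Notation tight := (tight D).
Local Notation facet := (facet D).
Local Notation min_face := (min_face D).

(** The two independent tight normals of a cell at f span the plane of e1 and e2. *)
Lemma ridge_orth f (e1 e2 : 'rV[R]_d) t v : ridge D f e1 e2 -> T t -> P (f - t) ->
  v \in orth (col_mx e1 e2 : 'M[R]_(1 + 1, d)) <->
  forall l, tight t f l -> dot (n l) v = 0.
Proof.
move=> [ON rf] Tt Pt; have [pl [l [m [tl tm lm]]]] := rf t Tt Pt.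
rewrite orth_pair; split=> [[v1 v2] k /pl pk|H].
  by rewrite (in_plane_dot _ pk) v1 v2 !mulr0 addr0.
have := H l tl; have := H m tm.
rewrite (in_plane_dot _ (pl m tm)) (in_plane_dot _ (pl l tl)).
have C0 : cross e1 e2 (n l) (n m) != 0.
  apply/eqP => C0; have := turn_cr (conj ON rf) Tt Pt tl tm.
  by rewrite eq_sym => /(_ lm); rewrite C0 mulr0 ltxx.
move: C0; rewrite /cross; move: (dot e1 (n l)) (dot e2 (n l)) (dot e1 (n m)) (dot e2 (n m)).
move: (dot e1 v) (dot e2 v) => x y a b c e C0 E1 E2; split; apply: (mulfI C0); rewrite mulr0.
  transitivity (e * (a * x + b * y) - b * (c * x + e * y)); first by ring.
  by rewrite E1 E2 !mulr0 subrr.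
transitivity (a * (c * x + e * y) - c * (a * x + b * y)); first by ring.
by rewrite E1 E2 !mulr0 subrr.
Qed.

Lemma ridge_face f (e1 e2 : 'rV[R]_d) t : ridge D f e1 e2 -> T t -> P (f - t) ->
  codim2_face P T (min_face t f) /\ around (min_face t f) e1 e2.
Proof.
move=> rf Tt Pt; have [[e11 e22 e12] _] := rf; have ON : orthonormal e1 e2 by [].
have ME v := ridge_orth v rf Tt Pt.
split.
  split; first by exists t => //; exact: min_face_face.
  exists (\dim (orth (col_mx e1 e2 : 'M[R]_(1 + 1, d)))).
    exact: (min_face_dim Pt (orth2 ON) (dim_orth (orth2 ON)) ME).
  by have := dim_orth (orth2 ON); lia.
split=> //; rewrite ?/enorm ?e11 ?e22 ?sqrtr1 //.
move=> x y [_ tx] [_ ty]; apply/orth_pair/ME => l tl.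
by apply: tight_sub; [exact: tx | exact: ty].
Qed.

(** If the normals tight at f did not span a plane, the minimal face at f would
    have another dimension. *)
Lemma codim2_ridge F (e1 e2 : 'rV[R]_d) : codim2_face P T F -> around F e1 e2 ->
  exists t f, [/\ T t, P (f - t), F = min_face t f & ridge D f e1 e2].
Proof.
move=> [[t Tt /face_min_face-/(_ _ D)[f [_ Pf ->]]] [k [_ [U dU dimU]] kd]] [e1n e2n e12 aF].
have ON : orthonormal e1 e2 by split; rewrite ?enorm_eq1.
exists t, f; split=> //.
have UE v := min_face_sub_direction v Pf dU.
pose M : 'M[R]_(1 + 1, d) := col_mx e1 e2.
have UM : U = orth M.
  apply/eqP; rewrite eqEdim; apply/andP; split.
    by have [_ ->] := dU => // x y Fx Fy; apply/orth_pair; exact: aF.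
  by have := dim_orth (orth2 ON); rewrite dimU /M; lia.
have [e11 e22 _] := ON; have e21 : dot e2 e1 = 0 by rewrite dotC.
have pl l : tight t f l -> in_plane e1 e2 (n l).
  move=> tl; pose w := n l - (dot e1 (n l) *: e1 + dot e2 (n l) *: e2).
  have w1 : dot e1 w = 0 by rewrite /w !dotE e11 e12 mulr1 mulr0 addr0 subrr.
  have w2 : dot e2 w = 0 by rewrite /w !dotE e22 e21 mulr1 mulr0 add0r subrr.
  have lw : dot (n l) w = 0 by apply: (UE w).1 tl; rewrite UM; exact/orth_pair.
  have : dot w w = dot (n l) w - (dot e1 (n l) * dot e1 w + dot e2 (n l) * dot e2 w).
    by rewrite [in LHS]/w dotDl dotNl dotDl !dotZl.
  rewrite lw w1 w2 !mulr0 addr0 subrr => /eqP.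
  by rewrite dot_eq0 subr_eq0 => /eqP.
have no v : (forall l, tight t f l -> dot (n l) v = 0) -> dot e1 v = 0 /\ dot e2 v = 0.
  by move=> H; apply/orth_pair; rewrite -/M -UM; exact/UE.
have [[l [m [tl tm lm]]]|one] := pselect (exists l m, [/\ tight t f l, tight t f m & l != m]).
  exact: (ridge_of_cell ON Tt Pf pl tl tm lm).
exfalso; have [[l tl]|none] := pselect (exists l, tight t f l); last first.
  by have [] := no e1 (fun l tl => False_ind _ (none (ex_intro _ l tl)));
    rewrite e11 => /eqP; rewrite oner_eq0.
pose v := - dot e2 (n l) *: e1 + dot e1 (n l) *: e2.
have v1 : dot e1 v = - dot e2 (n l) by rewrite /v !dotE e11 e12; ring.
have v2 : dot e2 v = dot e1 (n l) by rewrite /v !dotE e22 e21; ring.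
have [|] := no v.
  move=> m tm; have -> : m = l.
    by apply/eqP/negPn/negP => ml; apply: one; exists m, l.
  by rewrite (in_plane_dot _ (pl l tl)) v1 v2; ring.
rewrite v1 v2 => /eqP; rewrite oppr_eq0 => /eqP A B.
have := pl l tl; rewrite /in_plane A B !scale0r addr0 => nl0.
by case/tightP: tl => /nrm1; rewrite nl0 dot0l => /eqP; rewrite eq_sym oner_eq0.
Qed.

(** The outer normal of the cell from which the facet is crossed points against
    the chosen direction of turning. *)
Lemma unit_normal_facet f (e1 e2 : 'rV[R]_d) t u l : ridge D f e1 e2 -> T t -> P (f - t) ->
  rot D f e1 e2 (u, l) -> unit_normal e1 e2 (min_face t f) (facet u l) = - n l.
Proof.
move=> rf Tt Pt [/= Tu Pu tl turn0].
have lL : l \in L by case/tightP: tl.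
have [m tm ml] := ridge_other rf l Tu Pu.
have [_ /(_ u Tu Pu)[pl _]] := rf.
have cneg : cross e1 e2 (n l) (n m) < 0.
  by have := turn_cr rf Tu Pu tl tm ml; rewrite pmulr_rlt0.
have crossNr v w : cross e1 e2 v (- w) = cross e1 e2 w v.
  by rewrite /cross !dotNr; ring.
have only k : tight u f k -> k = l \/ k = m.
  have [l' [m' [tl' tm' _ _ H]]] := diamond rf Tu Pu.
  move=> /H Hk; move: (H _ tl) (H _ tm) Hk ml.
  by move=> [->|->] [->|->] [->|->]; rewrite ?eqxx //; tauto.
have HU : unit_normal_along e1 e2 (min_face t f) (facet u l) (- n l).
  split.
  - by rewrite /enorm dotNl dotNr opprK nrm1 // sqrtr1.
  - by move=> x y [_ tx] [_ ty]; rewrite dotNl (tight_sub tx ty) oppr0.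
  move=> x y Fx [Py ty] nFy.
  have [_ tx] : min_face u f x by exact: min_face_sub Fx.
  rewrite -/(cross e1 e2 (y - x) (- n l)) crossNr.
  have E : dot (n m) (y - x) = cross e1 e2 (n l) (y - x) * cross e1 e2 (n l) (n m).
    by rewrite -cr_dot ?nrm1 ?(tight_sub ty (tx l tl)) //; exact: pl.
  rewrite -(nmulr_llt0 _ cneg) -E lt_neqAle; apply/andP; split.
    apply/eqP => E0; apply: nFy; apply: (min_face_sub Tu Tt Pu Pt).
    split=> // k /only[->|->] //.
    have /tightP[mL xm] := tx m tm; apply/tightP; split=> //.
    have : dot (n m) (y - u) = dot (n m) (y - x) + dot (n m) (x - u).
      by rewrite -dotDr addrA subrK.
    by rewrite E0 xm add0r.
  have /tightP[mL xm] := tx m tm.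
  have -> : y - x = (y - u) - (x - u) by rewrite opprB addrA subrK.
  by rewrite dotDr dotNr xm subr_le0 cell_facet.
have Pa : facet u l (apt D l + u) by split; [exact: apt_cell | exact: apt_tight].
have nFa : ~ min_face t f (apt D l + u).
  move=> /(min_face_sub Tt Tu Pt Pu)[_ /(_ m tm) /(apt_only lL) mE].
  by rewrite mE eqxx in ml.
rewrite /unit_normal; case: xgetP => [n' _ [n1 nG nF]|/(_ _ HU)//].
have n'E : n' = dot (n l) n' *: n l.
  pose w := n' - dot (n l) n' *: n l.
  have lw : dot (n l) w = 0 by rewrite /w !dotE nrm1 // mulr1 subrr.
  have n'w : dot n' w = 0.
    have [|e e0 He] := cell_ray (D := D) (v := w) (apt_cell u lL).
      by move=> k /(apt_only lL) ->; rewrite lw.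
    have Fa : facet u l (apt D l + u + e *: w).
      split; first exact: He (ltW e0) (lexx e).
      apply/tightP; split=> //.
      by rewrite addrAC addrK dotDr dotZr lw mulr0 addr0 apt_eq.
    have := nG _ _ Fa Pa; rewrite addrAC subrr add0r dotZr => /eqP.
    by rewrite mulf_eq0 (gt_eqF e0) => /eqP.
  have : dot w w = dot n' w - dot (n l) n' * dot (n l) w.
    by rewrite [in LHS]/w dotDl dotNl dotZl.
  by rewrite n'w lw mulr0 subrr => /eqP; rewrite dot_eq0 subr_eq0 => /eqP.
have := enorm_eq1 n1; rewrite n'E dotZl dotZr nrm1 // mulr1 => /eqP.
rewrite -expr2 sqrf_eq1 => /orP[/eqP k1|/eqP ->]; last by rewrite scaleN1r.
have := nF f (apt D l + u) (min_face_id D Pt) Pa nFa.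
rewrite -/(cross e1 e2 (apt D l + u - f) n') n'E k1 scale1r.
rewrite -[n l]opprK crossNr crossNl oppr_gt0 => C.
by have := lt_trans turn0 C; rewrite ltxx.
Qed.

Lemma facet_sup f t u l : T t -> T u -> l \in L -> P (f - t) ->
  min_face t f `<=` facet u l <-> P (f - u) /\ tight u f l.
Proof.
move=> Tt Tu lL Pt; split=> [H|[Pu tl] x Fx].
  exact: (H f (min_face_id D Pt)).
have [Px tx] := min_face_sub Tt Tu Pt Pu Fx.
by split=> //; exact: tx.
Qed.

Lemma torsion_rot (s : set 'rV[R]_d -> R) f (e1 e2 : 'rV[R]_d) t : ridge D f e1 e2 -> T t ->
  P (f - t) -> torsion P T s e1 e2 (min_face t f) =
  - \sum_(tl \in rot D f e1 e2) s (facet tl.1 tl.2) *: n tl.2.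
Proof.
move=> rf Tt Pt; have finr : finite_set (rot D f e1 e2).
  apply: sub_finite_set (finite_facets_at D f) => -[u l] [/= Tu Pu tl _].
  by split.
rewrite /torsion (reindex_fsbig (fun tl => facet tl.1 tl.2) (rot D f e1 e2)).
  rewrite (eq_fsbigr (fun tl => - (s (facet tl.1 tl.2) *: n tl.2))).
    by rewrite !fsbig_finite //= sumrN.
  by move=> [u l]; rewrite inE => ul /=; rewrite (unit_normal_facet rf Tt Pt ul) scalerN.
split.
- move=> [u l] [/= Tu Pu tl _]; have lL : l \in L by case/tightP: tl.
  by split; [exact: facet_hyperface | apply/facet_sup].
- move=> [u l] [u' l']; rewrite !inE => -[/= Tu Pu tl tu0] [/= Tu' Pu' tl' tu0'].
  have lL : l \in L by case/tightP: tl.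
  have lL' : l' \in L by case/tightP: tl'.
  move=> /(facet_inj Tu lL Tu' lL')[[-> ->] //|[uE lE]].
  by move: tu0; rewrite -(turn_neighbour rf Tu Pu tl) -uE -lE ltNge ltW.
move=> G [/= /hyperface_facet-/(_ D)[u [l [Tu lL ->]]] /(facet_sup Tt Tu lL Pt)[Pu tl]].
have := turn_neq0 rf Tu Pu tl; rewrite neq_lt => /orP[tu|tu]; last by exists (u, l).
exists (u + l, - l) => /=; last exact: facet_opp.
have tl' := neighbour_tight tl; have Pu' := neighbour_cell Pu tl.
have Tu' := step Tu lL.
by split=> //=; rewrite -(turn_neighbour rf Tu' Pu' tl') addrK opprK.
Qed.

(** The dictionary between scalings of hyperfaces and functions of pairs (t, l).
    The hyperfaces containing a codimension two face are the facets at any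
    point f of its relative interior. *)
Lemma canonical_star (s : set 'rV[R]_d -> R) : canonical_scaling P T s <->
  (forall t l, T t -> l \in L -> 0 < s (facet t l)) /\
  star D (fun t l => s (facet t l) *: n l).
Proof.
split=> [[s0 sT]|[s0 sD]]; split.
- by move=> t l Tt lL; apply/s0/facet_hyperface.
- move=> f e1 e2 rf; have [t Tt Pt] := covered D f.
  have [cF aF] := ridge_face rf Tt Pt.
  by have := sT _ _ _ cF aF; rewrite (torsion_rot _ rf Tt Pt) => /eqP; rewrite oppr_eq0 => /eqP.
- by move=> G /hyperface_facet-/(_ D)[t [l [Tt lL ->]]]; exact: s0.
move=> F e1 e2 cF aF; have [t [f [Tt Pf -> rf]]] := codim2_ridge cF aF.
by rewrite (torsion_rot _ rf Tt Pf) (sD _ _ _ rf) oppr0.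
Qed.

End Torsion.

(** * Facets at a codimension two face: at most three, or opposite pairs *)

Section Classification.
Context {R : realType} {d : nat} {P T : set 'rV[R]_d} (D : facet_system P T).
Implicit Types (t u x y f v l m : 'rV[R]_d) (p q : 'rV[R]_d * 'rV[R]_d).
Local Notation L := (fvec D).
Local Notation n := (nrm D).
Local Notation tight := (tight D).

(** A canonical scaling, as a function of a cell and of a facet vector. *)
Definition solution (S : 'rV[R]_d -> 'rV[R]_d -> R) :=
  [/\ forall t l, T t -> l \in L -> 0 < S t l,
      forall t l, T t -> l \in L -> S (t + l) (- l) = S t l &
      star D (fun t l => S t l *: n l)].

(** The values of a canonical scaling at p and q have a ratio c that is forced by
    the tiling, so it is the same at all translates of p and q. *)
Definition rigid p q (c : R) := forall S, solution S -> S q.1 q.2 = c * S p.1 p.2.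

Section AtRidge.
Variables (f e1 e2 : 'rV[R]_d).
Hypothesis rf : ridge D f e1 e2.
Local Notation cr := (cross e1 e2).
Local Notation rot := (rot D f e1 e2).

(** The second facet m of the cell at f, which is crossed from the cell t + m. *)
Lemma rot_other t l : rot (t, l) -> exists m, [/\ tight t f m, rot (t + m, - m),
  cr (n l) (n m) < 0 & forall k, tight t f k -> k = l \/ k = m].
Proof.
move=> [/= Tt Pt tl turnl]; have [m tm ml] := ridge_other rf l Tt Pt.
have cneg : cr (n l) (n m) < 0.
  by have := turn_cr rf Tt Pt tl tm ml; rewrite pmulr_rlt0.
have only k : tight t f k -> k = l \/ k = m.
  have [l' [m' [tl' tm' _ _ H]]] := diamond rf Tt Pt.
  move=> /H Hk; move: (H _ tl) (H _ tm) Hk ml.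
  by move=> [->|->] [->|->] [->|->]; rewrite ?eqxx //; tauto.
have mneg : turn D f e1 e2 t m < 0.
  have := turn_cr rf Tt Pt tm tl; rewrite eq_sym ml => /(_ isT).
  by rewrite cr_anti mulrN oppr_lt0 nmulr_lgt0.
exists m; split=> //; have mL : m \in L by case/tightP: tm.
have Tm := step Tt mL; have Pm := neighbour_cell Pt tm.
have tm' := neighbour_tight tm; split=> //=.
have := turn_neq0 rf Tm Pm tm'; rewrite neq_lt (turn_neighbour rf Tt Pt tm).
by rewrite [0 < turn _ _ _ _ t m]lt_gtF.
Qed.

Lemma same_inside t u v : T t -> T u -> P (f - t) -> P (f - u) ->
  (forall l, tight t f l -> dot (n l) v < 0) ->
  (forall l, tight u f l -> dot (n l) v < 0) -> t = u.
Proof.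
move=> Tt Tu Pt Pu tv uv.
have [a a0 Ha] := cell_ray_int Pt tv; have [b b0 Hb] := cell_ray_int Pu uv.
have k0 : 0 < Num.min a b by rewrite lt_min a0.
apply: (interior_disjoint (f := D) Tt Tu (x := f + Num.min a b *: v)).
  by apply: Ha => //; rewrite ge_min lexx.
by apply/(cellE D) => l lL; apply/ltW/Hb => //; rewrite ge_min lexx orbT.
Qed.

Lemma rot_plane p : rot p -> in_plane e1 e2 (n p.2).
Proof.
by move=> [Tt Pt tl _]; have [_ /(_ p.1 Tt Pt)[pl _]] := rf; exact: pl.
Qed.

Lemma rot_fvec p : rot p -> p.2 \in L.
Proof. by move=> [_ _ /tightP[]]. Qed.

(** Two cells that lie on the same side of the same half-hyperplane at f have
    common inner points, so each direction occurs for one cell only. *)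
Lemma rot_inj p q : rot p -> rot q -> p.2 = q.2 -> p = q.
Proof.
case: p q => t l [u k] rp rq /= lk; subst k; congr (_, _).
have [Tt Pt tl turnl] := rp; have [Tu Pu ul _] := rq; rewrite /= in Tt Pt tl turnl Tu Pu ul.
have [m [tm _ cm tonly]] := rot_other rp; have [k [uk _ ck uonly]] := rot_other rq.
have lL := rot_fvec rp; have ll : dot (n l) (n l) = 1 := nrm1 lL.
pose g := apt D l + t - f.
have lg : dot (n l) g = 0 by exact: tight_facet_dir.
have pl := rot_plane rp.
have pm : in_plane e1 e2 (n m) by have [_ /(_ t Tt Pt)[H _]] := rf; exact: H.
have pk : in_plane e1 e2 (n k) by have [_ /(_ u Tu Pu)[H _]] := rf; exact: H.
have neg j : in_plane e1 e2 (n j) -> cr (n l) (n j) < 0 -> dot (n j) g < 0.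
  by move=> pj cj; rewrite (cr_dot pl pj ll lg) nmulr_llt0.
have gm := neg m pm cm; have gk := neg k pk ck.
(* g points along the facet l and inside the second facets, whose normals have
   scalar products at most 1 with n l: the factor K compensates for them *)
pose K := - (dot (n m) g)^-1 - (dot (n k) g)^-1.
have km : 0 < - (dot (n m) g)^-1 by rewrite oppr_gt0 invr_lt0.
have kk : 0 < - (dot (n k) g)^-1 by rewrite oppr_gt0 invr_lt0.
have mm : dot (n m) (n m) = 1 by apply: nrm1; case/tightP: tm.
have kk1 : dot (n k) (n k) = 1 by apply: nrm1; case/tightP: uk.
have Km : K * dot (n m) g < -1.
  rewrite /K mulrBl mulNr mulVf ?lt_eqF // ltrBlDr ltrDl.
  by rewrite nmulr_rgt0 ?invr_lt0.
have Kk : K * dot (n k) g < -1.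
  rewrite /K mulrBl mulVf ?lt_eqF // ltrBlDr addNr.
  by rewrite pmulr_rlt0.
apply: (same_inside (v := - n l + K *: g)) => // j.
  move=> /tonly[->|->]; rewrite dotDr dotNr dotZr ?ll ?lg ?mulr0 ?addr0 ?ltrN10 //.
  by have := dot_unit_le1 mm ll; rewrite ler_norml => /andP[]; lra.
move=> /uonly[->|->]; rewrite dotDr dotNr dotZr ?ll ?lg ?mulr0 ?addr0 ?ltrN10 //.
by have := dot_unit_le1 kk1 ll; rewrite ler_norml => /andP[]; lra.
Qed.

(** The functional [cross e1 e2 v] is a negative combination of the normals n l
    and n m, hence its minimum over the cell is attained on the minimal face. *)
Lemma mixed_max t l m v y : T t -> P (f - t) -> tight t f l -> tight t f m ->
  (forall k, tight t f k -> k = l \/ k = m) -> cr (n l) (n m) < 0 ->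
  0 < dot (n l) v -> dot (n m) v < 0 -> P (y - t) ->
  cr v f <= cr v y /\ (cr v y = cr v f -> min_face D t f y).
Proof.
move=> Tt Pt tl tm tonly c0 lv mv Py.
have [_ /(_ t Tt Pt)[pl _]] := rf.
have E : cr (n l) (n m) * (cr v y - cr v f) =
    - dot (n m) v * dot (n l) (y - f) + dot (n l) v * dot (n m) (y - f).
  rewrite !(in_plane_dot _ (pl l tl)) !(in_plane_dot _ (pl m tm)) /cross !dotE.
  by ring.
have yf k : tight t f k -> dot (n k) (y - f) <= 0.
  move=> /tightP[kL tk]; have -> : y - f = (y - t) - (f - t) by rewrite opprB addrA subrK.
  by rewrite dotDr dotNr tk subr_le0 (cell_facet Py kL).
have A : - dot (n m) v * dot (n l) (y - f) <= 0 by rewrite pmulr_rle0 ?oppr_gt0 // yf.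
have B : dot (n l) v * dot (n m) (y - f) <= 0 by rewrite pmulr_rle0 // yf.
split.
  by rewrite -subr_ge0 -(nmulr_rle0 _ c0) E; lra.
move=> H; move: E; rewrite H subrr mulr0 => E.
have A0 : - dot (n m) v * dot (n l) (y - f) = 0 by lra.
have B0 : dot (n l) v * dot (n m) (y - f) = 0 by lra.
have tk k : tight t f k -> dot (n k) (y - f) = 0.
  move=> /tonly[->|->].
    by move/eqP: A0; rewrite mulf_eq0 oppr_eq0 (lt_eqF mv) => /eqP.
  by move/eqP: B0; rewrite mulf_eq0 (gt_eqF lv) => /eqP.
split=> // k tk0; have /tightP[kL fk] := tk0; apply/tightP; split=> //.
have -> : y - t = (y - f) + (f - t) by rewrite addrA subrK.
by rewrite dotDr fk tk // add0r.
Qed.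

(** On both cells the functional [cross e1 e2 v] is minimal exactly on the same
    codimension two face. So the translation by u - t maps this face to itself. *)
Lemma mixed_unique t l m u k j v : T t -> P (f - t) -> tight t f l -> tight t f m ->
  (forall k, tight t f k -> k = l \/ k = m) -> cr (n l) (n m) < 0 ->
  0 < dot (n l) v -> dot (n m) v < 0 ->
  T u -> P (f - u) -> tight u f k -> tight u f j ->
  (forall i, tight u f i -> i = k \/ i = j) -> cr (n k) (n j) < 0 ->
  0 < dot (n k) v -> dot (n j) v < 0 -> t = u.
Proof.
move=> Tt Pt tl tm tonly ct lv mv Tu Pu uk uj uonly cu kv jv.
have Mt y Py := @mixed_max t l m v y Tt Pt tl tm tonly ct lv mv Py.
have Mu y Py := @mixed_max u k j v y Tu Pu uk uj uonly cu kv jv Py.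
have crD x y : cr v (x + y) = cr v x + cr v y by rewrite /cross !dotDr; ring.
have fut : f + (u - t) - u = f - t by rewrite addrA addrAC addrK.
have ftu : f + (t - u) - t = f - u by rewrite addrA addrAC addrK.
have c0 : cr v (u - t) = 0.
  have := (Mu (f + (u - t))); rewrite fut => /(_ Pt)[+ _].
  have := (Mt (f + (t - u))); rewrite ftu => /(_ Pu)[+ _].
  rewrite -(opprB u t) (crD f (u - t)) (crD f (- (u - t))); have -> : cr v (- (u - t)) = - cr v (u - t).
    by rewrite /cross !dotNr; ring.
  lra.
have [M HM] := bounded D.
apply/esym/eqP; rewrite -subr_eq0; apply/eqP.
apply: (@bounded_periodic _ _ [set x | min_face D t f (x + t)] M (f - t)).
- by move=> x [Px _]; apply: HM; rewrite addrK in Px.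
- by rewrite /= subrK; exact: min_face_id.
move=> x Fx /=; apply: (min_face_sub Tu Tt Pu Pt).
have Px : P (x + (u - t) + t - u) by case: Fx; rewrite addrK addrA subrK addrK.
apply: (Mu _ Px).2; have -> : x + (u - t) + t = (x + t) + (u - t) by rewrite addrAC.
rewrite crD c0 addr0.
have e1f : cr v f <= cr v (x + t) by apply: (Mt _ _).1; case: Fx.
have [Px' tx] := Fx.
have tk i : tight t f i -> dot (n i) (x + t - f) = 0.
  by move=> ti; apply: (tight_sub (tx i ti) ti).
have [_ /(_ t Tt Pt)[pl _]] := rf.
have := tk l tl; have := tk m tm.
rewrite !(in_plane_dot _ (pl l tl)) !(in_plane_dot _ (pl m tm)) => E1 E2.
have cx : cr (n l) (n m) * (cr v (x + t) - cr v f) =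
   dot (n l) v * 0 - dot (n m) v * 0.
  rewrite -{1}E1 -E2 !(in_plane_dot _ (pl l tl)) !(in_plane_dot _ (pl m tm)).
  by rewrite /cross !dotDr !dotNr; ring.
move/eqP: cx; rewrite !mulr0 subr0 mulf_eq0 (lt_eqF ct) subr_eq0 => /eqP //.
Qed.

(** The half-plane argument. A facet p of its cell with a positive value on v
    leaves two cases for the second facet of this cell. If its value is
    positive too, then - v points inside the cell, and there is only one such
    cell. If it is negative, then [mixed_unique] applies. *)
Lemma rot_three v p q k : (forall i, rot i -> dot (n i.2) v != 0) ->
  rot p -> rot q -> rot k ->
  0 < dot (n p.2) v -> 0 < dot (n q.2) v -> 0 < dot (n k.2) v ->
  [\/ p = q, p = k | q = k].
Proof.
move=> v0.
have other i : rot i -> exists m, [/\ tight i.1 f m, cr (n i.2) (n m) < 0,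
    dot (n m) v != 0 & forall j, tight i.1 f j -> j = i.2 \/ j = m].
  case: i => t l ri; have [m [tm rm cm mo]] := rot_other ri.
  exists m; split=> //; have := v0 _ rm; rewrite /= nrmN ?dotNl ?oppr_eq0 //.
  by case/tightP: tm.
have same i j m m' : rot i -> rot j -> 0 < dot (n i.2) v -> 0 < dot (n j.2) v ->
    tight i.1 f m -> cr (n i.2) (n m) < 0 -> dot (n m) v != 0 ->
    (forall j', tight i.1 f j' -> j' = i.2 \/ j' = m) ->
    tight j.1 f m' -> cr (n j.2) (n m') < 0 -> dot (n m') v != 0 ->
    (forall j', tight j.1 f j' -> j' = j.2 \/ j' = m') ->
    (0 < dot (n m) v) = (0 < dot (n m') v) -> i = j.
  move=> ri rj iv jv im cm mv io jm cm' mv' jo E.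
  have [Ti Pi ii _] := ri; have [Tj Pj jj _] := rj.
  suff tE : i.1 = j.1.
    apply: rot_inj => //; have := jo i.2; rewrite -tE => /(_ ii)[//|E2].
    have := io j.2; rewrite tE => /(_ jj)[//|E3].
    move: cm' cm; rewrite -E2 -E3 => A B; move: A; rewrite cr_anti oppr_lt0.
    by rewrite ltNge (ltW B).
  case: (ltrgtP 0 (dot (n m) v)) mv E => // mv _ E.
    apply: (same_inside (v := - v)) => // a.
      by move=> /io[->|->]; rewrite dotNr oppr_lt0.
    by move=> /jo[->|->]; rewrite dotNr oppr_lt0 // -E.
  have mv'0 : dot (n m') v < 0 by rewrite lt_neqAle mv' leNgt -E.
  exact: (mixed_unique Ti Pi ii im io cm iv mv Tj Pj jj jm jo cm' jv mv'0).
move=> rp rq rk pv qv kv.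
have [a [pa ca av ao]] := other p rp; have [b [qb cb bv bo]] := other q rq.
have [c [kc cc cv co]] := other k rk.
have := same p q a b rp rq pv qv pa ca av ao qb cb bv bo.
have := same p k a c rp rk pv kv pa ca av ao kc cc cv co.
have := same q k b c rq rk qv kv qb cb bv bo kc cc cv co.
case: (0 < dot (n a) v); case: (0 < dot (n b) v); case: (0 < dot (n c) v).
all: try by move=> A _ _; constructor 3; exact: A.
all: try by move=> _ A _; constructor 2; exact: A.
all: by move=> _ _ A; constructor 1; exact: A.
Qed.

Lemma finite_rot : exists2 r : seq ('rV[R]_d * 'rV[R]_d),
  uniq r & forall p, p \in r <-> rot p.
Proof.
have : finite_set rot.
  apply: sub_finite_set (finite_facets_at D f) => -[u l] [/= Tu Pu tl _].
  by split.
move=> /finite_seqP[r Hr]; exists (undup r); rewrite ?undup_uniq // => p.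
by rewrite mem_undup; have := congr1 (fun Z => Z p) Hr; rewrite /= => ->.
Qed.

Lemma rot_sum S r x : solution S -> uniq r -> (forall p, p \in r <-> rot p) ->
  \sum_(i <- r) S i.1 i.2 * dot (n i.2) x = 0.
Proof.
move=> [_ _ /(_ _ _ _ rf) sS] ur Hr.
have E : rot = [set` r] by apply/seteqP; split => p /Hr.
move: sS; rewrite E -fsbig_seq // => /(congr1 (fun y => dot y x)).
rewrite dot0l dot_suml => H; etransitivity; last exact: H.
by apply: eq_bigr => i _; rewrite dotZl.
Qed.

Lemma cr_zero p q : rot p -> rot q -> cr (n p.2) (n q.2) = 0 ->
  q.2 = p.2 \/ q.2 = - p.2.
Proof.
move=> rp rq c0; have pL := rot_fvec rp; have qL := rot_fvec rq.
have pp := nrm1 pL; have pp2 := rot_plane rp; have pq2 := rot_plane rq.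
apply: (nrm_parallel (b := dot (n p.2) (n q.2)) (c := -1) pL qL).
  apply/eqP => d0; have := nrm1 qL.
  rewrite (in_plane_dot _ pp2) in d0; rewrite (in_plane_dot _ pq2).
  rewrite (in_plane_dot _ pp2) in pp; move: c0; rewrite /cross.
  move: d0 pp; set a := dot e1 (n p.2); set b := dot e2 (n p.2).
  set a' := dot e1 (n q.2); set b' := dot e2 (n q.2) => d0 pp c0.
  have A0 : a' = 0.
    transitivity (a * (a * a' + b * b') - b * (a * b' - b * a') + a' * (1 - (a * a + b * b))).
      by ring.
    by rewrite d0 c0 pp; ring.
  have B0 : b' = 0.
    transitivity (b * (a * a' + b * b') + a * (a * b' - b * a') + b' * (1 - (a * a + b * b))).
      by ring.
    by rewrite d0 c0 pp; ring.
  by rewrite A0 B0 !mul0r addr0 => /eqP; rewrite eq_sym oner_eq0.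
pose w := n q.2 - dot (n p.2) (n q.2) *: n p.2.
have pw : dot (n p.2) w = 0 by rewrite /w !dotE pp mulr1 subrr.
have qw : dot (n q.2) w = 0.
  rewrite (cr_dot pp2 pq2 pp pw) c0 mulr0 //.
have : dot w w = dot (n q.2) w - dot (n p.2) (n q.2) * dot (n p.2) w.
  by rewrite [in LHS]/w dotDl dotNl dotZl.
rewrite pw qw mulr0 subrr => /eqP; rewrite dot_eq0 subr_eq0 => /eqP <-.
by rewrite scaleN1r subrr.
Qed.

(** A vector orthogonal to n p, oriented by k, moved slightly towards n p: it is
    positive at p and at all facets that are on the side k of p. *)
Lemma perturb p (k : R) : rot p -> `|k| = 1 -> exists v,
  [/\ forall i, rot i -> dot (n i.2) v != 0, 0 < dot (n p.2) v &
      forall i, rot i -> 0 < k * cr (n p.2) (n i.2) -> 0 < dot (n i.2) v].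
Proof.
move=> rp k1; have [r _ Hr] := finite_rot.
have [e e0 He] : exists2 e : R, 0 < e & forall i, i \in r ->
    cr (n p.2) (n i.2) != 0 -> e < `|cr (n p.2) (n i.2)|.
  elim: (r) => [|i s [e e0 He]]; first by exists 1.
  have [c0|c0] := eqVneq (cr (n p.2) (n i.2)) 0.
    by exists e => // j; rewrite inE => /orP[/eqP ->|/He //]; rewrite c0 eqxx.
  exists (Num.min e (`|cr (n p.2) (n i.2)| / 2)).
    by rewrite lt_min e0 divr_gt0 ?normr_gt0.
  move=> j; rewrite inE => /orP[/eqP -> _|/He H /H]; rewrite gt_min.
    by rewrite [X in _ || X]gtr_pMr ?normr_gt0 // invf_lt1 // ltr1n orbT.
  by move=> ->.
pose w := - dot e2 (n p.2) *: e1 + dot e1 (n p.2) *: e2.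
have Ew x : dot x w = cr (n p.2) x.
  by rewrite /w !dotE /cross (dotC x e1) (dotC x e2); ring.
have E x : dot x (k *: w + e *: n p.2) = k * cr (n p.2) x + e * dot x (n p.2).
  by rewrite dotDr !dotZr Ew.
have pL := rot_fvec rp; have pp := nrm1 pL.
have small i : rot i -> `|e * dot (n i.2) (n p.2)| <= e.
  move=> ri; rewrite normrM gtr0_norm // ger_pMr //.
  by apply: dot_unit_le1 => //; exact: nrm1 (rot_fvec ri).
exists (k *: w + e *: n p.2); split.
- move=> i ri; rewrite E; have [c0|c0] := eqVneq (cr (n p.2) (n i.2)) 0.
    rewrite c0 mulr0 add0r mulf_neq0 //; first by rewrite gt_eqF.
    by case: (cr_zero rp ri c0) => ->; rewrite ?(nrmN pL) ?dotNl pp ?oppr_eq0 oner_eq0.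
  apply/eqP => H; have := He i ((Hr i).2 ri) c0.
  have -> : `|cr (n p.2) (n i.2)| = `|k * cr (n p.2) (n i.2)| by rewrite normrM k1 mul1r.
  move/eqP: H; rewrite addr_eq0 => /eqP ->; rewrite normrN.
  by rewrite ltNge small.
- by rewrite E pp mulr1 /cross [X in k * X](_ : _ = 0) ?mulr0 ?add0r //; ring.
move=> i ri ci; rewrite E; have c0 : cr (n p.2) (n i.2) != 0.
  by apply/eqP => c0; rewrite c0 mulr0 ltxx in ci.
have := He i ((Hr i).2 ri) c0.
have -> : `|cr (n p.2) (n i.2)| = k * cr (n p.2) (n i.2).
  by rewrite -[RHS]gtr0_norm // normrM k1 mul1r.
by have := small i ri; rewrite ler_norml => /andP[]; lra.
Qed.

(** Together with p they would give three facets in an open half-plane. *)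
Lemma same_side p q k (c : R) : `|c| = 1 -> rot p -> rot q -> rot k ->
  0 < c * cr (n p.2) (n q.2) -> 0 < c * cr (n p.2) (n k.2) -> q = k.
Proof.
move=> c1 rp rq rk cq ck; have [v [v0 pv H]] := perturb rp c1.
have nz j : 0 < c * cr (n p.2) (n j.2) -> p <> j.
  by move=> + E; rewrite -E /cross [X in c * X](_ : _ = 0) ?mulr0 ?ltxx //; ring.
by case: (rot_three v0 rp rq rk pv (H q rq cq) (H k rk ck)) => // /nz; case.
Qed.

(** Each side of the line of n p contains at most one other facet. *)
Lemma three_others p : rot p -> (forall q, rot q -> q.2 != - p.2) ->
  forall q1 q2 q3, rot q1 -> rot q2 -> rot q3 -> q1 != p -> q2 != p -> q3 != p ->
  [\/ q1 = q2, q1 = q3 | q2 = q3].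
Proof.
move=> rp nop q1 q2 q3 r1 r2 r3 n1 n2 n3.
have side q : rot q -> q != p -> (0 < cr (n p.2) (n q.2)) || (cr (n p.2) (n q.2) < 0).
  move=> rq /eqP qp; rewrite orbC -neq_lt; apply/eqP => /(cr_zero rp rq)[/(rot_inj rq rp)//|].
  by apply/eqP; exact: nop.
have pos a b : rot a -> rot b -> 0 < cr (n p.2) (n a.2) -> 0 < cr (n p.2) (n b.2) -> a = b.
  by move=> ra rb ca cb; apply: (@same_side p a b 1); rewrite ?normr1 ?mul1r.
have neg a b : rot a -> rot b -> cr (n p.2) (n a.2) < 0 -> cr (n p.2) (n b.2) < 0 -> a = b.
  by move=> ra rb ca cb; apply: (@same_side p a b (-1)); rewrite ?normrN ?normr1 ?mulN1r ?oppr_gt0.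
have := side q1 r1 n1; have := side q2 r2 n2; have := side q3 r3 n3.
move=> /orP[c3|c3] /orP[c2|c2] /orP[c1|c1].
- by constructor 1; apply: pos.
- by constructor 3; apply: pos.
- by constructor 2; apply: pos.
- by constructor 1; apply: neg.
- by constructor 1; apply: pos.
- by constructor 2; apply: neg.
- by constructor 3; apply: neg.
- by constructor 1; apply: neg.
Qed.

Lemma rot_small p (r : seq ('rV[R]_d * 'rV[R]_d)) : uniq r -> (forall i, i \in r <-> rot i) ->
  rot p -> (forall q, rot q -> q.2 != - p.2) -> (size r <= 3)%N.
Proof.
move=> ur Hr rp nop; have := three_others rp nop.
have pr : p \in r by apply/Hr.
have := size_rem pr; have := rem_uniq p ur.
have Hm i : i \in rem p r -> rot i /\ i != p.
  by rewrite mem_rem_uniq // inE => /andP[-> /Hr].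
case: (rem p r) Hm => [|a [|b [|c s]]] Hm us sz H; try by move: sz => /=; lia.
exfalso; have [ra na] : rot a /\ a != p by apply: Hm; rewrite !inE eqxx.
have [rb nb] : rot b /\ b != p by apply: Hm; rewrite !inE eqxx orbT.
have [rc nc] : rot c /\ c != p by apply: Hm; rewrite !inE eqxx !orbT.
move: us => /= /andP[]; rewrite !inE !negb_or => /and3P[ab ac _] /andP[/andP[bc _] _].
case: (H a b c ra rb rc na nb nc) => E.
- by rewrite E eqxx in ab.
- by rewrite E eqxx in ac.
- by rewrite E eqxx in bc.
Qed.

(** At most two lines of opposite facets exist by [same_side]. The component of
    the relation transversal to the other line gives the equality. *)
Lemma opposite_equal p p' S : solution S -> (forall q, rot q -> exists2 q', rot q' & q'.2 = - q.2) ->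
  rot p -> rot p' -> p'.2 = - p.2 -> S p'.1 p'.2 = S p.1 p.2.
Proof.
move=> sS opp rp rp' pp'; have [r ur Hr] := finite_rot.
have pL := rot_fvec rp; have np' : n p'.2 = - n p.2 by rewrite pp' nrmN.
have pnp : p != p' by apply/eqP => E; have := fvec_neqN pL; rewrite -pp' -E eqxx.
have key x : dot (n p.2) x != 0 -> (forall k, rot k -> k != p -> k != p' -> dot (n k.2) x = 0) ->
    S p'.1 p'.2 = S p.1 p.2.
  move=> px kx; have := rot_sum x sS ur Hr.
  have pr : p \in r by apply/Hr.
  rewrite (perm_big _ (perm_to_rem pr)) big_cons.
  have p'r : p' \in rem p r by rewrite mem_rem_uniq // inE eq_sym pnp; exact/Hr.
  rewrite (perm_big _ (perm_to_rem p'r)) big_cons big1_seq => [|k /= ].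
    rewrite /= np' dotNl addr0 mulrN => /eqP; rewrite subr_eq0 => /eqP E.
    by apply/esym/(mulIf px).
  rewrite mem_rem_uniq ?rem_uniq // inE mem_rem_uniq // inE => /and3P[kp' kp /Hr rk].
  by rewrite kx ?mulr0.
have [[q [rq qp qp']]|no] := pselect (exists q, [/\ rot q, q.2 <> p.2 & q.2 <> - p.2]); last first.
  apply: (key (n p.2)) => [|k rk kp kp']; first by rewrite nrm1 ?oner_eq0.
  exfalso; apply: no; exists k; split=> // E.
    by move/eqP: kp; apply; exact: rot_inj.
  by move/eqP: kp'; apply; apply: rot_inj; rewrite // pp'.
have [q' rq' qq'] := opp q rq; have qL := rot_fvec rq.
have cpq : cr (n p.2) (n q.2) != 0.
  by apply/eqP => /(cr_zero rp rq)[].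
pose w := - dot e2 (n q.2) *: e1 + dot e1 (n q.2) *: e2.
have Ew x : dot x w = cr (n q.2) x.
  by rewrite /w !dotE /cross (dotC x e1) (dotC x e2); ring.
apply: (key w) => [|k rk kp kp']; first by rewrite Ew cr_anti oppr_eq0.
rewrite Ew; apply/eqP/negPn/negP => cqk.
have kq : k <> q by move=> E; case/negP: cqk; rewrite E /cross; apply/eqP; ring.
have kq' : k <> q'.
  move=> E; case/negP: cqk; rewrite E qq' nrmN // /cross !dotNr; apply/eqP; ring.
have [k' rk' kk'] := opp k rk; have kL := rot_fvec rk.
have ck : cr (n p.2) (n k.2) != 0.
  apply/eqP => /(cr_zero rp rk)[E|E].
    by move/eqP: kp; apply; exact: rot_inj.
  by move/eqP: kp'; apply; apply: rot_inj; rewrite // pp'.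
have pos a a' : rot a -> rot a' -> a'.2 = - a.2 -> cr (n p.2) (n a.2) != 0 ->
    exists2 b, (b = a \/ b = a') & 0 < 1 * cr (n p.2) (n b.2).
  move=> ra ra' aa'; rewrite neq_lt => /orP[c0|c0]; last by exists a; [left | rewrite mul1r].
  exists a'; first by right.
  have aL := rot_fvec ra.
  by rewrite mul1r aa' nrmN // cr_anti crossNl opprK cr_anti oppr_gt0.
have [a ak pa] := pos k k' rk rk' kk' ck; have [b bq pb] := pos q q' rq rq' qq' cpq.
have ra : rot a by case: ak => ->.
have rb : rot b by case: bq => ->.
have E := same_side (normr1 _) rp ra rb pa pb.
case: ak => ka; case: bq => qb; move: E; rewrite ka qb => E.
- by apply: kq.
- by apply: kq'.
- by apply: kq'; apply: (rot_inj rk rq'); rewrite qq' -E kk' opprK.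
by apply: kq; apply: (rot_inj rk rq); rewrite -[k.2]opprK -kk' E qq' opprK.
Qed.

(** A positive relation between at most three unit vectors of the plane, all
    different, is unique up to a factor. *)
Lemma rigid_small p q (r : seq ('rV[R]_d * 'rV[R]_d)) : uniq r ->
  (forall i, i \in r <-> rot i) -> (size r <= 3)%N -> rot p -> rot q ->
  exists c, rigid p q c.
Proof.
move=> ur Hr sr rp rq; have [->|pq] := eqVneq p q.
  by exists 1 => S _; rewrite mul1r.
have pr : p \in r by apply/Hr.
have qr : q \in rem p r by rewrite mem_rem_uniq // inE eq_sym pq; exact/Hr.
have sumE S x : solution S -> S p.1 p.2 * dot (n p.2) x + (S q.1 q.2 * dot (n q.2) x +
    \sum_(i <- rem q (rem p r)) S i.1 i.2 * dot (n i.2) x) = 0.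
  move=> sS; etransitivity; last exact: (rot_sum x sS ur Hr).
  by rewrite (perm_big _ (perm_to_rem pr)) big_cons (perm_big _ (perm_to_rem qr)) big_cons /=.
have pos S j : solution S -> rot j -> S j.1 j.2 != 0.
  by move=> [S0 _ _] [Tj _ /tightP[jL _] _]; rewrite gt_eqF // S0.
suff [x Hx H0] : exists2 x, (forall S, solution S -> dot (n p.2) x = 0 -> dot (n q.2) x = 0 -> False) &
    forall i, i \in rem q (rem p r) -> dot (n i.2) x = 0.
  exists (- (dot (n p.2) x / dot (n q.2) x)) => S sS; have := sumE S x sS.
  rewrite big1_seq => [/=|i /H0 ->]; last by rewrite mulr0.
  rewrite addr0.
  move=> E; have [B0|B0] := eqVneq (dot (n q.2) x) 0.
    exfalso; apply: (Hx S sS) => //; apply/eqP.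
    move/eqP: E; rewrite B0 mulr0 addr0 mulf_eq0 => /orP[|//].
    by move=> /eqP S0; have := pos S p sS rp; rewrite S0 eqxx.
  apply: (mulIf B0); rewrite !mulNr [X in - X]mulrAC divfK //.
  by apply/eqP; rewrite -addr_eq0 addrC [X in X + _]mulrC E.
have := size_rem qr; have := size_rem pr; have := rem_uniq q (rem_uniq p ur).
have Hk k : k \in rem q (rem p r) -> [/\ rot k, k != p & k != q].
  by rewrite mem_rem_uniq ?rem_uniq // inE mem_rem_uniq // inE => /and3P[-> -> /Hr].
case: (rem q (rem p r)) Hk => [|k [|j s]] Hk us sp sq.
- exists (n p.2) => // S _; rewrite nrm1 ?(rot_fvec rp) // => /eqP.
  by rewrite oner_eq0.
- have [rk kp kq] := Hk k (mem_head _ _).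
  pose w := - dot e2 (n k.2) *: e1 + dot e1 (n k.2) *: e2.
  have Ew x : dot x w = cr (n k.2) x.
    by rewrite /w !dotE /cross (dotC x e1) (dotC x e2); ring.
  exists w => [S _|i]; rewrite !Ew; last first.
    by rewrite inE => /eqP ->; rewrite /cross; ring.
  move=> /(cr_zero rk rp)[/(rot_inj rp rk)E|pE].
    by rewrite E eqxx in kp.
  move=> /(cr_zero rk rq)[/(rot_inj rq rk)E|qE].
    by rewrite E eqxx in kq.
  by move/eqP: pq; apply; apply: rot_inj; rewrite // pE qE.
by move: sq; rewrite sp /=; lia.
Qed.

End AtRidge.

Lemma ridge_dichotomy f e1 e2 : ridge D f e1 e2 ->
  (forall p q, rot D f e1 e2 p -> rot D f e1 e2 q -> exists c, rigid p q c) \/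
  (forall p, rot D f e1 e2 p -> exists q,
     [/\ rot D f e1 e2 q, q.2 = - p.2 & rigid p q 1]).
Proof.
move=> rf; have [[p [rp nop]]|opp] := pselect (exists p, rot D f e1 e2 p /\
    forall q, rot D f e1 e2 q -> q.2 != - p.2).
  left=> q k rq rk; have [r ur Hr] := finite_rot f e1 e2.
  exact: (rigid_small rf ur Hr (rot_small rf ur Hr rp nop)).
have opp' p : rot D f e1 e2 p -> exists2 q, rot D f e1 e2 q & q.2 = - p.2.
  move=> rp; apply: contrapT => H; apply: opp; exists p; split=> // q rq.
  by apply/eqP => E; apply: H; exists q.
right=> p rp; have [q rq qp] := opp' p rp; exists q; split=> // S sS.
by rewrite mul1r; exact: (opposite_equal rf sS opp').
Qed.

End Classification.

(** * Periods and characters *)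

Section Extension.
Context {R : realType} {V : zmodType}.
Implicit Types (G : set (V * R)) (x l : V) (c : R).

(** The graph of an additive map with values in R, defined on a subgroup. *)
Definition graph_hom G := [/\ G 0, forall p q, G p -> G q -> G (p - q) &
  forall c, G (0, c) -> c = 0].

Lemma graph_homMz G p (k : int) : graph_hom G -> G p -> G (p.1 *~ k, p.2 *~ k).
Proof.
move=> [G0 GB _] Gp.
have Gn (j : nat) : G (p.1 *+ j, p.2 *+ j).
  elim: j => [|j IH]; first by rewrite !mulr0n.
  have -> : (p.1 *+ j.+1, p.2 *+ j.+1) = p - (0 - (p.1 *+ j, p.2 *+ j)).
    by rewrite sub0r opprK !mulrS [in RHS](surjective_pairing p).
  exact: (GB _ _ Gp (GB _ _ G0 IH)).
case: k => j; first exact: Gn.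
have -> : (p.1 *~ Negz j, p.2 *~ Negz j) = 0 - (p.1 *+ j.+1, p.2 *+ j.+1).
  by rewrite sub0r !NegzE !mulrNz.
exact: GB.
Qed.

(** R is divisible: if a multiple k l of l belongs to the domain, the value at l
    has to be the value at k l divided by k; otherwise the value 0 will do. *)
Lemma extend_one G l : graph_hom G -> exists G',
  [/\ graph_hom G', G `<=` G' & exists c, G' (l, c)].
Proof.
move=> GH; have [G0 GB Gf] := GH.
(* the value at l that is forced by the multiples of l in the domain *)
have [c Hc] : exists c, forall (k : int) b, k != 0 -> G (l *~ k, b) -> b = c *~ k.
  have [[k [b [k0 Gk]]]|no] := pselect (exists (k : int) b, k != 0 /\ G (l *~ k, b)).
    exists (b / k%:~R) => j b' j0 Gj.
    have k1 : k%:~R != 0 :> R by rewrite intr_eq0.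
    have := graph_homMz j GH Gk; have := graph_homMz k GH Gj => /= A B.
    have := GB _ _ A B; rewrite -[(_, _) - _]/(_, _) /=.
    rewrite -!mulrzA [j * k]mulrC subrr => /Gf /eqP; rewrite subr_eq0 => /eqP E.
    have E2 : b' * k%:~R = b * j%:~R by rewrite !mulrzr.
    by apply: (mulIf k1); rewrite E2 -(mulrzr (b / k%:~R)) mulrAC divfK.
  by exists 0 => k b k0 Gk; case: no; exists k, b.
exists [set p | exists k : int, G (p.1 - l *~ k, p.2 - c *~ k)]; split.
- split.
  + by exists 0; rewrite !mulr0z !subr0.
  + move=> p q [k Gp] [j Gq]; exists (k - j) => /=.
    have E (U : zmodType) (x y a b : U) : x - a - (y - b) = x - y - (a - b).
        by rewrite !opprB -!addrA; congr (x + _); rewrite addrCA [RHS]addrCA [- a - y]addrC.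
    have := GB _ _ Gp Gq; rewrite -[(_, _) - _]/(_, _) /=.
    by rewrite (E V) (E R) -!mulrzBr.
  move=> b [k /=]; rewrite !sub0r; have [->|k0] := eqVneq k 0.
    by rewrite !mulr0z oppr0 subr0; exact: Gf.
  rewrite -mulrNz => /Hc; rewrite oppr_eq0 => /(_ k0).
  by rewrite mulrNz => /eqP; rewrite subr_eq addNr => /eqP.
- by move=> p Gp; exists 0; rewrite !mulr0z !subr0 -surjective_pairing.
by exists c, 1; rewrite /= !mulr1z !subrr.
Qed.

Lemma extend_seq G (s : seq V) : graph_hom G -> exists G',
  [/\ graph_hom G', G `<=` G' & forall l, l \in s -> exists c, G' (l, c)].
Proof.
move=> GH; elim: s => [|l s [G1 [H1 S1 E1]]]; first by exists G; split.
have [G2 [H2 S2 E2]] := extend_one l H1; exists G2; split=> //.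
  by move=> p /S1/S2.
move=> k; rewrite inE => /orP[/eqP -> //|/E1[c Hc]].
by exists c; exact: S2.
Qed.

End Extension.

Section Periods.
Context {R : realType} {d : nat} {P T : set 'rV[R]_d} (D : facet_system P T).
Implicit Types (t u v x y f l m : 'rV[R]_d) (p q : 'rV[R]_d * 'rV[R]_d).
Local Notation L := (fvec D).
Local Notation tight := (tight D).

(** The translations of the set of cells; they contain the facet vectors, and
    by [periods_cells] also all differences of cells. *)
Definition periods : set 'rV[R]_d := [set v | forall t, T t <-> T (t + v)].

Lemma periods0 : periods 0.
Proof. by move=> t; rewrite addr0. Qed.

Lemma periodsB u v : periods u -> periods v -> periods (u - v).
Proof. by move=> pu pv t; rewrite (pu t) (pv (t + (u - v))) addrA subrK. Qed.

Lemma periodsN v : periods v -> periods (- v).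
Proof. by move=> pv; rewrite -[- v]sub0r; apply: periodsB => //; exact: periods0. Qed.

Lemma periodsD u v : periods u -> periods v -> periods (u + v).
Proof. by move=> pu pv; rewrite -[v]opprK; apply: periodsB => //; exact: periodsN. Qed.

Lemma periods_fvec l : l \in L -> periods l.
Proof.
move=> lL t; split=> [Tt|Tt]; first exact: (step Tt lL).
by rewrite -[t](addrK l); exact: (step Tt (fvecN lL)).
Qed.

Lemma cells_induction (Q : set 'rV[R]_d) t t' : T t -> T t' -> Q t ->
  (forall u l, T u -> l \in L -> Q u -> Q (u + l)) -> Q t'.
Proof.
move=> Tt Tt' Qt HQ; have [p [q [_ _ H]]] := walk D Tt Tt'.
by apply: H => // u l Tu lL Qu _; exact: HQ.
Qed.

Lemma periods_cells t t' : T t -> T t' -> periods (t' - t).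
Proof.
move=> Tt Tt'; pose Q := [set u | periods (u - t)].
apply: (@cells_induction Q t t' Tt Tt'); first by rewrite /Q /= subrr; exact: periods0.
move=> u l Tu lL Qu; rewrite /Q /= addrAC; apply: periodsD => //.
exact: periods_fvec.
Qed.

Lemma ridge_shift f e1 e2 v : periods v -> ridge D f e1 e2 -> ridge D (f + v) e1 e2.
Proof.
move=> pv [ON rf]; split=> // t Tt Pt.
have Tt' : T (t - v) by apply/pv; rewrite subrK.
have Pt' : P (f - (t - v)) by rewrite opprB addrA.
have E l : tight t (f + v) l = tight (t - v) f l by rewrite -[t in LHS](subrK v) tight_shift.
have [pl [l [m [tl tm lm]]]] := rf _ Tt' Pt'; split=> [k|].
  by rewrite E; exact: pl.
by exists l, m; rewrite !E.
Qed.

Lemma rot_shift f e1 e2 v t l : periods v ->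
  rot D (f + v) e1 e2 (t + v, l) <-> rot D f e1 e2 (t, l).
Proof.
move=> pv; rewrite /rot /= tight_shift.
have -> : f + v - (t + v) = f - t by rewrite opprD addrACA subrr addr0.
have -> : turn D (f + v) e1 e2 (t + v) l = turn D f e1 e2 t l.
  by rewrite /turn (addrA _ t) opprD addrACA subrr addr0.
by split=> -[Tt Pt tl rl]; split=> //; exact/(pv t).
Qed.

Lemma star_shift (V : nmodType) (j : 'rV[R]_d -> 'rV[R]_d -> V) v : periods v ->
  star D j -> star D (fun t l => j (t + v) l).
Proof.
move=> pv sj f e1 e2 rf; etransitivity; last exact: (sj _ _ _ (ridge_shift pv rf)).
rewrite [RHS](reindex_fsbig (fun p => (p.1 + v, p.2)) (rot D f e1 e2)) //.
split.
- by move=> [t l] /= rt; apply/rot_shift.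
- by move=> [t l] [t' l'] _ _ [/addIr -> ->].
move=> [t l] rt; exists (t - v, l) => /=; last by rewrite subrK.
by apply/(rot_shift _ _ _ _ _ pv); rewrite subrK.
Qed.

Lemma solution_shift S v : periods v -> solution D S ->
  solution D (fun t l => S (t + v) l).
Proof.
move=> pv [S0 Ssym sS]; split.
- by move=> t l Tt lL; apply: S0 => //; exact/(pv t).
- by move=> t l Tt lL; rewrite addrAC; apply: Ssym => //; exact/(pv t).
exact: (star_shift pv sS).
Qed.

Lemma rigid_shift t l t' l' c v : periods v -> rigid D (t, l) (t', l') c ->
  rigid D (t + v, l) (t' + v, l') c.
Proof. by move=> pv H S /(solution_shift pv)/H. Qed.

Lemma rigid_trans p q k b c : rigid D p q b -> rigid D q k c -> rigid D p k (c * b).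
Proof. by move=> pq qk S sS; rewrite (qk S sS) (pq S sS) mulrA. Qed.

Lemma rigid_sym p q c : c != 0 -> rigid D p q c -> rigid D q p c^-1.
Proof. by move=> c0 pq S sS; rewrite (pq S sS) mulrA mulVf // mul1r. Qed.

Lemma rigid_pos S p q c : solution D S -> T p.1 -> p.2 \in L -> T q.1 -> q.2 \in L ->
  rigid D p q c -> 0 < c.
Proof.
move=> sS Tp pL Tq qL /(_ S sS); have [S0 _ _] := sS.
have := S0 _ _ Tp pL; have := S0 _ _ Tq qL => q0 p0 E.
by move: q0; rewrite E pmulr_lgt0.
Qed.

(** The translations v for which the facet (t0 + v, l0) is rigidly related to
    (t0, l0) form a group, on which the logarithm of the ratio is additive; it
    extends to all periods by [extend_seq], as L generates them. *)
Lemma log_character S t0 l0 : solution D S -> T t0 -> l0 \in L ->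
  exists ell : 'rV[R]_d -> R,
    (forall u v, periods u -> periods v -> ell (u + v) = ell u + ell v) /\
    (forall v c, periods v -> rigid D (t0, l0) (t0 + v, l0) (expR c) -> ell v = c).
Proof.
move=> sS T0 l0L.
pose G : set ('rV[R]_d * R) := [set p | periods p.1 /\
  rigid D (t0, l0) (t0 + p.1, l0) (expR p.2)].
have GH : graph_hom G.
  split.
  - split; first exact: periods0.
    by rewrite /= addr0 expR0 => S' _; rewrite mul1r.
  - move=> [u b] [v c] [/= pu ru] [/= pv rv]; split; first exact: periodsB.
    move=> /= S' sS'; have pNv := periodsN pv.
    have := rigid_shift pNv ru sS'; rewrite /= -addrA => ->.
    have := rigid_shift pNv rv sS'; rewrite /= addrK => ->.
    by rewrite expRB mulrA divfK // gt_eqF ?expR_gt0.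
  move=> c [/= _]; rewrite addr0 => /(_ S sS) /= E.
  have [S0 _ _] := sS; have := S0 _ _ T0 l0L => p0.
  apply: expR_inj; rewrite expR0; apply: (mulIf (lt0r_neq0 p0)).
  by rewrite -E mul1r.
have [G' [[G0 GB Gf] GG' GL]] := extend_seq L GH.
have uniqG v b c : G' (v, b) -> G' (v, c) -> b = c.
  move=> Gb Gc; apply/eqP; rewrite -subr_eq0; apply/eqP/Gf.
  by have := GB _ _ Gb Gc; rewrite -[(_, _) - _]/(_, _) /= subrr.
have ex v : periods v -> exists c, G' (v, c).
  move=> pv; pose Q := [set u | exists c, G' (u - t0, c)].
  have : Q (t0 + v).
    apply: (@cells_induction Q t0 (t0 + v) T0); first exact/(pv t0).
      by exists 0; rewrite subrr.
    move=> u l Tu lL [b Gb]; have [c Gc] := GL l lL; exists (b + c).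
    rewrite addrAC; have := GB _ _ Gb (GB _ _ G0 Gc).
    by rewrite sub0r opprK.
  by move=> [c]; rewrite addrAC subrr add0r; exists c.
pose ell v := xget 0 [set c | G' (v, c)].
have ellP v : periods v -> G' (v, ell v).
  by move=> /ex[c Gc]; rewrite /ell; case: xgetP => [b _ //|/(_ c)]; case.
exists ell; split=> [u v pu pv|v c pv rv].
  apply: (uniqG (u + v)); first exact/ellP/periodsD.
  have := GB _ _ (ellP u pu) (GB _ _ G0 (ellP v pv)).
  by rewrite sub0r opprK.
apply: (uniqG v); first exact: ellP.
by apply: GG'.
Qed.

End Periods.

(** * Translation invariant stars *)

Section Periodic.
Context {R : realType} {d : nat} {P T : set 'rV[R]_d} (D : facet_system P T).
Implicit Types (t u v x y f l m : 'rV[R]_d) (p q : 'rV[R]_d * 'rV[R]_d).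
Local Notation L := (fvec D).
Local Notation n := (nrm D).
Local Notation periods := (@periods _ _ T).

(** The exchange of opposite facets changes the sign of the sum. *)
Lemma star_opposite (V : lmodType R) (j : 'rV[R]_d -> 'rV[R]_d -> V) f e1 e2 :
  ridge D f e1 e2 ->
  (forall p, rot D f e1 e2 p -> exists q, [/\ rot D f e1 e2 q, q.2 = - p.2 &
     j q.1 q.2 = - j p.1 p.2]) ->
  \sum_(p \in rot D f e1 e2) j p.1 p.2 = 0.
Proof.
move=> rf H; have /choice[opp Hopp] : forall p, exists q, rot D f e1 e2 p ->
    [/\ rot D f e1 e2 q, q.2 = - p.2 & j q.1 q.2 = - j p.1 p.2].
  by move=> p; have [/H[q Hq]|no] := pselect (rot D f e1 e2 p); [exists q | exists p].
set s := LHS; have sN : s = - s.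
  rewrite {1}/s (reindex_fsbig opp (rot D f e1 e2)).
    have [r ur Hr] := finite_rot D f e1 e2.
    have E : rot D f e1 e2 = [set` r] by apply/seteqP; split => p /Hr.
    rewrite /s E -!fsbig_seq // -sumrN; apply: eq_big_seq => p /Hr rp.
    by have [_ _] := Hopp p rp.
  split.
  - by move=> p rp; have [] := Hopp p rp.
  - move=> p q /set_mem rp /set_mem rq E; apply: (rot_inj rf rp rq).
    have [_ p2 _] := Hopp p rp; have [_ q2 _] := Hopp q rq.
    by apply: oppr_inj; rewrite -p2 -q2 E.
  move=> p rp; have [ro o2 _] := Hopp p rp; exists (opp p) => //.
  have [roo oo2 _] := Hopp _ ro; apply: (rot_inj rf roo rp).
  by rewrite oo2 o2 opprK.
have : (2%:R : R) *: s = 0.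
  by rewrite scaler_nat mulr2n {1}sN addNr.
by move=> /eqP; rewrite scaler_eq0 pnatr_eq0 => /eqP.
Qed.

Variables (S0 : 'rV[R]_d -> 'rV[R]_d -> R) (sS : solution D S0).
Variables (t0 l0 : 'rV[R]_d).
Hypotheses (T0 : T t0) (l0L : l0 \in L).
Variable ell : 'rV[R]_d -> R.
Hypothesis ellD : forall u v, periods u -> periods v -> ell (u + v) = ell u + ell v.
Hypothesis ellE : forall v c, periods v ->
  rigid D (t0, l0) (t0 + v, l0) (expR c) -> ell v = c.

(** The facets related to a translate of (t0, l0) get the value forced by the
    relation, if the translate by v itself has the value exp (ell v). *)
Definition orbit_weight p : set R := [set k | exists v c,
  [/\ periods v, rigid D (t0 + v, l0) p c & k = c * expR (ell v)]].

Definition weight p : R := xget 0 (orbit_weight p).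

Definition facet_pair p := T p.1 /\ p.2 \in L.

Lemma T0v v : periods v -> T (t0 + v).
Proof. by move=> /(_ t0) <-. Qed.

Lemma orbit_pos v p c : periods v -> facet_pair p ->
  rigid D (t0 + v, l0) p c -> 0 < c.
Proof.
move=> pv [Tp pL] rv.
exact: (@rigid_pos _ _ _ _ D S0 (t0 + v, l0) p c sS (T0v pv) l0L Tp pL rv).
Qed.

Lemma orbit_weight_uniq p b c : facet_pair p ->
  orbit_weight p b -> orbit_weight p c -> b = c.
Proof.
move=> fp [v [b' [pv rv ->]]] [u [c' [pu ru ->]]].
have b0 := orbit_pos pv fp rv; have c0 := orbit_pos pu fp ru.
have puv : periods (u - v) by exact: periodsB.
have r1 : rigid D (t0 + v, l0) (t0 + u, l0) (c'^-1 * b').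
  exact: (rigid_trans rv (rigid_sym (lt0r_neq0 c0) ru)).
have := rigid_shift (periodsN pv) r1; rewrite addrK -addrA => r2.
have e0 : 0 < c'^-1 * b' by rewrite mulr_gt0 ?invr_gt0.
have /(ellE puv) E : rigid D (t0, l0) (t0 + (u - v), l0) (expR (ln (c'^-1 * b'))).
  by rewrite lnK ?posrE.
have -> : ell u = ell (u - v) + ell v by rewrite -ellD // subrK.
by rewrite E expRD lnK ?posrE // mulrA mulrA divff ?gt_eqF // mul1r.
Qed.

Lemma weightE p k : facet_pair p -> orbit_weight p k -> weight p = k.
Proof.
move=> fp ok; rewrite /weight; case: xgetP => [b _ ob|/(_ _ ok) //].
exact: (orbit_weight_uniq fp ob ok).
Qed.

Lemma weight_out p : ~ (exists k, orbit_weight p k) -> weight p = 0.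
Proof.
by move=> no; rewrite /weight; case: xgetP => // b _ ob; case: no; exists b.
Qed.

Lemma weight_ge0 p : facet_pair p -> 0 <= weight p.
Proof.
move=> fp; rewrite /weight; case: xgetP => // b _ [v [c [pv rv ->]]].
by rewrite mulr_ge0 ?expR_ge0 // ltW // (orbit_pos pv fp rv).
Qed.

Lemma weight_rigid p q c : facet_pair p -> facet_pair q -> rigid D p q c ->
  weight q = c * weight p.
Proof.
move=> fp fq pq; have [Tp pL] := fp; have [Tq qL] := fq.
have c0 := rigid_pos sS Tp pL Tq qL pq.
have [[k ok]|no] := pselect (exists k, orbit_weight p k).
  rewrite (weightE fp ok); apply: (weightE fq).
  case: ok => v [b [pv rv ->]]; exists v, (c * b); split; rewrite ?mulrA //.
  exact: rigid_trans rv pq.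
rewrite (weight_out no) mulr0; apply: weight_out => -[k [v [b [pv rv _]]]].
apply: no; exists (c^-1 * b * expR (ell v)); exists v, (c^-1 * b); split=> //.
exact: rigid_trans rv (rigid_sym (lt0r_neq0 c0) pq).
Qed.

Lemma weight_shift t l v : facet_pair (t, l) -> periods v ->
  weight (t + v, l) = expR (ell v) * weight (t, l).
Proof.
move=> [Tt lL] pv; have fp : facet_pair (t, l) by [].
have fp' : facet_pair (t + v, l) by split=> //; exact/(pv t).
have [[k ok]|no] := pselect (exists k, orbit_weight (t, l) k).
  rewrite (weightE fp ok); apply: (weightE fp').
  case: ok => u [b [pu ru ->]]; exists (u + v), b; split.
  - exact: periodsD.
  - by rewrite addrA; exact: rigid_shift.
  by rewrite ellD // expRD; ring.
rewrite (weight_out no) mulr0; apply: weight_out => -[k [u [b [pu ru _]]]].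
apply: no; exists (b * expR (ell (u - v))); exists (u - v), b; split=> //.
  exact: periodsB.
by have := rigid_shift (periodsN pv) ru; rewrite addrK addrA.
Qed.

Lemma weight_opp t l : facet_pair (t, l) -> weight (t + l, - l) = weight (t, l).
Proof.
move=> [Tt lL]; rewrite -[RHS]mul1r; apply: weight_rigid => //.
  by split; [exact: (step Tt lL) | exact: fvecN].
by move=> S [_ Ssym _]; rewrite mul1r; exact: Ssym.
Qed.

Lemma weight_base t : T t -> 0 < weight (t, l0) /\ 0 < weight (t, - l0).
Proof.
have H u : T u -> 0 < weight (u, l0).
  move=> Tu; have pv := periods_cells D T0 Tu.
  have -> : weight (u, l0) = 1 * expR (ell (u - t0)).
    apply: weightE => //; exists (u - t0), 1; split=> //.
    by rewrite addrC subrK => S _; rewrite mul1r.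
  by rewrite mul1r expR_gt0.
move=> Tt; split; first exact: H.
have Tl : T (t - l0) by exact: (step Tt (fvecN l0L)).
have := weight_opp (conj Tl l0L : facet_pair (t - l0, l0)); rewrite subrK => ->.
exact: H.
Qed.

Lemma rot_facet_pair f e1 e2 p : rot D f e1 e2 p -> facet_pair p.
Proof. by move=> [Tp _ /tightP[pL _] _]. Qed.

(** In the first case of [ridge_dichotomy], either none or all of the facets are
    related to the orbit of (t0, l0), and then the weights are proportional to
    the given scaling; in the second case opposite facets cancel. *)
Lemma weight_star : star D (fun t l => weight (t, l) *: n l).
Proof.
move=> f e1 e2 rf; have [H|H] := ridge_dichotomy rf; last first.
  apply: (star_opposite (j := fun t l => weight (t, l) *: n l)) => //.
  move=> p rp; have [q [rq qp pq]] := H p rp; exists q; split=> //.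
  rewrite -!surjective_pairing qp nrmN; last by case: (rot_facet_pair rp).
  by rewrite (weight_rigid (rot_facet_pair rp) (rot_facet_pair rq) pq) mul1r scalerN.
have [[p rp]|no] := pselect (exists p, rot D f e1 e2 p); last first.
  by apply: fsbig1 => p rp; case: no; exists p.
have [r ur Hr] := finite_rot D f e1 e2.
have E : rot D f e1 e2 = [set` r] by apply/seteqP; split => q /Hr.
have [Spos _ /(_ _ _ _ rf)] := sS; rewrite E -!fsbig_seq // => sum0.
have p0 : 0 < S0 p.1 p.2 by have [Tp pL] := rot_facet_pair rp; exact: Spos.
transitivity ((weight p / S0 p.1 p.2) *: \sum_(q <- r) S0 q.1 q.2 *: n q.2).
  rewrite scaler_sumr; apply: eq_big_seq => q /Hr rq; rewrite scalerA -surjective_pairing.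
  have [c pq] := H p q rp rq.
  rewrite (weight_rigid (rot_facet_pair rp) (rot_facet_pair rq) pq) (pq _ sS).
  by congr (_ *: _); rewrite mulrCA divfK ?gt_eqF.
by rewrite sum0 scaler0.
Qed.

(** In the first case of [ridge_dichotomy], if one facet is parallel to l0 then all
    of them are; by positivity both l0 and - l0 occur. Thus they always pair off. *)
Lemma indicator_star :
  (forall t l, T t -> l \in L -> weight (t, l) != 0 -> l = l0 \/ l = - l0) ->
  star D (fun _ l => ((l == l0) || (l == - l0))%:R *: n l).
Proof.
move=> only f e1 e2 rf.
suff H : forall p, rot D f e1 e2 p -> (p.2 == l0) || (p.2 == - l0) ->
    exists2 q, rot D f e1 e2 q & q.2 = - p.2.
  pose j (t l : 'rV[R]_d) := ((l == l0) || (l == - l0))%:R *: n l.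
  have [[p [rp pl]]|no] := pselect (exists p, rot D f e1 e2 p /\
     (p.2 == l0) || (p.2 == - l0)); last first.
    apply: fsbig1 => p rp; case: (boolP (_ || _)) => pl; last by rewrite scale0r.
    by case: no; exists p.
  have [H1|H1] := ridge_dichotomy rf; last first.
    apply: (star_opposite (j := j)) => // q rq; have [k [rk kq _]] := H1 q rq.
    exists k; split=> //; rewrite /j kq nrmN ?scalerN; last by case: (rot_facet_pair rq).
    by rewrite eqr_opp eqr_oppLR orbC.
  apply: (star_opposite (j := j)) => // q rq.
  have ql : (q.2 == l0) || (q.2 == - l0).
    have [c pq] := H1 p q rp rq; have fq := rot_facet_pair rq; have fp := rot_facet_pair rp.
    have c0 := rigid_pos sS fp.1 fp.2 fq.1 fq.2 pq.
    have wp : 0 < weight p.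
      have [A B] := weight_base fp.1.
      by rewrite [p]surjective_pairing; case/orP: pl => /eqP ->.
    have : weight (q.1, q.2) != 0.
      by rewrite -surjective_pairing (weight_rigid fp fq pq) gt_eqF ?mulr_gt0.
    by move=> /(only _ _ fq.1 fq.2)[->|->]; rewrite eqxx ?orbT.
  have [k rk kq] := H q rq ql; exists k; split=> //.
  rewrite /j kq nrmN ?scalerN; last by case: (rot_facet_pair rq).
  by rewrite eqr_opp eqr_oppLR orbC.
move=> p rp pl; apply: contrapT => no.
have nop q : rot D f e1 e2 q -> q.2 <> - p.2 by move=> rq E; apply: no; exists q.
have [H1|H1] := ridge_dichotomy rf; last by have [q [rq qp _]] := H1 p rp; exact: (nop q).
have fp := rot_facet_pair rp.
have all q : rot D f e1 e2 q -> q = p.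
  move=> rq; have [c pq] := H1 p q rp rq; have fq := rot_facet_pair rq.
  have c0 := rigid_pos sS fp.1 fp.2 fq.1 fq.2 pq.
  have wp : 0 < weight p.
    have [A B] := weight_base fp.1.
    by rewrite [p]surjective_pairing; case/orP: pl => /eqP ->.
  have : weight (q.1, q.2) != 0.
    by rewrite -surjective_pairing (weight_rigid fp fq pq) gt_eqF ?mulr_gt0.
  have nq := nop q rq.
  move=> /(only _ _ fq.1 fq.2) ql; apply: (rot_inj rf rq rp).
  by case: ql nq => ->; case/orP: pl => /eqP ->; rewrite ?opprK.
have [Spos _ /(_ _ _ _ rf)] := sS.
have -> : rot D f e1 e2 = [set p] by apply/seteqP; split=> q /=; [exact: all | move=> ->].
rewrite fsbig_set1 => /eqP; rewrite scaler_eq0 gt_eqF /=; last exact: Spos fp.1 fp.2.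
by move=> /eqP n0; have := nrm1 fp.2; rewrite n0 dot0l => /eqP; rewrite eq_sym oner_eq0.
Qed.

(** Let a be the potential of the weights. Its translate by a period u differs
    from exp (ell u) a by a constant, and if exp (ell v) is not 1, these
    constants disappear when a suitable constant is added to a. Then all the
    values of a are multiples of one vector, hence so are the differences
    between neighbours, which are multiples of the normals. *)
Lemma unbalanced_parallel v : periods v -> expR (ell v) != 1 ->
  forall t l, T t -> l \in L -> weight (t, l) != 0 -> l = l0 \/ l = - l0.
Proof.
move=> pv v1; pose j t l := weight (t, l) *: n l.
have aj : anti D j.
  by move=> t l Tt lL; rewrite /j weight_opp // nrmN // scalerN.
have [a Ha] := potential weight_star aj.
have shift u : periods u -> exists k, forall t, T t -> a (t + u) = expR (ell u) *: a t + k.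
  move=> pu; exists (a (t0 + u) - expR (ell u) *: a t0) => t Tt.
  apply: (@cells_induction _ _ _ _ D [set t | a (t + u) = expR (ell u) *: a t +
    (a (t0 + u) - expR (ell u) *: a t0)] t0 t T0 Tt) => /=.
    by rewrite [RHS]addrC subrK.
  move=> s l Ts lL; rewrite addrAC (Ha (s + u) l) ?(Ha s l) //; last exact/(pu s).
  by move=> ->; rewrite /j weight_shift // scalerDr scalerA addrAC.
have [k Hk] := shift v pv; set ev := expR (ell v) in v1 Hk.
have ev1 : ev - 1 != 0 by rewrite subr_eq0.
(* after adding k / (ev - 1), a is multiplied by ev under the translation by v *)
have [b [bE bv bk]] : exists b : 'rV[R]_d -> 'rV[R]_d,
    [/\ forall t l, T t -> l \in L -> b (t + l) = b t + weight (t, l) *: n l,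
      forall t, T t -> b (t + v) = ev *: b t &
      forall u, periods u -> exists k, forall t, T t -> b (t + u) = expR (ell u) *: b t + k].
  exists (fun t => a t + (ev - 1)^-1 *: k); split=> [t l Tt lL|t Tt|u pu].
  - by rewrite Ha // addrAC.
  - rewrite Hk // scalerDr -addrA; congr (_ + _).
    apply: (scalerI ev1); rewrite scalerDr !scalerA divff // [_ * ev]mulrC -mulrA divff //.
    by rewrite mulr1 scale1r -{2}[k]scale1r -scalerDl subrK.
  have [c Hc] := shift u pu.
  exists (c + (ev - 1)^-1 *: k - expR (ell u) *: ((ev - 1)^-1 *: k)) => t Tt.
  by rewrite Hc // scalerDr; apply/rowP => i; rewrite !mxE; ring.
have bu u t : periods u -> T t -> b (t + u) = expR (ell u) *: b t.
  move=> pu Tt; have [e He] := bk u pu.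
  have Tu : T (t + u) by exact/(pu t).
  have Tv : T (t + v) by exact/(pv t).
  have := bv _ Tu; rewrite addrAC (He _ Tv) (bv _ Tt) (He _ Tt) scalerDr !scalerA mulrC.
  (* the value at t + u + v, computed in both orders *)
  move=> /addrI E; have : (ev - 1) *: e = 0 by rewrite scalerBl -E scale1r subrr.
  by move=> /eqP; rewrite scaler_eq0 (negbTE ev1) => /eqP ->; rewrite addr0.
have par t l : T t -> l \in L -> weight (t, l) *: n l = (expR (ell (t - t0)) * (expR (ell l) - 1)) *: b t0.
  move=> Tt lL; have pl := periods_fvec lL; have pt := periods_cells D T0 Tt.
  have E := bu _ _ pl Tt; rewrite bE // in E.
  have -> : weight (t, l) *: n l = expR (ell l) *: b t - b t by rewrite -E addrC addKr.
  have -> : b t = expR (ell (t - t0)) *: b t0 by rewrite -bu // addrC subrK.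
  by rewrite scalerA -scalerBl; congr (_ *: _); ring.
move=> t l Tt lL w0; have [w1 _] := weight_base Tt.
have := par t l Tt lL; have := par t l0 Tt l0L.
move: (expR _ * _) (expR _ * _) => c2 c1 E1 E2.
have c20 : c1 != 0.
  apply/eqP => c10; move/eqP: E1; rewrite c10 scale0r scaler_eq0 gt_eqF //= => /eqP n0.
  by have := nrm1 l0L; rewrite n0 dot0l => /eqP; rewrite eq_sym oner_eq0.
apply: (nrm_parallel (b := c2 * weight (t, l0)) (c := - c1 * weight (t, l)) l0L lL).
  apply/eqP => /eqP; rewrite mulf_eq0 (gt_eqF w1) orbF => /eqP c20'.
  move/eqP: E2; rewrite c20' scale0r scaler_eq0 (negbTE w0) => /eqP n0.
  by have := nrm1 lL; rewrite n0 dot0l => /eqP; rewrite eq_sym oner_eq0.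
by rewrite -!scalerA E1 E2 !scalerA -scalerDl mulNr mulrC subrr scale0r.
Qed.

(** If the character is trivial, the weights are periodic; otherwise the
    indicator of the facets parallel to l0 is used. *)
Lemma periodic_weight : exists w : 'rV[R]_d -> R,
  [/\ forall l, l \in L -> 0 <= w l, forall l, l \in L -> w (- l) = w l, 0 < w l0 &
      star D (fun _ l => w l *: n l)].
Proof.
have [[v [pv v1]]|bal] := pselect (exists v, periods v /\ expR (ell v) != 1).
  exists (fun l => ((l == l0) || (l == - l0))%:R); split.
  - by move=> l _; rewrite ler0n.
  - by move=> l _; rewrite eqr_opp eqr_oppLR orbC.
  - by rewrite eqxx.
  exact/indicator_star/(unbalanced_parallel pv v1).
have wper t l : T t -> l \in L -> weight (t, l) = weight (t0, l).
  move=> Tt lL; have pt := periods_cells D T0 Tt.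
  have := weight_shift (conj T0 lL : facet_pair (t0, l)) pt.
  rewrite addrC subrK => ->; rewrite [expR _](_ : _ = 1) ?mul1r //.
  by apply/eqP/negPn/negP => e1; apply: bal; exists (t - t0).
exists (fun l => weight (t0, l)); split.
- by move=> l lL; apply: weight_ge0.
- move=> l lL; have := weight_opp (conj T0 lL : facet_pair (t0, l)).
  by rewrite wper //; [exact: (step T0 lL) | exact: fvecN].
- by have [] := weight_base T0.
move=> f e1 e2 rf; rewrite -[RHS](weight_star rf).
apply: eq_fsbigr => -[t l] /set_mem /rot_facet_pair[Tt lL] /=.
by rewrite (wper t l).
Qed.

End Periodic.

(** * Bases of discrete groups *)

Section LatticeBasis.
Context {R : realType} {d : nat}.
Implicit Types (u v x : 'rV[R]_d) (M : 'M[R]_d).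
Variables (G : set 'rV[R]_d).
Hypotheses (G0 : G 0) (GB : forall u v, G u -> G v -> G (u - v)).
Hypothesis Gfin : forall r : R, finite_set [set u | G u /\ `|u| <= r].

Definition rows_in M := forall i, G (row i M).

Lemma groupD u v : G u -> G v -> G (u + v).
Proof. by move=> Gu Gv; have := GB Gu (GB G0 Gv); rewrite sub0r opprK. Qed.

Lemma groupMz u (k : int) : G u -> G (u *~ k).
Proof.
move=> Gu; have Gn (j : nat) : G (u *+ j).
  by elim: j => [|j IH]; rewrite ?mulr0n // mulrS; exact: groupD.
case: k => j; first exact: Gn.
by rewrite NegzE mulrNz -sub0r; exact: (GB G0 (Gn j.+1)).
Qed.

(** The integer combinations of rows are the points of [lattice]. *)
Lemma group_comb M (z : 'rV[int]_d) : rows_in M -> G (map_mx intr z *m M).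
Proof.
move=> GM; rewrite mulmx_sum_row; elim/big_ind: _ => //; first exact: groupD.
by move=> i _; rewrite mxE scaler_int; exact/groupMz/GM.
Qed.

Lemma int_row (c : 'rV[R]_d) : (forall i, c 0 i \is a Num.int) ->
  exists z : 'rV[int]_d, c = map_mx intr z.
Proof.
move=> ci; exists (\row_i Num.floor (c 0 i)); apply/rowP => i.
by rewrite !mxE floorK.
Qed.

Lemma int_mx (M : 'M[R]_d) : (forall i k, M i k \is a Num.int) ->
  exists Z : 'M[int]_d, M = map_mx intr Z.
Proof.
move=> Mi; exists (\matrix_(i, k) Num.floor (M i k)); apply/matrixP => i k.
by rewrite !mxE floorK.
Qed.

(** Reduction modulo the lattice spanned by the rows of a basis. *)
Definition frac_row (c : 'rV[R]_d) : 'rV[R]_d := \row_i (c 0 i - (Num.floor (c 0 i))%:~R).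

Lemma frac_row_in M x : M \in unitmx -> rows_in M -> G x ->
  G (frac_row (x *m invmx M) *m M).
Proof.
move=> Mu GM Gx; set c := x *m invmx M.
have -> : frac_row c = c - map_mx intr (\row_i Num.floor (c 0 i)).
  by apply/rowP => i; rewrite !mxE.
by rewrite mulmxBl mulmxKV //; apply: GB => //; exact: group_comb.
Qed.

Lemma frac_row_bounded M c : `|frac_row c *m M| <= \sum_i `|row i M|.
Proof.
rewrite mulmx_sum_row; apply: le_trans (ler_norm_sum _ _ _) _.
apply: ler_sum => i _; rewrite normrZ ler_piMl // mxE ger0_norm ?subr_ge0 ?floor_le //.
by rewrite lerBlDl -intrD1 ltW // floorD1_gt.
Qed.

Variable M0 : 'M[R]_d.
Hypotheses (M0u : M0 \in unitmx) (GM0 : rows_in M0).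

(** By pigeonhole, two of the multiples k x have the same remainder modulo M0, and
    there are finitely many remainders. *)
Lemma common_denominator : exists2 m : nat, (0 < m)%N &
  forall x, G x -> forall i, m%:R * (x *m invmx M0) 0 i \is a Num.int.
Proof.
have /finite_seqP[s Hs] := Gfin (\sum_i `|row i M0|).
exists (size s)`!; first exact: fact_gt0.
move=> x Gx i.
pose r (k : 'I_(size s).+1) := frac_row ((x *+ k) *m invmx M0) *m M0.
have rs k : r k \in s.
  have : [set u | G u /\ `|u| <= \sum_i `|row i M0|] (r k).
    split; last exact: frac_row_bounded.
    by apply: frac_row_in => //; exact: (groupMz k%:Z Gx).
  by have := congr1 (fun Z => Z (r k)) Hs; rewrite /= => ->.
(* more multiples than remainders *)
have ninj : ~~ injectiveb (fun k => Ordinal (etrans (index_mem (r k) s) (rs k) : (index (r k) s < size s)%N)).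
  apply/injectiveP => /leq_card; rewrite !card_ord ltnn //.
have [k [k' [kk' E]]] : exists k k' : 'I_(size s).+1, (k < k')%N /\ r k = r k'.
  move/injectivePn: ninj => [a [b ab /(congr1 val) /= E]].
  have rE : r a = r b by rewrite -(nth_index 0 (rs a)) -(nth_index 0 (rs b)) E.
  have : (a < b)%N || (b < a)%N by rewrite -neq_ltn.
  by case/orP => ?; [exists a, b | exists b, a].
set c := (x *m invmx M0) 0 i.
have ck : (k' - k)%:R * c \is a Num.int.
  have /(congr1 (fun y => (y *m invmx M0) 0 i)) := E.
  rewrite /r !mulmxK // [LHS]mxE [RHS]mxE.
  have cE (j : nat) : ((x *+ j) *m invmx M0) 0 i = j%:R * c.
    by rewrite -scaler_nat -scalemxAl mxE.
  rewrite !cE => E'; rewrite natrB ?(ltnW kk') // mulrBl.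
  have -> : k'%:R * c - k%:R * c = (Num.floor (k'%:R * c))%:~R - (Num.floor (k%:R * c))%:~R by lra.
  by rewrite -intrB; exact: intr_int.
have : (k' - k %| (size s)`!)%N.
  by apply: dvdn_fact; have := ltn_ord k'; lia.
by move=> /dvdnP[q ->]; rewrite natrM -mulrA; apply: rpredM => //; exact: natr_int.
Qed.

(** The determinants are multiples of a fixed positive number, so there is a
    smallest nonzero one. *)
Lemma det_discrete : exists2 m : nat, (0 < m)%N & forall M, rows_in M ->
  exists k : nat, `|\det M| * (m ^ d)%:R = k%:R * `|\det M0|.
Proof.
have [m m0 Hm] := common_denominator; exists m => // M GM.
have [|Z HZ] := @int_mx (m%:R *: (M *m invmx M0)).
  by move=> i k; rewrite mxE; have := Hm _ (GM i) k; rewrite -row_mul [row _ _ _ _]mxE.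
exists `|\det Z|%N.
have : \det (m%:R *: M) = \det (map_mx intr Z) * \det M0.
  by rewrite -HZ -det_mulmx -scalemxAl mulmxKV.
rewrite det_map_mx detZ => /(congr1 Num.norm); rewrite !normrM => E.
rewrite mulrC natrX -[m%:R]ger0_norm // -normrX E; congr (_ * _).
by rewrite -intr_norm natr_absz.
Qed.

(** The coordinates of the basis obtained from a basis by replacing its vector i
    by the vector with coordinates c. *)
Definition replace_row (i : 'I_d) (c : 'rV[R]_d) : 'M[R]_d :=
  \matrix_(j, k) if j == i then c 0 k else (j == k)%:R.

Lemma det_replace_row i c : \det (replace_row i c) = c 0 i.
Proof.
rewrite (expand_det_col _ i) (bigD1 i) //= big1 ?addr0 => [|j ji].
  rewrite mxE eqxx /cofactor -signr_odd addnn odd_double expr0 mul1r.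
  rewrite [X in \det X](_ : _ = 1%:M) ?det1 ?mulr1 //.
  apply/matrixP => j k; rewrite !mxE (inj_eq lift_inj).
  by rewrite [lift i j == i]eq_sym (negbTE (neq_lift _ _)).
by rewrite mxE (negbTE ji) mul0r.
Qed.

(** A system of smallest nonzero determinant is a basis of the group: otherwise
    some vector of the group has a coordinate strictly between 0 and 1, and the
    exchange multiplies the determinant by this coordinate. *)
Lemma lattice_basis : exists2 B : 'M[R]_d, B \in unitmx & lattice B = G.
Proof.
have [m m0 Hm] := det_discrete.
pose Q (k : nat) := `[< exists M, [/\ rows_in M, \det M != 0 &
  `|\det M| * (m ^ d)%:R = k%:R * `|\det M0|] >].
have d0 : \det M0 != 0 by rewrite -unitfE -unitmxE.
have exQ : exists k, Q k.
  by have [k Hk] := Hm M0 GM0; exists k; apply/asboolP; exists M0.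
case: (ex_minnP exQ) => k /asboolP[B [GB' dB EB]] kmin.
have Bu : B \in unitmx by rewrite unitmxE unitfE.
exists B => //; apply/seteqP; split => [_ [z _ <-]|x Gx]; first exact: group_comb.
have [|z Hz] := @int_row (x *m invmx B); last first.
  by exists z => //; rewrite -Hz mulmxKV.
move=> i; apply/negPn/negP => ni.
set c := frac_row (x *m invmx B).
have ci0 : 0 <= c 0 i < 1.
  rewrite mxE subr_ge0 floor_le /= ltrBlDl -intrD1 floorD1_gt //.
have ci1 : c 0 i != 0.
  rewrite mxE subr_eq0; apply/negP => /eqP E; move/negP: ni; apply.
  by rewrite E; exact: intr_int.
pose B' := replace_row i c *m B.
have dB' : \det B' = c 0 i * \det B by rewrite det_mulmx det_replace_row.
have GB'' : rows_in B'.
  move=> j; rewrite row_mul; have [->|ji] := eqVneq j i.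
    have -> : row i (replace_row i c) = c by apply/rowP => q; rewrite !mxE eqxx.
    exact: frac_row_in.
  have -> : row j (replace_row i c) = delta_mx 0 j.
    by apply/rowP => q; rewrite !mxE (negbTE ji) eqxx /= eq_sym.
  by rewrite -rowE.
have [k' Ek'] := Hm B' GB''.
have : Q k'.
  by apply/asboolP; exists B'; split=> //; rewrite dB' mulf_neq0.
move=> /kmin; rewrite leqNgt => /negP; apply.
rewrite -(ltr_nat R) -(ltr_pM2r (_ : 0 < `|\det M0|)) ?normr_gt0 // -Ek' -EB.
rewrite dB' normrM -mulrA; case/andP: ci0 => c0 c1.
rewrite (ger0_norm c0) gtr_pMl //.
by rewrite mulr_gt0 ?normr_gt0 // ltr0n expn_gt0 m0.
Qed.

End LatticeBasis.

Section Periods.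
Context {R : realType} {d : nat} {P T : set 'rV[R]_d} (D : facet_system P T).
Implicit Types (t u v x y f l m : 'rV[R]_d).
Local Notation L := (fvec D).
Local Notation periods := (@periods _ _ T).

(** Otherwise the cells would lie in a strip orthogonal to v. *)
Lemma fvec_spans v : (forall l, l \in L -> dot l v = 0) -> v = 0.
Proof.
move=> Hv; apply/eqP/negPn/negP => v0.
have [t0 T0 _] := covered D 0; have [M HM] := bounded D.
have tv t : T t -> dot t v = dot t0 v.
  move=> Tt; apply: (@cells_induction _ _ _ _ D [set t | dot t v = dot t0 v] t0 t T0 Tt) => //=.
  by move=> u l Tu lL E; rewrite dotDl E (Hv l lL) addr0.
have [K HK] : exists K, forall x, P x -> dot x v <= K.
  exists (d%:R * M * `|v|) => x Px; apply: le_trans (ler_norm _) _.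
  apply: le_trans (dot_norm_le x v) _.
  by rewrite ler_wpM2r // ler_wpM2l // HM.
have vv : 0 < dot v v by rewrite lt_def dot_eq0 v0 dot_ge0.
pose x := ((K + dot t0 v + 1) / dot v v) *: v.
have [t Tt Pt] := covered D x; have := HK _ Pt.
rewrite dotDl dotNl (tv t Tt) /x dotZl divfK ?gt_eqF //; lra.
Qed.

Lemma finite_periods (r : R) : finite_set [set u | periods u /\ `|u| <= r].
Proof.
have [t0 T0 _] := covered D 0.
have F := finite_image (fun t => t - t0) (locfin D (`|t0| + r)).
apply: sub_finite_set F => u [/= pu ur]; exists (t0 + u); last by rewrite addrC addKr.
by split; [exact/(pu t0) | apply: le_trans (ler_normD _ _) _; rewrite lerD2l].
Qed.

(** The facet vectors span the space, so they contain a basis of it. *)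
Lemma periods_lattice : exists2 B : 'M[R]_d, B \in unitmx & lattice B = periods.
Proof.
pose A : 'M[R]_(size L, d) := \matrix_(i < size L) (nth 0 L i).
have fA : row_full A.
  rewrite -sub1mx submxE mul1mx; apply/eqP/matrixP => i k; rewrite [RHS]mxE.
  have /fvec_spans : forall l, l \in L -> dot l (\row_j cokermx A j k) = 0.
    move=> l lL; have := mulmx_coker A; move/matrixP/(_ (Ordinal (etrans (index_mem l L) lL)) k).
    rewrite !mxE => <-; apply: eq_bigr => j _; rewrite !mxE nth_index //.
  by move=> /rowP/(_ i); rewrite !mxE.
have [] := @lattice_basis _ _ periods (@periods0 _ _ _) (@periodsB _ _ _) finite_periods (rowsub (fullrankfun fA) A).
- exact: fullrowsub_unit.
- move=> i; rewrite row_rowsub rowK; apply: periods_fvec; exact: mem_nth.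
by move=> B Bu BE; exists B.
Qed.

End Periods.

(** * Positive definite matrices *)

Section Cholesky.
Context {R : realType}.

Definition pos_def k (A : 'M[R]_k) :=
  A^T = A /\ forall x : 'rV[R]_k, x != 0 -> 0 < dot (x *m A) x.

Lemma dotE_mx k (u v : 'rV[R]_k) : (dot u v)%:M = u *m v^T.
Proof.
apply/matrixP => i j; rewrite !ord1 !mxE eqxx mulr1n.
by apply: eq_bigr => q _; rewrite mxE.
Qed.

Lemma dot_row_mx k k' (u u' : 'rV[R]_k) (v v' : 'rV[R]_k') :
  dot (row_mx u v) (row_mx u' v') = dot u u' + dot v v'.
Proof.
rewrite /dot big_split_ord /=; congr (_ + _); apply: eq_bigr => i _.
  by rewrite !row_mxEl.
by rewrite !row_mxEr.
Qed.

(** Elimination of the first variable: the Schur complement is positive definite. *)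
Lemma cholesky k (A : 'M[R]_k) : pos_def A -> exists C : 'M[R]_k, A = C *m C^T.
Proof.
elim: k A => [|k IH] A [AT Apos].
  by exists 0; apply/matrixP => -[].
rewrite -[k.+1]/(1 + k)%N in A AT Apos *.
have [a [b [b' [D AE]]]] : exists (a : 'M[R]_(1, 1)) (b : 'M[R]_(1, k)) b' (D : 'M[R]_k),
    block_mx a b b' D = A.
  by exists (ulsubmx A), (ursubmx A), (dlsubmx A), (drsubmx A); exact: submxK.
have [bT DT] : b' = b^T /\ D^T = D.
  move: AT; rewrite -AE tr_block_mx => /eq_block_mx[_ _ E1 E2]; split=> //.
pose r := a 0 0.
have aE : a = r%:M by apply/matrixP => i j; rewrite !ord1 !mxE eqxx mulr1n.
have QE (x : 'rV[R]_1) (y : 'rV[R]_k) : dot (row_mx x y *m A) (row_mx x y) =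
    r * (x 0 0) ^+ 2 + 2 * x 0 0 * dot b y + dot (y *m D) y.
  rewrite -AE mul_row_block dot_row_mx aE bT.
  have xE : x = (x 0 0)%:M by apply/matrixP => i j; rewrite !ord1 !mxE eqxx mulr1n.
  set s := x 0 0 in xE *; rewrite xE !mul_scalar_mx -dotE_mx.
  have dot1 (u v : 'rV[R]_1) : dot u v = u 0 0 * v 0 0 by rewrite /dot big_ord1.
  by rewrite !dotDl !dotZl (dotC y b) !dot1 !mxE !eqxx !mulr1n; ring.
have r0 : 0 < r.
  have := Apos (row_mx 1%:M 0); rewrite QE mul0mx dot0l (dotC b) dot0l mxE eqxx.
  rewrite mulr1n expr1n !mulr1 mulr0 !addr0; apply.
  apply/eqP => /(congr1 (fun z : 'rV[R]_(1 + k) => lsubmx z 0 0)).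
  by rewrite row_mxKl !mxE eqxx => /eqP; rewrite oner_eq0.
pose S := D - r^-1 *: (b^T *m b).
(* positivity of S at y is positivity of A at (- b y / r, y) *)
have [C SE] : exists C : 'M[R]_k, S = C *m C^T.
  apply: IH; split.
    by rewrite /S linearB linearZ /= trmx_mul trmxK DT.
  move=> y y0; pose x : 'rV[R]_1 := (- (dot b y / r))%:M.
  have := Apos (row_mx x y); rewrite QE.
  have -> : x 0 0 = - (dot b y / r) by rewrite mxE eqxx mulr1n.
  have -> : dot (y *m S) y = dot (y *m D) y - dot b y ^+ 2 / r.
    rewrite /S mulmxBr dotDl dotNl -scalemxAr dotZl mulmxA -dotE_mx mul_scalar_mx.
    by rewrite dotZl (dotC y b) expr2; ring.
  have -> : r * (- (dot b y / r)) ^+ 2 + 2 * (- (dot b y / r)) * dot b y + dot (y *m D) y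
     = dot (y *m D) y - dot b y ^+ 2 / r by field; rewrite gt_eqF.
  apply; apply/eqP => /(congr1 rsubmx); rewrite row_mxKr => E.
  by move/eqP: y0; apply; rewrite E linear0.
exists (block_mx (Num.sqrt r)%:M 0 ((Num.sqrt r)^-1 *: b^T) C).
have q0 : Num.sqrt r != 0 by rewrite gt_eqF ?sqrtr_gt0.
rewrite tr_block_mx mulmx_block -AE aE bT; congr block_mx.
- by rewrite tr_scalar_mx mul0mx addr0 -scalar_mxM -expr2 sqr_sqrtr ?ltW.
- by rewrite mul0mx addr0 linearZ /= trmxK mul_scalar_mx scalerA divff // scale1r.
- by rewrite trmx0 mulmx0 addr0 tr_scalar_mx mul_mx_scalar scalerA divff // scale1r.
rewrite -SE /S linearZ /= trmxK -scalemxAl -scalemxAr scalerA -invfM -expr2 sqr_sqrtr ?ltW //.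
by rewrite addrC subrK.
Qed.

Lemma pos_def_unit k (A : 'M[R]_k) : pos_def A -> A \in unitmx.
Proof.
move=> [_ Apos]; rewrite -row_free_unit -kermx_eq0.
apply/eqP/row_matrixP => i; rewrite row0; apply/eqP/negPn/negP => /Apos.
by rewrite -row_mul mulmx_ker row0 dot0l ltxx.
Qed.

End Cholesky.

(** * The quadratic form of an invariant scaling *)

Section Form.
Context {R : realType} {d : nat} {P T : set 'rV[R]_d} (D : facet_system P T).
Implicit Types (t u v x y z f l m : 'rV[R]_d).
Local Notation L := (fvec D).
Local Notation n := (nrm D).
Local Notation h := (hgt D).
Local Notation periods := (@periods _ _ T).

(** A canonical scaling that is invariant under all translations. *)
Definition periodic_solution (w : 'rV[R]_d -> R) :=
  [/\ forall l, l \in L -> 0 < w l, forall l, l \in L -> w (- l) = w l &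
      star D (fun _ l => w l *: n l)].

(** The sum over all l0 of the stars of [periodic_weight] is positive everywhere. *)
Lemma periodic_solution_exists S : solution D S -> exists w, periodic_solution w.
Proof.
move=> sS; have [t0 T0 _] := covered D 0.
suff H (s : seq 'rV[R]_d) : {subset s <= L} -> exists w : 'rV[R]_d -> R,
    [/\ forall l, l \in L -> 0 <= w l, forall l, l \in L -> w (- l) = w l,
      forall l, l \in s -> 0 < w l & star D (fun _ l => w l *: n l)].
  by have [w [_ ws wp sw]] := H L (fun l lL => lL); exists w.
elim: s => [|l0 s IH] sL.
  exists (fun=> 0); split=> // f e1 e2 _.
  by apply: fsbig1 => p _; rewrite scale0r.
have [|w [w0 ws wp sw]] := IH; first by move=> l ls; apply: sL; rewrite inE ls orbT.
have l0L : l0 \in L by apply: sL; rewrite mem_head.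
have [ell [ellD ellE]] := log_character sS T0 l0L.
have [w' [w0' ws' wp' sw']] := periodic_weight sS T0 l0L ellD ellE.
exists (fun l => w l + w' l); split.
- by move=> l lL; rewrite addr_ge0 ?w0 ?w0'.
- by move=> l lL; rewrite ws ?ws'.
- move=> l; rewrite inE => /orP[/eqP ->|ls].
    by rewrite ltr_wpDl ?w0.
  have lL : l \in L by apply: sL; rewrite inE ls orbT.
  by rewrite ltr_wpDr ?wp ?w0'.
move=> f e1 e2 rf; have [r ur Hr] := finite_rot D f e1 e2.
have E : rot D f e1 e2 = [set` r] by apply/seteqP; split => p /Hr.
have := sw _ _ _ rf; have := sw' _ _ _ rf; rewrite E -!fsbig_seq // => A B.
transitivity (\sum_(i <- r) w i.2 *: n i.2 + \sum_(i <- r) w' i.2 *: n i.2).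
  by rewrite -big_split; apply: eq_bigr => i _; rewrite scalerDl.
by rewrite A B addr0.
Qed.

(** The periods have a basis, and an additive function is determined by it. *)
Lemma periods_matrix k (al : 'rV[R]_d -> 'rV[R]_k) :
  (forall u v, periods u -> periods v -> al (u - v) = al u - al v) ->
  exists A : 'M[R]_(d, k), forall v, periods v -> al v = v *m A.
Proof.
move=> alB; have [B Bu BE] := periods_lattice D.
pose A := invmx B *m \matrix_i al (row i B); exists A => v.
have al0 : al 0 = 0.
  by have := alB 0 0 (@periods0 _ _ T) (@periods0 _ _ T); rewrite !subrr.
have pB i : periods (row i B).
  rewrite -BE; exists (delta_mx 0 i) => //; rewrite [map_mx _ _](_ : _ = delta_mx 0 i) -?rowE //.
  by apply/rowP => j; rewrite !mxE; case: (_ && _).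
have HG := @group_comb R d [set v | periods v /\ al v = v *m A].
rewrite -BE => -[z _ <-]; apply: (HG _ _ B z _).2.
- by split; [exact: periods0 | rewrite al0 mul0mx].
- move=> u u' [pu Eu] [pu' Eu']; split; first exact: periodsB.
  by rewrite alB // Eu Eu' mulmxBl.
move=> i; split=> //; rewrite -row_mul mulmxA mulmxV // mul1mx.
by apply/rowP => j; rewrite !mxE.
Qed.

Lemma potential_matrix k (a : 'rV[R]_d -> 'rV[R]_k) (be : 'rV[R]_d -> 'rV[R]_k) :
  (forall t l, T t -> l \in L -> a (t + l) = a t + be l) ->
  exists A : 'M[R]_(d, k), (forall l, l \in L -> be l = l *m A) /\
    forall t t', T t -> T t' -> a t' - a t = (t' - t) *m A.
Proof.
move=> Ha; have [t0 T0 _] := covered D 0.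
pose al v := a (t0 + v) - a t0.
have alE t v : T t -> periods v -> a (t + v) - a t = al v.
  move=> Tt pv; apply: (@cells_induction _ _ _ _ D
    [set t | a (t + v) - a t = al v] t0 t T0 Tt) => //= u l Tu lL <-.
  rewrite addrAC (Ha (u + v) l) ?(Ha u l) //; last exact/(pv u).
  by rewrite opprD addrACA subrr addr0.
have [u v pu pv|A HA] := @periods_matrix _ al.
  have Tv : T (t0 - v) by apply/(pv _); rewrite subrK.
  have := alE _ _ Tv pu; have := alE _ _ Tv pv; rewrite subrK => <- <-.
  by rewrite opprB addrA subrK /al -addrA [- v + u]addrC.
exists A; split=> [l lL|t t' Tt Tt'].
  have pl := periods_fvec lL.
  by rewrite -HA // -(alE _ _ T0 pl) Ha // addrC addKr.
have pt := periods_cells D Tt Tt'.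
by rewrite -HA // -(alE _ _ Tt pt) [t + _]addrC subrK.
Qed.

Section Quadratic.
Variable w : 'rV[R]_d -> R.
Hypothesis sw : periodic_solution w.

Lemma weight_gradient_anti : anti D (fun _ l => w l *: n l).
Proof.
by have [_ ws _] := sw; move=> t l Tt lL; rewrite ws // nrmN // scalerN.
Qed.

(** The potential of the gradients w(l) n l has differences that do not depend on
    the cell, hence it is additive on the periods. *)
Lemma gradient_matrix : exists A : 'M[R]_d, forall l, l \in L -> l *m A = w l *: n l.
Proof.
have [_ _ sS] := sw.
have [a Ha] := potential sS weight_gradient_anti.
have [A [HA _]] := potential_matrix Ha.
by exists A => l lL; rewrite HA.
Qed.

(** The function with gradient w(l) n l across the facet (t, l) that vanishes on
    this facet has constant term - w(l) (h l + n l . t). Around a codimension two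
    face, at a point f of this face, these constants add up to the scalar
    product of f with the sum of the w(l) n l. *)
Lemma offset_potential : exists c : 'rV[R]_d -> R, forall t l, T t -> l \in L ->
  c (t + l) = c t - w l * (h l + dot (n l) t).
Proof.
have [_ ws sS] := sw; pose j t l : R^o := - (w l * (h l + dot (n l) t)).
have sj : star D j.
  move=> f e1 e2 rf; have [r ur Hr] := finite_rot D f e1 e2.
  have E : rot D f e1 e2 = [set` r] by apply/seteqP; split => p /Hr.
  have := sS _ _ _ rf; rewrite E -!fsbig_seq // => /(congr1 (fun y => - dot y f)).
  rewrite dot0l oppr0 dot_suml -sumrN => H; etransitivity; last exact: H.
  apply: eq_big_seq => p /Hr[_ _ /tightP[_ pf] _].
  by rewrite dotZl /j -pf dotDr dotNr subrK.
have aj : anti D j.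
  move=> t l Tt lL; rewrite /j ws // hgtN // nrmN // dotNl dotDr.
  by congr (- _); rewrite -mulrN; congr (_ * _); ring.
have [c Hc] := potential sj aj.
by exists c => t l Tt lL; rewrite Hc.
Qed.

Variable A : 'M[R]_d.
Hypothesis HA : forall l, l \in L -> l *m A = w l *: n l.

(** The constant terms are reached in two ways: first through l, then through m,
    and conversely. The mixed terms have to agree. *)
Lemma form_symmetric : A^T = A.
Proof.
have [t0 T0 _] := covered D 0; have [c Hc] := offset_potential.
have sym l m : l \in L -> m \in L -> dot (l *m A) m = dot (m *m A) l.
  move=> lL mL; have Tl := step T0 lL; have Tm := step T0 mL.
  have := Hc _ _ Tl mL; have := Hc _ _ Tm lL; rewrite addrAC => ->.
  rewrite (Hc _ _ T0 lL) (Hc _ _ T0 mL) !HA // !dotZl !dotDr; lra.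
have H l : l \in L -> l *m A = l *m A^T.
  move=> lL; apply/eqP; rewrite -subr_eq0; apply/eqP; apply: (@fvec_spans _ _ _ _ D) => m mL.
  by rewrite dotDr dotNr -dot_mulmx -(sym l m lL mL) dotC subrr.
have H' x : x *m A = x *m A^T.
  apply/eqP; rewrite -subr_eq0; apply/eqP; apply: (@fvec_spans _ _ _ _ D) => m mL.
  by rewrite dotDr dotNr -{1}[A]trmxK -!dot_mulmx H // subrr.
by apply/row_matrixP => i; rewrite !rowE H'.
Qed.

Lemma form_sym x y : dot (x *m A) y = dot (y *m A) x.
Proof. by rewrite dot_mulmx form_symmetric dotC. Qed.

(** On a generic segment between the two cells, each facet that is crossed
    contributes w(l) n l . (q - p) > 0. The ends p and q are only known up to
    points x and y of P. *)
Lemma form_cells t t' : T t -> T t' -> exists x y,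
  [/\ P x, P y & 0 <= dot ((t' - t) *m A) (t' - t + (y - x))].
Proof.
move=> Tt Tt'; have [w0 _ _] := sw; have [p [q [tp tq H]]] := walk D Tt Tt'.
exists (p - t), (q - t'); split; [exact: (inside_cell tp) | exact: (inside_cell tq) |].
have -> : t' - t + (q - t' - (p - t)) = q - p.
  by apply/rowP => i; rewrite !mxE; ring.
apply: (H (fun u => 0 <= dot ((u - t) *m A) (q - p))).
  by rewrite subrr mul0mx dot0l.
move=> u l Tu lL Qu lpos; rewrite addrAC mulmxDl dotDl (HA lL) dotZl.
by rewrite addr_ge0 // mulr_ge0 ?ltW // w0.
Qed.

Lemma form_bilinear_bound : exists2 K, 0 <= K & forall x y a b,
  `|x| <= a -> `|y| <= b -> `|dot (x *m A) y| <= K * a * b.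
Proof.
suff [K K0 HK] : exists2 K, 0 <= K & forall x y, `|dot (x *m A) y| <= K * `|x| * `|y|.
  exists K => // x y a b xa yb; apply: le_trans (HK x y) _.
  by apply: ler_pM; rewrite ?mulr_ge0 // ler_wpM2l.
exists (d%:R * \sum_i `|row i A|) => [|x y].
  by rewrite mulr_ge0 ?sumr_ge0.
apply: le_trans (dot_norm_le _ _) _; rewrite -!mulrA ler_wpM2l // mulrA ler_wpM2r //.
exact: norm_mulmx.
Qed.

(** The vector k x is a difference of two cells up to a bounded error. So the
    previous inequality gives k^2 A(x, x) >= - k C1 - C2 for all k. *)
Lemma form_ge0 x : 0 <= dot (x *m A) x.
Proof.
rewrite leNgt; apply/negP => Qx.
have [t0 T0 _] := covered D 0; have [M HM] := bounded D.
have [K K0 HK] := form_bilinear_bound.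
have [q qE] : {q | q = - dot (x *m A) x} by eexists.
have q0 : 0 < q by rewrite qE oppr_gt0.
pose N := M + `|t0|; pose N' := N + (M + M).
(* C1 and C2 bound the terms of degree one and zero in k *)
pose C1 := K * N * `|x| + K * `|x| * N'; pose C2 := K * N * N'.
have M0 : 0 <= M by apply: le_trans (HM _ (ctr_cell D)); exact: normr_ge0.
have N0 : 0 <= N by rewrite addr_ge0.
have N'0 : 0 <= N' by rewrite !addr_ge0.
have C10 : 0 <= C1 by rewrite addr_ge0 ?mulr_ge0.
have C20 : 0 <= C2 by rewrite !mulr_ge0.
have bound (k : nat) : k%:R * k%:R * q <= k%:R * C1 + C2.
  (* k x is within M of the cell t *)
  have [t Tt Pt] := covered D (k%:R *: x).
  have [y [z [Py Pz]]] := form_cells T0 Tt.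
  have [e eE] : {e | e = t - t0 - k%:R *: x} by eexists.
  have tE : t - t0 = k%:R *: x + e by rewrite eE [RHS]addrC subrK.
  rewrite tE -addrA; have [e' eE'] : {e' | e' = e + (z - y)} by eexists.
  rewrite -eE' => Q0.
  have eN : `|e| <= N.
    have -> : e = - (k%:R *: x - t) - t0.
      by rewrite eE; apply/rowP => i; rewrite !mxE; ring.
    by apply: le_trans (ler_normB _ _) _; rewrite normrN lerD2r HM.
  have eN' : `|e'| <= N'.
    rewrite eE'; apply: le_trans (ler_normD _ _) _; apply: lerD => //.
    by apply: le_trans (ler_normB _ _) _; rewrite lerD ?HM.
  have B1 := HK _ _ _ _ eN (lexx `|x|); have B2 := HK _ _ _ _ (lexx `|x|) eN'.
  have B3 := HK _ _ _ _ eN eN'.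
  rewrite mulmxDl -scalemxAl !dotDl !dotZl !dotDr !dotZr in Q0.
  have k0 : 0 <= k%:R :> R by [].
  have D1 : k%:R * dot (e *m A) x <= k%:R * (K * N * `|x|).
    by rewrite ler_wpM2l // (le_trans (ler_norm _)).
  have D2 : k%:R * dot (x *m A) e' <= k%:R * (K * `|x| * N').
    by rewrite ler_wpM2l // (le_trans (ler_norm _)).
  have D3 : dot (e *m A) e' <= C2 by rewrite (le_trans (ler_norm _)).
  rewrite /C1 qE mulrDr; lra.
pose k := (Num.truncn ((C1 + C2) / q)).+1.
have := truncnS_gt ((C1 + C2) / q); rewrite -/k ltr_pdivrMr // => kq.
have k1 : 1 <= k%:R :> R by rewrite ler1n.
have := bound k; rewrite leNgt => /negP; apply.
apply: le_lt_trans (_ : k%:R * (C1 + C2) < _).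
  by rewrite (mulrDr k%:R C1 C2) lerD2l ler_peMl.
by rewrite -mulrA ltr_pM2l // (lt_le_trans ltr01).
Qed.

(** By Cauchy and Schwarz a null vector x satisfies A(x, l) = 0 for all l, so it is
    orthogonal to all normals, and P would contain a line. *)
Lemma form_gt0 x : x != 0 -> 0 < dot (x *m A) x.
Proof.
move=> x0; rewrite lt_def form_ge0 andbT; apply/eqP => Qx.
have xA y : dot (x *m A) y = 0.
  apply/eqP/negPn/negP => b0; set b := dot _ y in b0.
  have H (s : R) : 0 <= 2 * s * b + s ^+ 2 * dot (y *m A) y.
    have := form_ge0 (x + s *: y); rewrite mulmxDl -scalemxAl !dotDl !dotZl !dotDr !dotZr.
    rewrite Qx [dot (y *m A) x]form_sym -/b add0r; lra.
  have [q qE] : {q | q = dot (y *m A) y} by eexists.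
  have q0 : 0 <= q by rewrite qE form_ge0.
  have := H (- b / (q + 1)); rewrite -qE.
  have -> : 2 * (- b / (q + 1)) * b + (- b / (q + 1)) ^+ 2 * q =
      - (b ^+ 2 * (q + 2) / (q + 1) ^+ 2) by field; rewrite gt_eqF ?ltr_wpDl.
  rewrite oppr_ge0 leNgt => /negP; apply.
  have b2 : 0 < b ^+ 2 by rewrite exprn_even_gt0 //= b0.
  by rewrite divr_gt0 //; [rewrite mulr_gt0 //; lra | rewrite exprn_gt0 //; lra].
move/eqP: x0; apply; have [M HM] := bounded D.
apply: (bounded_periodic HM (ctr_cell D)) => y /(cellE D) Py; apply/(cellE D) => l lL.
have [w0 _ _] := sw; have : w l * dot (n l) x = 0.
  by rewrite -dotZl -HA // form_sym xA.
move=> /eqP; rewrite mulf_eq0 gt_eqF ?w0 //= => /eqP nx.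
by rewrite dotDr nx addr0; exact: Py.
Qed.

Lemma form_pos_def : pos_def A.
Proof. by split; [exact: form_symmetric | exact: form_gt0]. Qed.

(** The sum of the constant terms and of half the quadratic form is additive on
    the periods, so it is given by a vector; this vector determines the centre. *)
Lemma cell_form : exists p, forall x,
  P x <-> forall l, l \in L -> 2 * dot (l *m A) (x - p) <= dot (l *m A) l.
Proof.
have [w0 _ _] := sw; have [t0 T0 _] := covered D 0; have [c Hc] := offset_potential.
pose e t : 'rV[R]_1 := (c t + dot ((t - t0) *m A) (t - t0) / 2)%:M.
pose be l : 'rV[R]_1 := (w l * (dot (n l) l / 2 - h l - dot (n l) t0))%:M.
have He t l : T t -> l \in L -> e (t + l) = e t + be l.
  move=> Tt lL; rewrite /e /be -raddfD Hc //=; congr (_%:M).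
  have -> : t + l - t0 = t - t0 + l by rewrite addrAC.
  rewrite mulmxDl !dotDl !dotDr [dot ((t - t0) *m A) l]form_sym (HA lL) !dotZl.
  by rewrite !dotDr !dotNr; field.
have [b [Hb _]] := potential_matrix He.
have Au := pos_def_unit form_pos_def.
pose p' : 'rV[R]_d := b^T *m invmx A; exists (- (t0 + p')) => x.
have hE l : l \in L -> h l = dot (n l) l / 2 - dot (n l) (t0 + p').
  move=> lL; have /(congr1 (fun M : 'M[R]_1 => M 0 0)) := Hb l lL.
  rewrite /be mxE eqxx mulr1n.
  have -> : (l *m b) 0 0 = w l * dot (n l) p'.
    rewrite -dotZl -HA // form_sym /p' mulmxKV // dotC.
    by rewrite mxE; apply: eq_bigr => k _; rewrite mxE.
  by move=> /(mulfI (lt0r_neq0 (w0 l lL))) E; rewrite dotDr; lra.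
have E l : l \in L -> (2 * dot (l *m A) (x - - (t0 + p')) <= dot (l *m A) l) = (dot (n l) x <= h l).
  move=> lL; rewrite HA // !dotZl mulrCA ler_pM2l ?w0 // hE // opprK dotDr.
  by apply/idP/idP; lra.
split=> [/(cellE D) Px l lL|H]; first by rewrite E //; exact: Px.
by apply/(cellE D) => l lL; rewrite -E //; exact: H.
Qed.

End Quadratic.

End Form.

(** * Dirichlet domains *)

Lemma seq_min {R : realDomainType} (X : eqType) (s : seq X) (g : X -> R) (x0 : X) : x0 \in s ->
  exists2 x, x \in s & forall y, y \in s -> g x <= g y.
Proof.
elim: s x0 => // a s IH x0 _; case: s IH => [|b s] IH.
  by exists a; rewrite ?mem_head // => y; rewrite inE => /eqP ->.
have [x xs Hx] := IH b (mem_head _ _).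
have [ax|xa] := leP (g a) (g x).
  exists a; rewrite ?mem_head // => y; rewrite inE => /orP[/eqP -> //|/Hx].
  exact: le_trans.
exists x; first by rewrite inE xs orbT.
by move=> y; rewrite inE => /orP[/eqP ->|/Hx //]; exact: ltW.
Qed.

Section Voronoi.
Context {R : realType} {d : nat} {P T : set 'rV[R]_d} (D : facet_system P T).
Implicit Types (t u v x y z f l m : 'rV[R]_d).
Local Notation L := (fvec D).
Local Notation n := (nrm D).
Local Notation h := (hgt D).
Local Notation periods := (@periods _ _ T).

Variables (C : 'M[R]_d) (p : 'rV[R]_d).
Hypothesis Cu : C \in unitmx.
Local Notation A := (C *m C^T).
Hypothesis PE : forall x,
  P x <-> forall l, l \in L -> 2 * dot (l *m A) (x - p) <= dot (l *m A) l.

Lemma dot_cholesky x y : dot (x *m C) (y *m C) = dot (y *m A) x.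
Proof. by rewrite dotC mulmxA [RHS]dot_mulmx trmxK. Qed.

Lemma enorm_bounded (b : R) : exists M, forall y, dot (y *m C) (y *m C) <= b -> `|y| <= M.
Proof.
exists (\sum_i Num.sqrt b * `|row i (invmx C)|) => y yb.
rewrite -[y](mulmxK Cu) mulmx_sum_row; apply: le_trans (ler_norm_sum _ _ _) _.
apply: ler_sum => i _; rewrite normrZ ler_wpM2r //.
rewrite -sqrtr_sqr ler_sqrt; last by apply: le_trans yb; exact: dot_ge0.
apply: le_trans yb; rewrite /dot (bigD1 i) //= -expr2 lerDl.
by apply: sumr_ge0 => j _; rewrite -expr2 sqr_ge0.
Qed.

(** Let u be a period that is nearest to x - p for the norm of C. Comparison with the
    neighbours u + l shows that x - u belongs to P; but x is inside P, so
    that u = 0. *)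
Lemma strict_cell_nearest x v : (forall l, l \in L -> dot (n l) x < h l) ->
  periods v -> dot ((x - p) *m C) ((x - p) *m C) <= dot ((x - p - v) *m C) ((x - p - v) *m C).
Proof.
move=> Px pv; pose q y := dot (y *m C) (y *m C).
rewrite -![dot _ _]/(q _); rewrite leNgt; apply/negP => lt0.
have [t0 T0 _] := covered D 0.
have [M HM] := enorm_bounded (q (x - p)).
have F : finite_set [set u | periods u /\ q (x - p - u) <= q (x - p)].
  apply: sub_finite_set (finite_periods D (M + `|x - p|)) => u [/= pu qu]; split=> //.
  have -> : u = - (x - p - u) + (x - p) by rewrite opprB subrK.
  by apply: le_trans (ler_normD _ _) _; rewrite normrN lerD2r; exact: HM.
have /finite_seqP[s Hs] := F.
have sP u : u \in s <-> periods u /\ q (x - p - u) <= q (x - p).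
  by have := congr1 (fun Z => Z u) Hs; rewrite /= => ->.
have vs : v \in s by apply/sP; split=> //; exact: ltW.
(* only finitely many periods are as near as 0 *)
have [u us Hu] := seq_min (fun u => q (x - p - u)) vs.
have [pu qu] := (sP u).1 us.
have Pxu : P (x - u).
  apply/PE => l lL; have plu : periods (u + l) by apply: periodsD => //; exact: (periods_fvec lL).
  have le1 : q (x - p - u) <= q (x - p - u - l).
    have [big|small] := leP (q (x - p - (u + l))) (q (x - p)).
      by have := Hu (u + l); rewrite opprD addrA; apply; apply/sP.
    by rewrite -(addrA _ (- u)) -opprD; exact: le_trans qu (ltW small).
  have qB a b : q (a - b) = q a - 2 * dot (b *m A) a + dot (b *m A) b.
    rewrite /q mulmxBl !dotDl !dotDr !dotNl !dotNr opprK !dot_cholesky.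
    have -> : dot (a *m A) b = dot (b *m A) a by rewrite -!dot_cholesky dotC.
    by ring.
  move: le1; rewrite (qB _ l) (_ : x - u - p = x - p - u); last by rewrite addrAC.
  lra.
have u0 : u = 0.
  have Tu : T (t0 + u) by exact/(pu t0).
  have E : t0 = t0 + u.
    apply: (interior_disjoint (f := D) T0 Tu (x := x + t0)).
      by move=> l lL; rewrite addrK; exact: Px.
    by rewrite opprD addrA addrK.
  by apply: (addrI t0); rewrite addr0 -E.
by have := Hu v vs; rewrite u0 subr0 leNgt lt0.
Qed.

(** The inequality is closed, and inner points are dense in P. *)
Lemma cell_nearest x v : P x -> periods v -> 2 * dot (v *m A) (x - p) <= dot (v *m A) v.
Proof.
move=> Px pv; pose g y := 2 * dot (v *m A) (y - p) - dot (v *m A) v.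
suff : g x <= 0 by rewrite /g subr_le0.
have gE y (s : R) : g (x + s *: (y - x)) = g x + s * (g y - g x).
  by rewrite /g !dotDr !dotNr dotZr dotDr dotNr; ring.
have strict y : (forall l, l \in L -> dot (n l) y < h l) -> g y <= 0.
  move=> Py; have := strict_cell_nearest Py pv.
  rewrite (mulmxBl _ v) !dotDl !dotDr !dotNl !dotNr opprK !dot_cholesky.
  have -> : dot ((y - p) *m A) v = dot (v *m A) (y - p) by rewrite -!dot_cholesky dotC.
  rewrite /g; lra.
have near (s : R) : 0 < s -> s <= 1 -> g x + s * (g (ctr D) - g x) <= 0.
  move=> s0 s1; rewrite -gE; apply: strict => l lL.
  have := ctr_lt lL; have := (cellE D _).1 Px l lL.
  rewrite dotDr dotZr dotDr dotNr => A1 A2.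
  by nra.
rewrite leNgt; apply/negP => gx.
have gc : g (ctr D) <= 0 by apply: strict => l lL; exact: ctr_lt.
(* at this point of the segment from x to the centre g is half of g x *)
pose s := g x / (2 * (g x - g (ctr D))).
have den : 0 < g x - g (ctr D) by lra.
have := near s; have -> : g x + s * (g (ctr D) - g x) = g x / 2.
  by rewrite /s; field; rewrite gt_eqF.
have s0 : 0 < s by rewrite divr_gt0 // mulr_gt0.
have s1 : s <= 1 by rewrite ler_pdivrMr ?mulr_gt0 //; lra.
by move=> /(_ s0 s1); lra.
Qed.

(** The map x |-> (x - p) C takes P to the points that are nearer to 0 than to the
    other images of periods. *)
Lemma form_voronoi : voronoi_conjecture_holds P.
Proof.
have [B Bu BE] := periods_lattice D.
exists (dirichlet_domain (lattice (B *m C)) 0).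
  exists (B *m C), 0; split=> //; first by rewrite unitmx_mul Bu.
  by exists 0 => //; rewrite map_mx0 mul0mx.
exists C, (- (p *m C)); split=> //; apply/seteqP; split=> [y Hy|y [x Px <-]].
  exists (y *m invmx C + p); last by rewrite mulmxDl mulmxKV // addrK.
  apply/PE => l lL; rewrite addrK.
  have : lattice B l by rewrite BE; exact: (periods_fvec lL).
  move=> [z _ zl]; have := Hy (l *m C); rewrite -zl -mulmxA => /(_ (ex_intro2 _ _ z I erefl)).
  rewrite mulmxA zl subr0 enorm_le; set y' := y *m invmx C.
  have -> : y = y' *m C by rewrite mulmxKV.
  rewrite -mulmxBl mulmxBl !dotDl !dotDr !dotNl !dotNr opprK !dot_cholesky.
  have -> : dot (y' *m A) l = dot (l *m A) y' by rewrite -!dot_cholesky dotC.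
  lra.
move=> _ [z _ <-]; rewrite mulmxA; set v := _ *m B.
have pv : periods v by rewrite -BE; exists z.
rewrite subr0 enorm_le -mulmxBl; have near := cell_nearest Px pv.
rewrite -mulmxBl (mulmxBl _ v) !dotDl !dotDr !dotNl !dotNr opprK !dot_cholesky.
have -> : dot ((x - p) *m A) v = dot (v *m A) (x - p) by rewrite -!dot_cholesky dotC.
lra.
Qed.

End Voronoi.

Section Sufficiency.
Context {R : realType} {d : nat} {P T : set 'rV[R]_d} (D : facet_system P T).

Lemma scaling_solution (s : set 'rV[R]_d -> R) : canonical_scaling P T s ->
  solution D (fun t l => s (facet D t l)).
Proof.
move=> /(canonical_star D)[s0 sS]; split=> // t l Tt lL.
by rewrite facet_opp.
Qed.

Lemma scaling_voronoi (s : set 'rV[R]_d -> R) : canonical_scaling P T s ->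
  voronoi_conjecture_holds P.
Proof.
move=> /scaling_solution/periodic_solution_exists[w sw].
have [A HA] := gradient_matrix sw.
have [p PE] := cell_form sw HA; have pd := form_pos_def sw HA.
have [C AE] := cholesky pd; rewrite AE in PE.
apply: (@form_voronoi _ _ _ _ D C p) => //.
have := pos_def_unit pd.
by rewrite AE unitmx_mul => /andP[].
Qed.

End Sufficiency.

(** * Scalings of Voronoi parallelohedra *)

Section Telescope.
Context {R : realType} {d : nat} {P T : set 'rV[R]_d} (D : facet_system P T).
Implicit Types (t u v x y f l m : 'rV[R]_d).
Local Notation n := (nrm D).

Lemma rot_cell_uniq f e1 e2 t l m : ridge D f e1 e2 ->
  rot D f e1 e2 (t, l) -> rot D f e1 e2 (t, m) -> l = m.
Proof.
move=> rf [/= Tt Pt tl lpos] [/= _ _ tm mpos].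
have [k [k' [_ _ _ k'neg H]]] := diamond rf Tt Pt.
case: (H l tl) (H m tm) => [->|lk] [->|mk] //.
- by move: mpos; rewrite mk ltNge (ltW k'neg).
- by move: lpos; rewrite lk ltNge (ltW k'neg).
by rewrite lk mk.
Qed.

Lemma rot_fst_bij f e1 e2 : ridge D f e1 e2 ->
  set_bij (rot D f e1 e2) [set t | T t /\ P (f - t)] fst.
Proof.
move=> rf; split.
- by move=> [t l] [/= Tt Pt _ _].
- move=> [t l] [u m] /set_mem rt /set_mem ru /= E; subst u.
  by rewrite (rot_cell_uniq rf rt ru).
move=> t [Tt Pt]; have [l [_ [tl _ lpos _ _]]] := diamond rf Tt Pt.
by exists (t, l).
Qed.

Lemma rot_add_bij f e1 e2 : ridge D f e1 e2 ->
  set_bij (rot D f e1 e2) [set t | T t /\ P (f - t)] (fun p => p.1 + p.2).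
Proof.
move=> rf; split.
- move=> [t l] [/= Tt Pt tl _]; have /tightP[lL _] := tl.
  by split; [exact: (step Tt lL) | exact: neighbour_cell Pt tl].
- move=> [t l] [u m] /set_mem rt /set_mem ru /= E.
  have [/= Tt Pt tl lpos] := rt; have [/= Tu Pu um mpos] := ru.
  have /tightP[lL _] := tl.
  have := turn_neighbour rf Tt Pt tl; rewrite lpos => /idP l1.
  have := turn_neighbour rf Tu Pu um; rewrite mpos -E => /idP l2.
  have Tv := step Tt lL; have Pv := neighbour_cell Pt tl.
  have t1 := neighbour_tight tl; have t2 := neighbour_tight um; rewrite -E in t2.
  have [k [k' [_ _ kpos _ H]]] := diamond rf Tv Pv.
  have lm : - l = - m.
    case: (H _ t1) (H _ t2) => [lk|->] [mk|->] //; first by rewrite lk mk.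
      by move: l1; rewrite lk ltNge (ltW kpos).
    by move: l2; rewrite mk ltNge (ltW kpos).
  by have /oppr_inj E2 := lm; subst m; have /addIr -> := E.
move=> t [Tt Pt]; have [l [_ [tl _ lpos _ _]]] := diamond rf Tt Pt.
have rt : rot D f e1 e2 (t, l) by [].
have [m [_ rm _ _]] := rot_other rf rt.
by exists (t + m, - m) => //=; rewrite addrK.
Qed.

(** The vector l leads from a cell at f to the next one, and every cell at f is
    left once and reached once. *)
Lemma rot_telescope f e1 e2 r : ridge D f e1 e2 -> uniq r ->
  (forall p, p \in r <-> rot D f e1 e2 p) -> \sum_(p <- r) p.2 = 0.
Proof.
move=> rf ur Hr.
have E : rot D f e1 e2 = [set` r] by apply/seteqP; split => p /Hr.
have := reindex_fsbig (idx := 0) (op := +%R) _ _ _ id (rot_fst_bij rf).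
rewrite (reindex_fsbig _ _ _ id (rot_add_bij rf)) E -!fsbig_seq //=.
by rewrite big_split /= addrC => H; apply: (addIr (\sum_(p <- r) p.1)); rewrite H add0r.
Qed.

(** The scaling is s(t, l) = n l . (l A), and its torsion is the image by A of a
    vanishing sum. *)
Lemma form_canonical (A : 'M[R]_d) : (forall l, l \in fvec D ->
    0 < dot (n l) (l *m A) /\ l *m A = dot (n l) (l *m A) *: n l) ->
  exists s, canonical_scaling P T s.
Proof.
move=> HA; pose w l := dot (n l) (l *m A).
pose s G := xget 1 [set k | exists t l, [/\ T t, l \in fvec D, G = facet D t l & k = w l]].
have wN l : l \in fvec D -> w (- l) = w l.
  by move=> lL; rewrite /w nrmN // mulNmx dotNl dotNr opprK.
have sE t l : T t -> l \in fvec D -> s (facet D t l) = w l.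
  move=> Tt lL; rewrite /s; case: xgetP => [k _ [u [m [Tu mL E ->]]]|/(_ (w l))]; last first.
    by case; exists t, l.
  by case: (facet_inj Tt lL Tu mL E) => -[_ ->] //; exact: wN.
exists s; apply/(canonical_star D); split=> [t l Tt lL|f e1 e2 rf].
  by rewrite sE //; case: (HA l lL).
have [r ur Hr] := finite_rot D f e1 e2.
have E : rot D f e1 e2 = [set` r] by apply/seteqP; split => p /Hr.
transitivity ((\sum_(p <- r) p.2) *m A); last by rewrite (rot_telescope rf ur Hr) mul0mx.
rewrite E -fsbig_seq // mulmx_suml; apply: eq_big_seq => p /Hr[Tp _ /tightP[pL _] _].
by rewrite sE //; case: (HA p.2 pL).
Qed.

End Telescope.

Section Necessity.
Context {R : realType} {d : nat} {P T : set 'rV[R]_d} (D : facet_system P T).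
Implicit Types (t u v x y f l m : 'rV[R]_d).
Local Notation L := (fvec D).
Local Notation n := (nrm D).
Local Notation h := (hgt D).

Lemma finite_lattice (B : 'M[R]_d) (M : R) : B \in unitmx ->
  finite_set [set u | lattice B u /\ `|u| <= M].
Proof.
move=> Bu; pose K := \sum_i `|row i (invmx B)|.
pose N := (Num.truncn (K * M)).+1.
apply: sub_finite_set (finite_image (fun z => map_mx intr z *m B) (finite_bounded_int d N)).
move=> _ [[z _ <-] zM]; exists z => //= i.
have K0 : 0 <= K by rewrite sumr_ge0.
have : `|(z 0 i)%:~R : R| <= K * M.
  have -> : (z 0 i)%:~R = (map_mx intr z *m B *m invmx B) 0 i by rewrite mulmxK // mxE.
  apply: le_trans (coord_norm _ _) _; apply: le_trans (norm_mulmx _ _) _.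
  by rewrite ler_wpM2l.
move=> /le_lt_trans/(_ (truncnS_gt _)); rewrite -/N -intr_norm -natr_absz ltr_nat.
exact: ltnW.
Qed.

Variables (C B : 'M[R]_d) (c : 'rV[R]_d).
Hypotheses (Cu : C \in unitmx) (Bu : B \in unitmx).
Local Notation A := (C *m C^T).
Local Notation q y := (dot (y *m A) y).
Hypothesis PE : forall x, P x <-> forall v, lattice B v -> 2 * dot (v *m A) (x - c) <= q v.

Lemma latticeD u v : lattice B u -> lattice B v -> lattice B (u + v).
Proof. by move=> [y _ <-] [z _ <-]; exists (y + z) => //; rewrite map_mxD mulmxDl. Qed.

Lemma latticeN v : lattice B v -> lattice B (- v).
Proof. by move=> [z _ <-]; exists (- z) => //; rewrite map_mxN mulNmx. Qed.

Lemma gram_sym x y : dot (x *m A) y = dot (y *m A) x.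
Proof. by rewrite -!(dot_cholesky C) dotC. Qed.

Lemma gram_gt0 v : v != 0 -> 0 < q v.
Proof.
move=> v0; rewrite -dot_cholesky lt_def dot_ge0 andbT dot_eq0.
by apply: contra v0 => /eqP E; rewrite -[v](mulmxK Cu) E mul0mx.
Qed.

Lemma gramB x y : q (x - y) = q x - 2 * dot (y *m A) x + q y.
Proof.
rewrite mulmxBl !dotDl !dotDr !dotNl !dotNr opprK [dot (x *m A) y]gram_sym.
by ring.
Qed.

(** If no constraint were an equality at the point [apt D l], then only finitely
    many of them could fail nearby, and one could leave P through this point. *)
Lemma active_vector l : l \in L -> exists v, [/\ lattice B v, v != 0 &
  2 * dot (v *m A) (apt D l - c) = q v].
Proof.
move=> lL; set a := apt D l; apply: contrapT => no.
have Pa : P a by have := apt_cell (D := D) 0 lL; rewrite subr0 addr0.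
have strict v : lattice B v -> v != 0 -> 2 * dot (v *m A) (a - c) < q v.
  move=> Bv v0; rewrite lt_neqAle ((PE a).1 Pa) // andbT; apply/eqP => E.
  by apply: no; exists v.
pose x (k : R) := a + k *: n l.
have [M HM] : exists M, forall y k, 0 <= k <= 1 -> q y <= q (x k - c) -> `|y| <= M.
  pose b := q (a - c) + 2 * `|dot (n l *m A) (a - c)| + q (n l).
  have [M HM] := enorm_bounded Cu b; exists M => y k /andP[k0 k1] qy.
  apply: HM; rewrite dot_cholesky; apply: le_trans qy _.
  have -> : x k - c = (a - c) - (- k) *: n l.
    by rewrite /x scaleNr opprK addrAC.
  rewrite gramB -!scalemxAl !dotZl dotZr.
  have e1 : 0 <= q (n l) by rewrite -dot_cholesky dot_ge0.
  have e2 : k * k * q (n l) <= q (n l).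
    by rewrite ler_piMl // mulr_ile1.
  have e3 : k * dot (n l *m A) (a - c) <= `|dot (n l *m A) (a - c)|.
    apply: le_trans (ler_norm _) _; rewrite normrM ger0_norm //.
    by rewrite ler_piMl.
  rewrite /b; lra.
have F : finite_set [set v | lattice B v /\ `|v| <= M + (`|a - c| + `|n l|)].
  exact: finite_lattice.
have /finite_seqP[s Hs] := F.
have sP v : v \in s <-> lattice B v /\ `|v| <= M + (`|a - c| + `|n l|).
  by have := congr1 (fun Z => Z v) Hs; rewrite /= => ->.
have [e [e0 e1 He]] : exists e : R, [/\ 0 < e, e <= 1 & forall v, v \in s -> v != 0 ->
    2 * dot (v *m A) (x e - c) <= q v].
  have step e v : 0 < e -> e <= 1 -> 2 * dot (v *m A) (a - c) < q v ->
      exists e', [/\ 0 < e', e' <= e & forall k, 0 <= k -> k <= e' -> 2 * dot (v *m A) (x k - c) <= q v].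
    move=> e0 e1 sv; set g := 2 * `|dot (v *m A) (n l)| + 1.
    have g0 : 0 < g by rewrite ltr_wpDl // mulr_ge0.
    exists (Num.min e ((q v - 2 * dot (v *m A) (a - c)) / g)); split.
    - by rewrite lt_min e0 divr_gt0 // subr_gt0.
    - by rewrite ge_min lexx.
    move=> k k0; rewrite le_min => /andP[_]; rewrite ler_pdivlMr // => kg.
    have -> : x k - c = (a - c) + k *: n l by rewrite /x addrAC.
    rewrite dotDr dotZr.
    have : k * dot (v *m A) (n l) <= k * `|dot (v *m A) (n l)|.
      by rewrite ler_wpM2l // ler_norm.
    by rewrite /g in kg; lra.
  suff [e [e0 e1 He]] : exists e : R, [/\ 0 < e, e <= 1 & forall v, v \in s -> v != 0 ->
      forall k, 0 <= k -> k <= e -> 2 * dot (v *m A) (x k - c) <= q v].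
    by exists e; split=> // v vs v0; apply: He => //; exact: ltW.
  have : forall v, v \in s -> lattice B v by move=> v /sP[].
  elim: (s) => [|v s' IH] sB; first by exists 1; split.
  have [|e [e0 e1 He]] := IH; first by move=> y ys; apply: sB; rewrite inE ys orbT.
  have [v0|v0] := eqVneq v 0.
    by exists e; split=> // y; rewrite inE => /orP[/eqP -> /eqP //|/He].
  have [e' [e'0 e'e He']] := step e v e0 e1 (strict v (sB v (mem_head _ _)) v0).
  exists e'; split=> //; first exact: le_trans e1.
  move=> y; rewrite inE => /orP[/eqP -> _ //|ys y0 k k0 ke].
  by apply: He => //; exact: le_trans e'e.
have Px : P (x e).
  apply/PE => v Bv; have [->|v0] := eqVneq v 0.
    by rewrite mul0mx !dot0l mulr0.
  have [vs|vs] := boolP (v \in s); first exact: He.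
  have big : q (x e - c) < q (x e - c - v).
    rewrite ltNge; apply/negP => qy.
    have e01 : 0 <= e <= 1 by rewrite (ltW e0).
    have vM := HM _ _ e01 qy; case/negP: vs; apply/sP; split=> //.
    have -> : v = - (x e - c - v) + (x e - c) by rewrite opprB subrK.
    apply: le_trans (ler_normD _ _) _; rewrite normrN lerD //.
    have -> : x e - c = a - c + e *: n l by rewrite /x addrAC.
    apply: le_trans (ler_normD _ _) _; rewrite lerD2l normrZ (ger0_norm (ltW e0)).
    by rewrite ler_piMl.
  by move: big; rewrite (gramB _ v); lra.
have := (cellE D _).1 Px l lL; rewrite /x dotDr dotZr apt_eq // nrm1 // mulr1.
by rewrite gerDl leNgt e0.
Qed.

(** The constraint v of the Dirichlet domain that is active on the facet l has
    normal v A, a positive multiple of n l. Moving the facet by - v or by - l gives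
    in both cases the opposite facet of P, hence v = l. *)
Lemma facet_vector l : l \in L ->
  0 < dot (n l) (l *m A) /\ l *m A = dot (n l) (l *m A) *: n l.
Proof.
move=> lL; have [v [Bv v0 va]] := active_vector lL.
have vA0 : v *m A != 0.
  by apply/eqP => E; have := gram_gt0 v0; rewrite E dot0l ltxx.
have vmax x : P x -> dot (v *m A) x <= dot (v *m A) (apt D l).
  by move=> /PE/(_ v Bv); move: va; rewrite !dotDr; lra.
have [k0 kE] := max_at_facet_point (fvec_uniq D) (cellE D) (@nrm1 _ _ _ _ D) (@apt_eq _ _ _ _ D)
  (@apt_lt _ _ _ _ D) (@ctr_lt _ _ _ _ D) lL vA0 vmax.
suff lv : l = v by move: k0 kE; rewrite -lv.
have NL := fvecN lL; have [M HM] := bounded D.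
apply/eqP; rewrite -subr_eq0; apply/eqP.
apply: (@bounded_periodic _ _ [set x | P x /\ dot (n l) x = h l] M (apt D l)).
- by move=> x [/HM].
- split; last exact: apt_eq.
  by have := apt_cell (D := D) 0 lL; rewrite subr0 addr0.
move=> x [Px xl].
have xv : 2 * dot (v *m A) (x - c) = q v.
  by rewrite -va !dotDr kE !dotZl xl apt_eq.
have Pxv : P (x - v).
  apply/PE => u Bu'; have Buv := latticeD Bu' Bv.
  have := (PE x).1 Px _ Buv.
  have -> : x - v - c = x - c - v by rewrite addrAC.
  rewrite mulmxDl !dotDl !dotDr !dotNr; have := gram_sym u v.
  move: xv; rewrite !dotDr !dotNr; lra.
(* - v A is a positive multiple of n (- l), and it is maximal at x - v *)
have tight' : dot (n (- l)) (x - v) = h (- l).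
  apply/eqP; rewrite eq_le (cellE D _).1 //=.
  have Pa' : P (apt D (- l)) by have := apt_cell (D := D) 0 NL; rewrite subr0 addr0.
  rewrite -(apt_eq NL) nrmN // !dotNl lerN2.
  rewrite -(ler_pM2l k0) -!dotZl -kE.
  have := (PE _).1 Pa' _ (latticeN Bv); rewrite !mulNmx !dotNl !dotNr opprK.
  move: xv; rewrite !dotDr !dotNr; have := gram_sym v v; lra.
have Pn : P (x - v - - l) by exact: (adj NL Pxv tight').
split=> /=; first by rewrite opprK addrAC -addrA in Pn.
move: tight'; rewrite nrmN // hgtN // dotNl !dotDr !dotNr; lra.
Qed.

Lemma gram_scaling : exists s, canonical_scaling P T s.
Proof. by apply: (form_canonical (D := D) (A := A)) => l; exact: facet_vector. Qed.

End Necessity.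

Section Conclusion.
Context {R : realType} {d : nat} {P T : set 'rV[R]_d} (D : facet_system P T).

(** The affine map transports the constraints of the Dirichlet domain to P. *)
Lemma voronoi_scaling : voronoi_conjecture_holds P -> exists s, canonical_scaling P T s.
Proof.
move=> [Q [B [p [Bu Bp QE]]] [C [b [Cu PQ]]]].
pose c := (p - b) *m invmx C; pose B' := B *m invmx C.
have B'u : B' \in unitmx by rewrite unitmx_mul Bu unitmx_inv.
have latE v : lattice B (v *m C) <-> lattice B' v.
  split=> [[z _ E]|[z _ <-]]; exists z => //; last by rewrite -!mulmxA mulVmx // mulmx1.
  by rewrite /B' mulmxA E mulmxK.
have xc x : x *m C + b - p = (x - c) *m C.
  by rewrite mulmxBl mulmxKV // opprB addrA.
apply: (@gram_scaling _ _ _ _ D C B' c) => // x.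
have PxE : P x <-> Q (x *m C + b).
  rewrite PQ; split=> [Px|[y Py /addIr E]]; first by exists x.
  by rewrite -(mulmxK Cu x) -E mulmxK.
rewrite PxE QE; split=> [H v /latE Bv|H r Br].
  have := H (p + v *m C) (latticeD Bp Bv).
  rewrite opprD addrA xc enorm_le -mulmxBl !dot_cholesky (gramB C (x - c)); lra.
have /latE Bv : lattice B ((r - p) *m invmx C *m C).
  by rewrite mulmxKV //; exact: (latticeD Br (latticeN Bp)).
rewrite enorm_le xc; have -> : x *m C + b - r = (x - c - (r - p) *m invmx C) *m C.
  by rewrite mulmxBl mulmxKV // -xc opprB addrA subrK.
by rewrite !dot_cholesky (gramB C (x - c)); have := H _ Bv; lra.
Qed.

End Conclusion.

Theorem mainTheorem1 (R : realType) (d : nat) (P T : set 'rV[R]_d)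
    (hP : parallelohedron P) (hT : face_to_face_tiling P T) :
  voronoi_conjecture_holds P <->
  exists s : set 'rV[R]_d -> R, canonical_scaling P T s.
Proof.
have [Ppoly Pdim _] := hP; have [D] := facet_system_exists Ppoly Pdim hT.
split; first exact: (voronoi_scaling D).
by move=> [s]; exact: (scaling_voronoi D).
Qed.
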